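(* Let $0<\alpha<\frac{\pi}{2}$ and let $v_0\in H^3(\mathbb{R}^2;\mathbb{R}^2)$ with $\operatorname{div} v_0=0$. Let $\omega_0=\partial_1 v_{0,2}-\partial_2 v_{0,1}$ be the initial vorticity, and let $v$ be the unique (maximal) solution, continuous in time with values in $H^3$, of $$v_t+\mathbb{P}\left(\mathcal{R}_{-\alpha}(v)\cdot\nabla v\right)=0,\qquad \operatorname{div} v=0,\qquad v|_{t=0}=v_0.$$ If $\min_{x\in\mathbb{R}^2}\omega_0(x)<0$, then $v$ cannot exist globally in time. Moreover, the blow-up time $T^*$ is bounded above as $$T^*\le -\frac{2}{\sin\alpha\ \min_{x\in\mathbb{R}^2}\omega_0(x)}.$$
   Context: All functions are defined on $\mathbb{R}^2$ (and time). $\mathbb{P}$ is the Leray projection onto divergence-free vector fields. For a vector field $v=(v_1,v_2)$, $\mathcal{R}_{-\alpha}(v)=\big(\cos\alpha\, v_1+\sin\alpha\, v_2,\ -\sin\alpha\, v_1+\cos\alpha\, v_2\big)$, and $\mathcal{R}_{-\alpha}(v)\cdot\nabla v=\sum_{j=1}^2 (\mathcal{R}_{-\alpha}(v))_j\,\partial_j v$. For every divergence-free $v_0\in H^3$ the equation has a unique local-in-time solution $v\in C([0,T);H^3)$; $T^*$ denotes its maximal existence time. *)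

(* Defs.v *)
From HB Require Import structures.
From mathcomp Require Import all_boot all_order all_algebra.
From mathcomp Require Import all_classical all_reals all_analysis.
Import Order.TTheory GRing.Theory Num.Theory.
Import numFieldNormedType.Exports.

Set Implicit Arguments.
Unset Strict Implicit.
Unset Printing Implicit Defensive.

Local Open Scope classical_set_scope.
Local Open Scope ring_scope.

Notation scalar_field R := (R * R -> R) (only parsing).
Notation vector_field R := (R * R -> R * R) (only parsing).

Section Plane.
Variable R : realType.
Implicit Types (u g phi : scalar_field R) (v w f p : vector_field R).

Definition leb2 : {measure set (measurableTypeR R * measurableTypeR R) -> \bar R} :=
  (@lebesgue_measure R \x @lebesgue_measure R)%E.

Definition comp1 v : scalar_field R := fun x => (v x).1.
Definition comp2 v : scalar_field R := fun x => (v x).2.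

Definition d1 phi : scalar_field R := fun x => 'D_((1, 0) : R * R) phi x.
Definition d2 phi : scalar_field R := fun x => 'D_((0, 1) : R * R) phi x.

Fixpoint C_ (n : nat) phi : Prop :=
  continuous phi /\
  if n is n'.+1 then
    [/\ forall x, derivable phi x ((1, 0) : R * R),
        forall x, derivable phi x ((0, 1) : R * R),
        C_ n' (d1 phi) & C_ n' (d2 phi)]
  else True.

Definition test_function phi : Prop :=
  (forall n, C_ n phi) /\ compact (closure [set x | phi x != 0]).

(** Functions equal almost everywhere are not
    identified: all the notions below are invariant under such changes. *)

Definition L2 u : Prop := u \in Lfun leb2 2%:E.
Definition L2v v : Prop := L2 (comp1 v) /\ L2 (comp2 v).

Definition normL2 u : \bar R := 'N[leb2]_2%:E[EFin \o u].
Definition normL2v v : \bar R :=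
  sqrte (normL2 (comp1 v) ^+ 2 + normL2 (comp2 v) ^+ 2)%E.

(** [g] is an L^2 function that is the weak derivative of [u] of
    multi-index [(a, b)] *)
Definition is_weak_partial (a b : nat) u g : Prop :=
  L2 g /\ forall phi, test_function phi ->
    \int[leb2]_x (u x * iter a d1 (iter b d2 phi) x) =
    (-1) ^+ (a + b) * \int[leb2]_x (g x * phi x).

(** A representative of the weak derivative; the default value is irrelevant
    for the functions of H^k and [a + b <= k] *)
Definition weak_partial (a b : nat) u : scalar_field R :=
  xget (cst 0) [set g | is_weak_partial a b u g].

Definition sobolev (k : nat) u : Prop :=
  L2 u /\ forall a b, (a + b <= k)%N -> exists g, is_weak_partial a b u g.
Definition sobolevv (k : nat) v : Prop :=
  sobolev k (comp1 v) /\ sobolev k (comp2 v).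

Definition normH (k : nat) u : \bar R :=
  sqrte (\sum_(a < k.+1) \sum_(b < k.+1 | (a + b <= k)%N)
    normL2 (weak_partial a b u) ^+ 2)%E.
Definition normHv (k : nat) v : \bar R :=
  sqrte (normH k (comp1 v) ^+ 2 + normH k (comp2 v) ^+ 2)%E.

(** In the sense of distributions, so that it applies to L^2 fields *)
Definition divergence_free v : Prop :=
  forall phi, test_function phi ->
    \int[leb2]_x ((v x).1 * d1 phi x + (v x).2 * d2 phi x) = 0.

Definition weak_curl v : scalar_field R :=
  fun x => weak_partial 1 0 (comp2 v) x - weak_partial 0 1 (comp1 v) x.

(** [p] is the Leray projection of [f], i.e. its orthogonal projection, in L^2,
    onto the closed subspace of divergence-free vector fields *)
Definition leray f p : Prop :=
  [/\ L2v f, L2v p, divergence_free p &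
      forall w, L2v w -> divergence_free w ->
        \int[leb2]_x ((f x - p x).1 * (w x).1 + (f x - p x).2 * (w x).2) = 0].

Definition rot_neg (alpha : R) (z : R * R) : R * R :=
  (cos alpha * z.1 + sin alpha * z.2, - sin alpha * z.1 + cos alpha * z.2).

Definition transport w v : vector_field R := fun x =>
  ((w x).1 * weak_partial 1 0 (comp1 v) x
     + (w x).2 * weak_partial 0 1 (comp1 v) x,
   (w x).1 * weak_partial 1 0 (comp2 v) x
     + (w x).2 * weak_partial 0 1 (comp2 v) x).

Definition time_interval (T : \bar R) : set R :=
  [set t | 0 <= t /\ (t%:E < T)%E].

(** [v] belongs to C([0,T);H^3) and solves the Cauchy problem on [0,T); the
    time derivative [v_t = - p], with [p] the Leray projection of the
    nonlinearity, is the strong derivative in L^2 (one-sided at 0) *)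
Definition solution (alpha : R) (v0 : vector_field R) (v : R -> vector_field R)
    (T : \bar R) : Prop :=
  [/\ (0 < T)%E,
      (forall t, time_interval T t -> sobolevv 3 (v t)) /\
      (forall t, time_interval T t ->
         normHv 3 (v s \- v t) @[s --> within (time_interval T) (nbhs t)]
           --> 0%E),
      forall t, time_interval T t ->
        exists2 p : vector_field R,
          leray (transport (rot_neg alpha \o v t) (v t)) p &
          normL2v (fun x => (s - t)^-1 *: (v s x - v t x) + p x)
            @[s --> within (time_interval T) t^'] --> 0%E,
      forall t, time_interval T t -> divergence_free (v t) &
      ae_eq leb2 setT (v 0) v0].

(** [T] is the maximal existence time of [v]: no solution on a longer time
    interval extends [v] *)
Definition maximal_solution (alpha : R) (v0 : vector_field R)
    (v : R -> vector_field R) (T : \bar R) : Prop :=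
  solution alpha v0 v T /\
  forall (w : R -> vector_field R) (T' : \bar R), (T < T')%E ->
    (forall t, time_interval T t -> ae_eq leb2 setT (w t) (v t)) ->
    ~ solution alpha v0 w T'.

Definition is_min (u : scalar_field R) (m : R) : Prop :=
  (exists x, u x = m) /\ forall x, m <= u x.

End Plane.

(* Main.v *)
Require Import Defs.
From HB Require Import structures.
From mathcomp Require Import all_boot all_order all_algebra.
From mathcomp Require Import all_classical all_reals all_analysis.
From mathcomp Require Import measurable_realfun.
From mathcomp Require Import ring lra.
Import Order.TTheory GRing.Theory Num.Theory.
Import numFieldNormedType.Exports.
Local Open Scope classical_set_scope.
Local Open Scope ring_scope.

Set Implicit Arguments.
Unset Strict Implicit.
Unset Printing Implicit Defensive.

(**
Write s = sin alpha, and let om_t be the vorticity of v(t).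
The curl of R_{-alpha}(v).grad v is
  R_{-alpha}(v).grad om + s ((d_2 v_1)^2 + (d_1 v_2)^2 + 2 (d_1 v_1)^2),
with (d_2 v_1)^2 + (d_1 v_2)^2 >= om^2 / 2, while R_{-alpha}(v) has divergence
s om. Hence, along the characteristics, om' <= - s om^2 / 2, so that - 1 / om,
wherever om < 0, decreases at the rate s / 2 at least. In integrated form: with
tau(t) = tau(0) - s t / 2 and a convex profile f, zero on ]-oo, 1] and such that
2 f(y) <= (y - 1) f'(y), the energy E(t) = \int f(- tau(t) om_t) dx is
nondecreasing. If tau(0) is slightly larger than - 1 / min om_0 then E(0) > 0,
while E = 0 when tau = 0, at the time 2 tau(0) / s: the solution cannot reach it.

The solution is only differentiable in time with values in L^2. Convexity gives
E(t + h) - E(t) >= \int f'(y_t) (y_(t+h) - y_t) with y = - tau om, and in this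
pairing the curl and the Leray projection are moved to f'(y_t), which has weak
derivatives in L^2. This bounds the lower right Dini derivative of E from below;
continuity in H^3 gives the upper semicontinuity which is then enough for E to
be nondecreasing.
*)

(** A pointwise argument along characteristics would need values of om_t; the integrated form only
    pairs v_t, known in L^2, with gradients in L^2. The condition on f is then dictated by the
    divergence of R_{-alpha}(v). With y = - tau om, integrating the transport term by parts produces
    s f(y) om, and formally E' >= \int [ (s/2) f'(y) om + (s/2) tau f'(y) om^2 + s f(y) om ] = (s /
    (2 tau)) \int y ((y - 1) f'(y) - 2 f(y)). For a divergence-free transporting field f' >= 0 would
    do; the term 2 f pays for the contraction of volume where om < 0. The condition says that f(y) /
    (y - 1)^2 is nondecreasing for y > 1, so f grows at least quadratically, while a quadratic upper
    bound makes E finite and f'(y) square integrable for every vorticity in L^2. The choice (y -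
    1)^2 for y > 1 would give equality, but its second derivative jumps at 1, and f' itself has to
    be differentiated in the pairing. *)

(** * Square-integrable functions, the L^2 norm and Cauchy-Schwarz *)

Section square_integrable.
Context d (T : measurableType d) (R : realType) (mu : {measure set T -> \bar R}).
Implicit Types (f g u v : T -> R).

Definition intg f := mu.-integrable setT (EFin \o f).
Definition sqintg f := measurable_fun setT f /\ intg (fun x => f x ^+ 2).
(** A real number even when the integral diverges (it is then 0), so it is the L^2 norm only under
    [sqintg]. *)
Definition nrm f := Num.sqrt (\int[mu]_x (f x ^+ 2)).

Lemma ae_mono (P Q : T -> Prop) : (forall x, P x -> Q x) ->
  {ae mu, forall x, P x} -> {ae mu, forall x, Q x}.
Proof. by move=> PQ; apply: filterS. Qed.

Lemma ae_mono2 (P Q S : T -> Prop) : (forall x, P x -> Q x -> S x) ->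
  {ae mu, forall x, P x} -> {ae mu, forall x, Q x} -> {ae mu, forall x, S x}.
Proof. by move=> PQS; apply: filterS2. Qed.

Lemma Lfun2P f : f \in Lfun mu 2%:E <-> sqintg f.
Proof.
split=> [f2|[mf /integrableP[_ f2]]].
  split; last exact: Lfun2_integrable_sqr.
  by move: f2; rewrite inE => /andP[]; rewrite inE.
rewrite inE; apply/andP; split; rewrite inE //=.
rewrite /finite_norm unlock poweR_lty//.
apply: le_lt_trans f2; apply: ge0_le_integral => //.
- by move=> x _; exact: poweR_ge0.
- apply: (measurableT_comp (measurable_poweR _)) => //.
  by apply/measurable_EFinP; exact: measurableT_comp.
- apply/measurableT_comp => //; apply/measurable_EFinP.
  exact: measurable_funX.
- by move=> t _/=; rewrite lee_fin normrX powR_mulrn.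
Qed.

Lemma intgD f g : intg f -> intg g -> intg (fun x => f x + g x).
Proof. by move=> If Ig; have := integrableD measurableT If Ig. Qed.

Lemma intgB f g : intg f -> intg g -> intg (fun x => f x - g x).
Proof. by move=> If Ig; have := integrableB measurableT If Ig. Qed.

Lemma intgZ k f : intg f -> intg (fun x => k * f x).
Proof. by move=> If; have := integrableZl measurableT k If. Qed.

Lemma intgN f : intg f -> intg (fun x => - f x).
Proof. by move=> If; have := integrableN If. Qed.

Lemma intg_norm f : intg f -> intg (fun x => `|f x|).
Proof. by move=> If; have := integrable_norm If. Qed.

Lemma intg_measurable f : intg f -> measurable_fun setT f.
Proof. by move=> /integrableP[/measurable_EFinP]. Qed.

Lemma intg_le f g : measurable_fun setT f -> (forall x, `|f x| <= `|g x|) ->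
  intg g -> intg f.
Proof.
move=> mf fg; apply: le_integrable => //; first exact/measurable_EFinP.
by move=> x _; rewrite lee_fin.
Qed.

Lemma eq_intg f g : f =1 g -> intg f -> intg g.
Proof. by move=> fg; have -> : f = g by exact/funext. Qed.

Lemma RintD f g : intg f -> intg g ->
  \int[mu]_x (f x + g x) = \int[mu]_x f x + \int[mu]_x g x.
Proof. by move=> *; rewrite RintegralD. Qed.

Lemma RintB f g : intg f -> intg g ->
  \int[mu]_x (f x - g x) = \int[mu]_x f x - \int[mu]_x g x.
Proof. by move=> *; rewrite RintegralB. Qed.

Lemma RintZ k f : intg f -> \int[mu]_x (k * f x) = k * \int[mu]_x f x.
Proof. by move=> *; rewrite RintegralZl. Qed.

Lemma RintN f : intg f -> \int[mu]_x (- f x) = - \int[mu]_x f x.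
Proof.
move=> If; rewrite -mulN1r -RintZ//; apply: eq_Rintegral => x _.
by rewrite mulN1r.
Qed.

Lemma eq_Rint f g : f =1 g -> \int[mu]_x f x = \int[mu]_x g x.
Proof. by move=> fg; apply: eq_Rintegral => x _. Qed.

Lemma le_Rint f g : intg f -> intg g -> (forall x, f x <= g x) ->
  \int[mu]_x f x <= \int[mu]_x g x.
Proof. by move=> *; apply: le_Rintegral. Qed.

Lemma Rint_ge0 f : (forall x, 0 <= f x) -> 0 <= \int[mu]_x f x.
Proof. by move=> f0; apply: Rintegral_ge0. Qed.

Lemma norm_Rint f : intg f -> `|\int[mu]_x f x| <= \int[mu]_x `|f x|.
Proof. by move=> ?; apply: le_normr_Rintegral. Qed.

Lemma ae_intg f g : measurable_fun setT g -> ae_eq mu setT f g ->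
  intg f -> intg g.
Proof.
move=> mg fg /integrableP[mf If]; apply/integrableP; split.
  exact/measurable_EFinP.
rewrite (_ : (\int[_]_(_ in _) _ = \int[mu]_x `|(EFin \o f) x|)%E)//.
apply: ge0_ae_eq_integral => //.
- by apply: measurableT_comp => //; exact/measurable_EFinP.
- exact: measurableT_comp.
- by apply: filterS fg => x /= h Ix; rewrite h.
Qed.

Lemma ae_Rint f g : measurable_fun setT f -> measurable_fun setT g ->
  ae_eq mu setT f g -> \int[mu]_x f x = \int[mu]_x g x.
Proof.
move=> mf mg fg; rewrite /Rintegral; congr fine.
apply: ae_eq_integral => //; [exact/measurable_EFinP..|].
by apply: filterS fg => x /= h Ix; rewrite h.
Qed.

(** Replacing [g] by [max f g], to which it is equal almost everywhere, gives an inequality that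
    holds everywhere. *)
Lemma ae_le_Rint f g : intg f -> intg g -> {ae mu, forall x, f x <= g x} ->
  \int[mu]_x f x <= \int[mu]_x g x.
Proof.
move=> If Ig fg.
have mf := intg_measurable If; have mg := intg_measurable Ig.
have mm : measurable_fun setT (fun x => Num.max (f x) (g x)).
  exact: measurable_maxr.
have e : ae_eq mu setT g (fun x => Num.max (f x) (g x)).
  by apply: filterS fg => x h _; rewrite max_r.
rewrite (ae_Rint mg mm e); apply: le_Rint => //.
  exact: ae_intg e Ig.
by move=> x; rewrite le_max lexx.
Qed.

Lemma sqintgM u v : sqintg u -> sqintg v -> intg (fun x => u x * v x).
Proof.
move=> [mu_ u2] [mv v2].
apply: (@intg_le _ (fun x => u x ^+ 2 + v x ^+ 2)).
- exact: measurable_funM.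
- move=> x; rewrite [leRHS]ger0_norm ?addr_ge0 ?sqr_ge0// normrM.
  rewrite -[u x ^+ 2]real_normK ?num_real// -[v x ^+ 2]real_normK ?num_real//.
  by have := sqr_ge0 (`|u x| - `|v x|);
     have := normr_ge0 (u x); have := normr_ge0 (v x); nra.
- exact: intgD.
Qed.

Lemma sqintgD u v : sqintg u -> sqintg v -> sqintg (fun x => u x + v x).
Proof.
move=> Hu Hv; split; first exact: (measurable_funD Hu.1 Hv.1).
apply: (@eq_intg (fun x => (u x ^+ 2 + 2 * (u x * v x)) + v x ^+ 2)).
  by move=> x; rewrite sqrrD mulr_natl.
by apply: intgD; [apply: intgD; [exact: Hu.2|apply: intgZ; exact: sqintgM]|exact: Hv.2].
Qed.

Lemma sqintgZ k u : sqintg u -> sqintg (fun x => k * u x).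
Proof.
move=> Hu; split; first exact: (measurable_funM (measurable_cst _) Hu.1).
apply: (@eq_intg (fun x => k ^+ 2 * u x ^+ 2)); first by move=> x; rewrite exprMn.
by apply: intgZ; exact: Hu.2.
Qed.

Lemma sqintgN u : sqintg u -> sqintg (fun x => - u x).
Proof.
by move=> /(sqintgZ (-1)); under eq_fun do rewrite mulN1r.
Qed.

Lemma sqintgB u v : sqintg u -> sqintg v -> sqintg (fun x => u x - v x).
Proof. by move=> Hu /sqintgN; apply: sqintgD. Qed.

Lemma sqintg_norm u : sqintg u -> sqintg (fun x => `|u x|).
Proof.
move=> Hu; split; first by apply: measurableT_comp => //; exact: Hu.1.
apply: (eq_intg _ Hu.2) => x; by rewrite real_normK ?num_real.
Qed.

Lemma sqintg_le u v : measurable_fun setT u -> (forall x, `|u x| <= `|v x|) ->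
  sqintg v -> sqintg u.
Proof.
move=> mu_ uv [mv v2]; split => //; apply: intg_le v2.
  exact: measurable_funX.
by move=> x; rewrite !normrX lerXn2r// ?nnegrE.
Qed.

Lemma ae_sqintg u v : measurable_fun setT v -> ae_eq mu setT u v ->
  sqintg u -> sqintg v.
Proof.
move=> mv uv [mu_ u2]; split => //; apply: ae_intg u2; first exact: measurable_funX.
by apply: filterS uv => x h Ix; rewrite h.
Qed.

Definition essbnd M u := {ae mu, forall x, `|u x| <= M}.

(** Clamping [u] to [-M, M] changes it on a null set only, and the clamped function is bounded
    everywhere. *)
Lemma sqintg_bndM M u v : measurable_fun setT u -> essbnd M u -> sqintg v ->
  sqintg (fun x => u x * v x).
Proof.
move=> mu_ bu Hv; have mv := Hv.1.
have mm : measurable_fun setT (fun x => Num.max (- M) (Num.min (u x) M)).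
  by apply: measurable_maxr => //; exact: measurable_minr.
apply: (@ae_sqintg (fun x => Num.max (- M) (Num.min (u x) M) * v x)).
- exact: measurable_funM.
- apply: filterS bu => x; rewrite ler_norml => /andP[h1 h2] _.
  by rewrite min_l// max_r.
- apply: (@sqintg_le _ (fun x => M * v x)).
  + exact: measurable_funM.
  + move=> x; rewrite !normrM ler_wpM2r//.
    have [M0|M0] := leP 0 M.
      rewrite (ger0_norm M0) ler_norml.
      by rewrite le_max lexx/= ge_max ge_min lexx orbT andbT; lra.
    (* For [M < 0] the clamp is the constant [- M], whose absolute value is still that of [M]. *)
    rewrite (ltr0_norm M0) max_l; last by rewrite ge_min; apply/orP; right; lra.
    by rewrite gtr0_norm; lra.
  + exact: sqintgZ.
Qed.

Lemma nrm_ge0 u : 0 <= nrm u. Proof. exact: sqrtr_ge0. Qed.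

Lemma nrm_sqr u : nrm u ^+ 2 = \int[mu]_x (u x ^+ 2).
Proof. by rewrite sqr_sqrtr// Rint_ge0// => x; exact: sqr_ge0. Qed.

Lemma cauchy_schwarz u v : sqintg u -> sqintg v ->
  `|\int[mu]_x (u x * v x)| <= nrm u * nrm v.
Proof.
move=> Hu Hv; set p := \int[mu]_x _.
have q (a b : R) : 0 <= a ^+ 2 * nrm u ^+ 2 + 2 * (a * b) * p + b ^+ 2 * nrm v ^+ 2.
  have -> : a ^+ 2 * nrm u ^+ 2 + 2 * (a * b) * p + b ^+ 2 * nrm v ^+ 2 =
      \int[mu]_x ((a * u x + b * v x) ^+ 2).
    rewrite (@eq_Rint _ (fun x => (a ^+ 2 * u x ^+ 2 + (2 * (a * b)) * (u x * v x))
       + b ^+ 2 * v x ^+ 2)); last by move=> x; ring.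
    have I1 := intgZ (a ^+ 2) Hu.2; have I3 := intgZ (b ^+ 2) Hv.2.
    have I2 := intgZ (2 * (a * b)) (sqintgM Hu Hv).
    rewrite RintD//; last exact: intgD.
    rewrite RintD// !RintZ ?nrm_sqr//; [exact: Hv.2|exact: sqintgM|exact: Hu.2].
  by apply: Rint_ge0 => x; exact: sqr_ge0.
have := nrm_ge0 u; have := nrm_ge0 v; set n := nrm u in q *; set k := nrm v in q *.
move=> k0 n0; have p2 : p ^+ 2 <= (n * k) ^+ 2.
  (* At these coefficients the quadratic form equals k^2 ((n k)^2 - p^2), which settles the case k
     != 0. *)
  have := q (k ^+ 2) (- p).
  have [k00|kn0] := eqVneq k 0.
    rewrite k00 !mulr0 => _.
    suff -> : p = 0 by rewrite expr0n.
    apply: contrapT => /eqP p0.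
    (* If k = 0 and p != 0 the form is affine in its second coefficient; this value makes it equal
       to -1. *)
    have := q 1 (- (n ^+ 2 + 1) / (2 * p)); rewrite k00.
    have -> : 2 * (1 * (- (n ^+ 2 + 1) / (2 * p))) * p = - (n ^+ 2 + 1).
      by field.
    by rewrite expr1n mul1r expr0n /= mulr0; lra.
  have kk : 0 < k ^+ 2 by rewrite exprn_gt0// lt_neqAle eq_sym kn0.
  rewrite (_ : _ + _ = k ^+ 2 * ((n * k) ^+ 2 - p ^+ 2)); last by ring.
  by rewrite pmulr_rge0// subr_ge0.
rewrite -(ger0_norm (mulr_ge0 n0 k0)).
by rewrite -ler_sqr ?nnegrE// !real_normK ?num_real.
Qed.

Lemma Rint_normM u v : sqintg u -> sqintg v ->
  \int[mu]_x (`|u x| * `|v x|) <= nrm u * nrm v.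
Proof.
move=> Hu Hv; apply: le_trans (ler_norm _) _.
apply: le_trans (cauchy_schwarz (sqintg_norm Hu) (sqintg_norm Hv)) _.
rewrite /nrm; set a := fun x => _; rewrite (@eq_Rint (fun x => `|u x| ^+ 2) (fun x => u x ^+ 2)).
  rewrite (@eq_Rint (fun x => `|v x| ^+ 2) (fun x => v x ^+ 2))// => x.
  by rewrite real_normK ?num_real.
by move=> x; rewrite real_normK ?num_real.
Qed.

Lemma nrmD u v : sqintg u -> sqintg v -> nrm (fun x => u x + v x) <= nrm u + nrm v.
Proof.
move=> Hu Hv; rewrite -ler_sqr ?nnegrE ?addr_ge0 ?nrm_ge0// sqrrD !nrm_sqr.
rewrite (@eq_Rint _ (fun x => (u x ^+ 2 + 2 * (u x * v x)) + v x ^+ 2)); last first.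
  by move=> x; ring.
have I2 := intgZ 2 (sqintgM Hu Hv).
rewrite RintD//; [|by apply: intgD => //; exact: Hu.2|exact: Hv.2].
rewrite RintD//; last exact: Hu.2.
rewrite RintZ; last exact: sqintgM.
rewrite lerD2r lerD2l -[leRHS]mulr_natl ler_wpM2l//.
exact: le_trans (ler_norm _) (cauchy_schwarz Hu Hv).
Qed.

Lemma nrmZ k u : sqintg u -> nrm (fun x => k * u x) = `|k| * nrm u.
Proof.
move=> Hu; rewrite /nrm (@eq_Rint _ (fun x => k ^+ 2 * u x ^+ 2)); last first.
  by move=> x; rewrite exprMn.
rewrite RintZ; last exact: Hu.2.
by rewrite sqrtrM ?sqr_ge0// sqrtr_sqr.
Qed.

Lemma eq_nrm u v : u =1 v -> nrm u = nrm v.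
Proof. by move=> uv; rewrite (funext uv). Qed.

Lemma nrmN u : sqintg u -> nrm (fun x => - u x) = nrm u.
Proof.
move=> Hu; rewrite (@eq_nrm _ (fun x => -1 * u x)) ?nrmZ ?normrN1 ?mul1r// => x.
by rewrite mulN1r.
Qed.

Lemma nrmB u v : sqintg u -> sqintg v -> nrm (fun x => u x - v x) <= nrm u + nrm v.
Proof.
by move=> Hu Hv; rewrite -(nrmN Hv); apply: nrmD => //; exact: sqintgN.
Qed.

Lemma nrm_le_ae u v : sqintg u -> sqintg v -> {ae mu, forall x, `|u x| <= `|v x|} ->
  nrm u <= nrm v.
Proof.
move=> Hu Hv uv; rewrite ler_wsqrtr//; apply: ae_le_Rint; [exact: Hu.2|exact: Hv.2|].
apply: filterS uv => x h; rewrite -[u x ^+ 2]real_normK ?num_real//.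
by rewrite -[v x ^+ 2]real_normK ?num_real// lerXn2r// nnegrE.
Qed.

Lemma nrm_ae u v : sqintg u -> sqintg v -> ae_eq mu setT u v -> nrm u = nrm v.
Proof.
by move=> Hu Hv uv; apply/eqP; rewrite eq_le; apply/andP; split; apply: nrm_le_ae => //;
  apply: filterS uv => x /= ->.
Qed.

Lemma nrm_bndM M u v : 0 <= M -> measurable_fun setT u -> essbnd M u -> sqintg v ->
  nrm (fun x => u x * v x) <= M * nrm v.
Proof.
move=> M0 mu_ bu Hv; rewrite -[X in X * nrm v]ger0_norm// -nrmZ//; apply: nrm_le_ae.
- exact: sqintg_bndM bu Hv.
- exact: sqintgZ.
- by apply: filterS bu => x h; rewrite !normrM (ger0_norm M0) ler_wpM2r.
Qed.

End square_integrable.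

(** * Measurability on the plane and translation invariance of its measure *)

Section plane_measure.
Variable R : realType.
Notation mR := (measurableTypeR R).
Notation mu := (leb2 R).
Implicit Types (f g u v : R * R -> R) (z : R * R) (b : bool) (h : R).

(** Continuity refers to the product topology, measurability to the product sigma-algebra. They are
    related by writing an open set as the countable union of the squares it contains that have
    rational centre and half-side 1/(k+1). *)
Lemma continuous_plane_measurable f :
  continuous f -> measurable_fun setT (f : mR * mR -> R).
Proof.
move=> /continuousP cf; apply: (measurability _ (RGenOpens.measurableE R)).
move=> _ [_ [a [b ->] <-]]; rewrite setTI.
have oU : open (f @^-1` `]a, b[%classic) by exact/cf/interval_open.
set U := f @^-1` _ in oU *.
pose Q (p q : rat) (k : nat) : set (mR * mR) :=
  `]ratr p - k.+1%:R^-1, ratr p + k.+1%:R^-1[%classic `*`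
  `]ratr q - k.+1%:R^-1, ratr q + k.+1%:R^-1[%classic.
have -> : U = \bigcup_p \bigcup_q \bigcup_k
    (if `[< Q p q k `<=` U >] then Q p q k else set0).
  apply/seteqP; split => [[x y] Uxy|z [p _ [q _ [k _]]]]; last first.
    by case: asboolP => // QU /QU.
  have [e/= e0 exyU] := open_subball oU Uxy.
  have := exyU (e / 2); rewrite /= sub0r normrN (gtr0_norm (divr_gt0 e0 _))//.
  have e2 : e / 2 < e by lra.
  move=> /(_ e2 (divr_gt0 e0 (ltr0Sn _ _))) {exyU}; rewrite /ball/= => exyU.
  (* A point of the square is within r of the centre, and so is (x, y); 2r < e/2 keeps the square in
     the ball of radius e/2. *)
  have [k ke] : exists k : nat, k.+1%:R^-1 < e / 4.
    have /ltr_add_invr[k] : 0 < e / 4 by lra.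
    by rewrite add0r => ?; exists k.
  have k0 : 0 < k.+1%:R^-1 :> R by rewrite invr_gt0.
  set r := k.+1%:R^-1 in k0 ke.
  have /rat_in_itvoo[p pP] : x - r < x + r by lra.
  have /rat_in_itvoo[q qP] : y - r < y + r by lra.
  exists p => //; exists q => //; exists k => //; rewrite /Q -/r.
  case: asboolP => /=.
    move=> _; split => /=.
      by move: pP; rewrite !in_itv/= => /andP[? ?]; apply/andP; split; lra.
    by move: qP; rewrite !in_itv/= => /andP[? ?]; apply/andP; split; lra.
  apply; move=> [x' y'] [/=]; rewrite !in_itv/= => /andP[? ?] /andP[? ?].
  move: pP qP; rewrite !in_itv/= => /andP[? ?] /andP[? ?].
  by apply: exyU; split => /=; rewrite -ball_normE /ball_/= ltr_norml; lra.
apply: bigcupT_measurable_rat => p; apply: bigcupT_measurable_rat => q.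
apply: bigcupT_measurable => k; case: ifP => // _; apply: measurableX; exact: measurable_itv.
Qed.

(** [b = true] is the first coordinate direction and [b = false] the second. *)
Definition sh b h z : R * R := if b then (z.1 + h, z.2) else (z.1, z.2 + h).

Lemma sh0 b z : sh b 0 z = z.
Proof. by case: z b => [x y] [] /=; rewrite addr0. Qed.

Lemma shD b h k z : sh b h (sh b k z) = sh b (k + h) z.
Proof. by case: b => /=; rewrite addrA. Qed.

Lemma shC b c h k z : sh b h (sh c k z) = sh c k (sh b h z).
Proof. by case: b; case: c => //=; rewrite addrAC. Qed.

Lemma measurable_shx b h : measurable_fun setT (sh b h : mR * mR -> mR * mR).
Proof.
case: b.
  apply: (@measurable_fun_pair _ _ _ _ _ _ (fun z : mR * mR => z.1 + h) snd) => //.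
  exact: measurable_funD.
apply: (@measurable_fun_pair _ _ _ _ _ _ fst (fun z : mR * mR => z.2 + h)) => //.
exact: measurable_funD.
Qed.

(** The pushforward by the translation is a measure with the right value on half-open intervals, and
    these determine Lebesgue measure. The plane follows from uniqueness of the product measure. *)
Lemma lebesgue_measureD h (A : set mR) : measurable A ->
  lebesgue_measure ((fun x : mR => x + h) @^-1` A) = lebesgue_measure A.
Proof.
move=> mA.
have mh : measurable_fun setT (fun x : mR => (x + h : mR)).
  exact: measurable_funD.
pose f : mR -> mR := fun x => x + h.
pose i0 := isMeasurableFun.Build _ _ _ _ f mh.
pose F : {mfun mR >-> mR} := HB.pack f i0.
rewrite -[LHS]/(pushforward lebesgue_measure F A).
apply/esym/lebesgue_measure_unique => //= _ [[a b]] _ <-.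
have -> : pushforward lebesgue_measure F `]a, b]%classic =
    lebesgue_measure `]a - h, b - h]%classic.
  rewrite /pushforward; congr (lebesgue_measure _); apply/seteqP.
  by split => x /=; rewrite /f !in_itv/=; lra.
rewrite !lebesgue_measure_itv/= !lte_fin ltrD2r; case: ifP => // _.
by rewrite -!EFinB; congr EFin; ring.
Qed.

Lemma leb2X (A B : set mR) : measurable A -> measurable B ->
  mu (A `*` B) = (lebesgue_measure A * lebesgue_measure B)%E.
Proof. by move=> mA mB; exact: product_measure1E. Qed.

Definition shm b h : {mfun (mR * mR)%type >-> (mR * mR)%type} :=
  HB.pack (sh b h : mR * mR -> mR * mR)
    (isMeasurableFun.Build _ _ _ _ _ (measurable_shx b h)).

Lemma leb2_sh b h (A : set (mR * mR)) : measurable A ->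
  mu (sh b h @^-1` A) = mu A.
Proof.
move=> mA.
rewrite -[LHS]/(pushforward mu (shm b h) A).
apply/esym/product_measure_unique => // B C mB mC.
have mt (D : set mR) : measurable D -> measurable ((fun x : mR => x + h) @^-1` D).
  move=> mD; rewrite -[X in measurable X]setTI.
  by apply: (measurable_funD (@measurable_id _ mR _) (measurable_cst h)).
transitivity (mu ((if b then (fun x : mR => x + h) @^-1` B else B) `*`
    (if b then C else (fun x : mR => x + h) @^-1` C))).
  by congr (mu _); apply/seteqP; split => -[x y]; rewrite /shm/=; case: (b).
case: (b); rewrite leb2X//; [|exact: mt| |exact: mt].
  by rewrite lebesgue_measureD.
by rewrite lebesgue_measureD.
Qed.

Lemma ge0_int_sh b h (f : mR * mR -> \bar R) : measurable_fun setT f ->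
  (forall z, 0 <= f z)%E -> (\int[mu]_z f (sh b h z) = \int[mu]_z f z)%E.
Proof.
move=> mf f0; have H := @ge0_integral_pushforward _ _ _ _ _ (shm b h)
  (measurable_shx b h) mu setT f measurableT mf (fun z _ => f0 z).
rewrite preimage_setT in H; rewrite -[LHS]H.
by apply: (@eq_measure_integral _ _ _ _ mu (pushforward mu (shm b h))) => A mA _; exact: leb2_sh.
Qed.

Lemma measurable_sh b h f : measurable_fun setT (f : mR * mR -> R) ->
  measurable_fun setT (fun z : mR * mR => f (sh b h z)).
Proof. by move=> mf; apply: (measurableT_comp mf (measurable_shx b h)). Qed.

Lemma intg_sh b h f : intg mu f -> intg mu (fun z => f (sh b h z)).
Proof.
move=> If; have mf := intg_measurable If; move: (If) => /integrableP[mEf If2].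
apply/integrableP; split; first by apply/measurable_EFinP; exact: measurable_sh.
rewrite (ge0_int_sh b h (f := fun z => `|f z|%:E))//.
by apply/measurable_EFinP; apply: measurableT_comp.
Qed.

Lemma Rint_sh b h f : intg mu f -> \int[mu]_z f (sh b h z) = \int[mu]_z f z.
Proof.
move=> If; have mf := intg_measurable If; congr fine.
have Ifs := intg_sh b h If.
have mEf : measurable_fun setT (EFin \o f) by exact/measurable_EFinP.
have H := @integral_pushforward _ _ _ _ _ (shm b h) (measurable_shx b h) mu setT
  (EFin \o f) mEf Ifs measurableT.
rewrite preimage_setT in H; rewrite -[LHS]H.
by apply: (@eq_measure_integral _ _ _ _ mu (pushforward mu (shm b h))) => A mA _; exact: leb2_sh.
Qed.

Lemma ae_sh b h (S : set (R * R)) : {ae mu, forall z, S z} ->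
  {ae mu, forall z, S (sh b h z)}.
Proof.
move=> [N [mN N0 SN]]; exists (sh b h @^-1` N); split.
- by rewrite -[X in measurable X]setTI; apply: (measurable_shx b h).
- by rewrite leb2_sh.
- by move=> z /= Sz; apply: SN.
Qed.

Lemma sqintg_sh b h u : sqintg mu u -> sqintg mu (fun z => u (sh b h z)).
Proof.
move=> [mu_ u2]; split; first exact: measurable_sh.
exact: (@intg_sh b h (fun z => u z ^+ 2)).
Qed.

Lemma nrm_sh b h u : sqintg mu u -> nrm mu (fun z => u (sh b h z)) = nrm mu u.
Proof. by move=> [_ u2]; rewrite /nrm (Rint_sh b h (f := fun z => u z ^+ 2)). Qed.

Lemma L2P u : L2 u <-> sqintg mu u.
Proof. exact: Lfun2P. Qed.

End plane_measure.

(** * Smooth functions of one variable that are flat at 0 *)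

Section flat_functions.
Variable R : realType.
Implicit Types (Q : {poly R}) (t x : R).

(** Quantifying over [n] lets the induction on [Q] absorb the factor X of Q X + c into the power of
    x; monomials are dominated by the terms of the exponential series. *)
Lemma poly_expR_bounded Q n :
  exists2 C, 0 <= C & forall x, 0 <= x -> `|x ^+ n * Q.[x]| * expR (- x) <= C.
Proof.
elim/poly_ind: Q n => [|Q c IH] n.
  by exists 0 => // x x0; rewrite horner0 mulr0 normr0 mul0r.
have [C C0 HC] := IH n.+1.
have H k : exists2 D : R, 0 <= D & forall x, 0 <= x -> x ^+ k * expR (- x) <= D.
  case: k => [|k].
    exists 1 => // x x0; rewrite expr0 mul1r expR_le1; lra.
  exists (k.+1`!%:R) => // x x0; rewrite expRN.
  rewrite ler_pdivrMr ?expR_gt0//.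
  have := expR_ge1Dxn k x0 => h.
  have f0 : (0 : R) < k.+1`!%:R by rewrite ltr0n fact_gt0.
  rewrite mulrC -ler_pdivrMr//; apply: le_trans h; lra.
have [D D0 HD] := H n.
exists (C + `|c| * D); first by rewrite addr_ge0// mulr_ge0.
move=> x x0; rewrite hornerMXaddC mulrDr mulrA.
have e0 := expR_ge0 (- x).
apply: le_trans (_ : (`|x ^+ n.+1 * Q.[x]| + `|c| * x ^+ n) * expR (- x) <= _).
  rewrite ler_wpM2r//; apply: le_trans (ler_normD _ _) _.
  have -> : x ^+ n * Q.[x] * x = x ^+ n.+1 * Q.[x] by rewrite exprSr; ring.
  rewrite lerD2l.
  by rewrite normrM (ger0_norm (exprn_ge0 _ x0)) mulrC.
rewrite mulrDl lerD ?HC// -mulrA ler_wpM2l// HD//.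
Qed.

(** The functions [Q(1/t) exp(-1/t)] are closed under differentiation, which
    makes the smooth bumps below explicit. *)
Definition flat Q t := if 0 < t then Q.[t^-1] * expR (- t^-1) else 0.

(** From d/dt [Q(1/t) exp(-1/t)] = t^-2 (Q - Q')(1/t) exp(-1/t). *)
Definition flat_next Q : {poly R} := 'X^2 * (Q - Q^`()).

Lemma flat_le0 Q t : t <= 0 -> flat Q t = 0.
Proof. by rewrite /flat ltNge => ->. Qed.

(** A quadratic bound at the junction point 0 gives the derivative there at once, with value 0, for
    all [Q] simultaneously. *)
Lemma flat_quadratic Q : exists C, forall t, `|flat Q t| <= C * t ^+ 2.
Proof.
have [C C0 HC] := poly_expR_bounded Q 2.
exists C => t; rewrite /flat; case: ifP => [t0|_]; last first.
  by rewrite normr0 mulr_ge0// sqr_ge0.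
have := HC t^-1 (ltW _); rewrite invr_gt0 => /(_ t0).
rewrite exprVn !normrM (ger0_norm (expR_ge0 _)) -mulrA.
by rewrite ger0_norm ?invr_ge0 ?sqr_ge0// mulrC ler_pdivrMr ?exprn_gt0.
Qed.

Lemma is_derive_quadratic (f : R -> R) x C :
  (forall t, `|f t - f x| <= C * (t - x) ^+ 2) -> is_derive x 1 f 0.
Proof.
move=> fC.
have C0 : 0 <= C.
  have := fC (x + 1); rewrite [x + 1]addrC addrK expr1n mulr1.
  by apply: le_trans.
have H : (fun h : R => h^-1 *: ((f \o shift x) (h *: (1 : R)) - f x)) @ 0^' --> (0 : R).
  apply/cvgrPdist_lt => e e0; near=> h.
  rewrite sub0r normrN /= /shift scaler1 normrM normfV.
  have h0 : 0 < `|h| by rewrite normr_gt0; near: h; exact: nbhs_dnbhs_neq.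
  rewrite mulrC ltr_pdivrMr//; apply: le_lt_trans (fC _) _.
  rewrite addrK -[h ^+ 2]real_normK ?num_real// expr2 mulrA ltr_pM2r//.
  have : `|h| < e / (C + 1).
    near: h; apply: dnbhs0_lt; rewrite divr_gt0//; lra.
  rewrite ltr_pdivlMr; last lra.
  by apply: le_lt_trans; rewrite mulrC ler_wpM2l//; lra.
by split; [apply/cvg_ex; exists 0|exact/cvg_lim].
Unshelve. all: by end_near. Qed.

Lemma is_derive_flat Q t : is_derive t 1 (flat Q) (flat (flat_next Q) t).
Proof.
have [t0|t0|->] := ltgtP t 0.
- rewrite (flat_le0 _ (ltW t0)).
  apply: (near_eq_is_derive _ (is_derive_cst (0 : R) t 1)).
  near=> s; rewrite flat_le0// ltW//; near: s; exact: (lt_nbhsl t0).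
-  have dV : is_derive t 1 (fun s : R => s^-1) (- t ^- 2).
    have := @is_deriveV R id t 1 1 (lt0r_neq0 t0) (is_derive_id _ _).
    by rewrite /= /GRing.scale /= mulr1.
  have d1 := is_derive1_comp (is_derive_poly Q t^-1) dV.
  have d2 := @is_derive1_comp _ expR (fun s : R => - s^-1) t _ _
    (is_derive_expR (- t^-1)) (is_deriveN dV).
  apply: (near_eq_is_derive (f := fun s : R => Q.[s^-1] * expR (- s^-1))
    _ (is_derive_eq (is_deriveM d1 d2) _)).
    near=> s; rewrite /flat ifT//; near: s; exact: lt_nbhsr.
  rewrite /flat t0 /flat_next !hornerE /= /GRing.scale /=.
  by field; exact: lt0r_neq0.
- rewrite flat_le0//; have [C HC] := flat_quadratic Q.
  apply: (@is_derive_quadratic _ _ C) => s.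
  by rewrite [flat Q 0]flat_le0// !subr0.
Unshelve. all: by end_near. Qed.

Lemma flatZ k Q t : flat (k *: Q) t = k * flat Q t.
Proof. by rewrite /flat hornerZ; case: ifP => _; rewrite ?mulr0 ?mulrA. Qed.

Lemma continuous_flat Q : continuous (flat Q).
Proof.
move=> t; apply/differentiable_continuous/derivable1_diffP.
by have [] := is_derive_flat Q t.
Qed.

End flat_functions.

(** * Directional derivatives, the classes C^n, and smooth bumps *)

Section directional.
Variable R : realType.
Implicit Types (phi psi : R * R -> R) (z : R * R) (b : bool).

Definition ee b : R * R := if b then (1, 0) else (0, 1).
Definition dd b phi := if b then d1 phi else d2 phi.
Definition coord b z : R := if b then z.1 else z.2.

Lemma sh_ee b h z : h *: ee b + z = sh b h z.
Proof.
by case: z b => [x y] [] /=; congr pair => /=;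
  rewrite /GRing.scale /= ?mulr1 ?mulr0 ?add0r// addrC.
Qed.

(** Restriction to lines makes the one-variable chain rule, mean value theorem and fundamental
    theorem of calculus available. *)
Lemma derivable_slice b phi z s :
  derivable (fun t => phi (sh b t z)) s 1 <-> derivable phi (sh b s z) (ee b).
Proof.
rewrite /derivable.
set F := (X in cvg (X @ _) <-> _); set G := (X in _ <-> cvg (X @ _)).
suff -> : F = G by [].
apply/funext => h; rewrite /F /G /= /shift; congr (_ *: (phi _ - _)).
by rewrite sh_ee shD /GRing.scale /= mulr1 addrC.
Qed.

Lemma derive_slice b phi z s :
  'D_1 (fun t => phi (sh b t z)) s = dd b phi (sh b s z).
Proof.
transitivity ('D_(ee b) phi (sh b s z)); last by case: b.
rewrite /derive.
set F := (X in lim (X @ _) = _); set G := (X in _ = lim (X @ _)).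
suff -> : F = G by [].
apply/funext => h; rewrite /F /G /= /shift; congr (_ *: (phi _ - _)).
by rewrite sh_ee shD /GRing.scale /= mulr1 addrC.
Qed.

Lemma C_S n phi : C_ n.+1 phi <->
  [/\ continuous phi, forall b z, derivable phi z (ee b) &
      forall b, C_ n (dd b phi)].
Proof.
split=> [[cphi [H1 H2 H3 H4]]|[cphi H1 H2]].
  split; first exact: cphi.
    by case; [exact: H1|exact: H2].
  by case; [exact: H3|exact: H4].
by split=> //; split; [exact: (H1 true)|exact: (H1 false)|exact: (H2 true)|exact: (H2 false)].
Qed.

Lemma C_continuous n phi : C_ n phi -> continuous phi.
Proof. by case: n => [[]|n []]. Qed.

Lemma is_derive_slice n b phi z s : C_ n.+1 phi ->
  is_derive s (1 : R) (fun t => phi (sh b t z)) (dd b phi (sh b s z)).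
Proof.
move=> /C_S[_ H _]; split; last exact: derive_slice.
exact/derivable_slice.
Qed.

Lemma is_derive_dd n b phi z : C_ n.+1 phi -> is_derive z (ee b) phi (dd b phi z).
Proof. by move=> /C_S[_ H _]; split; [exact: H|case: b {H}]. Qed.

Lemma ddP b phi z d : is_derive z (ee b) phi d -> dd b phi z = d.
Proof. by case=> _ <-; case: b. Qed.

Lemma C_S_intro n phi (g : bool -> R * R -> R) : continuous phi ->
  (forall b z, is_derive z (ee b) phi (g b z)) -> (forall b, C_ n (g b)) ->
  C_ n.+1 phi.
Proof.
move=> cphi dphi cg; apply/C_S; split; first exact: cphi.
  by move=> b z; have [] := dphi b z.
move=> b.
suff -> : dd b phi = g b by exact: cg.
by apply/funext => z; apply: ddP.
Qed.

Lemma C_W n phi : C_ n.+1 phi -> C_ n phi.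
Proof.
elim: n phi => [|n IH] phi /C_S[c H1 H2]; first by split.
by apply/C_S; split=> // b; apply: IH.
Qed.

Lemma C_cst n (c : R) : C_ n (fun=> c : R).
Proof.
elim: n c => [|n IH] c; first by split=> //; exact: cst_continuous.
apply: (@C_S_intro _ _ (fun _ _ => 0)); first exact: cst_continuous.
by move=> b; exact: IH.
Qed.

Lemma C_D n phi psi : C_ n phi -> C_ n psi -> C_ n (fun z => phi z + psi z).
Proof.
elim: n phi psi => [|n IH] phi psi Hphi Hpsi.
  split=> // z; apply: continuousD; [exact: Hphi.1|exact: Hpsi.1].
have [cphi _ H2] := (C_S _ _).1 Hphi; have [cpsi _ K2] := (C_S _ _).1 Hpsi.
apply: (@C_S_intro _ _ (fun b z => dd b phi z + dd b psi z)).
- by move=> z; apply: continuousD; [exact: cphi|exact: cpsi].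
- by move=> b z; exact: is_deriveD (is_derive_dd _ _ Hphi) (is_derive_dd _ _ Hpsi).
- by move=> b; exact: IH.
Qed.

Lemma C_M n phi psi : C_ n phi -> C_ n psi -> C_ n (fun z => phi z * psi z).
Proof.
elim: n phi psi => [|n IH] phi psi Hphi Hpsi.
  split=> // z; apply: continuousM; [exact: Hphi.1|exact: Hpsi.1].
have [cphi _ H2] := (C_S _ _).1 Hphi; have [cpsi _ K2] := (C_S _ _).1 Hpsi.
apply: (@C_S_intro _ _ (fun b z => phi z * dd b psi z + psi z * dd b phi z)).
- by move=> z; apply: continuousM; [exact: cphi|exact: cpsi].
- by move=> b z; exact: is_deriveM (is_derive_dd _ _ Hphi) (is_derive_dd _ _ Hpsi).
- move=> b; apply: C_D; apply: IH => //; exact: C_W.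
Qed.

Lemma coord_sh b c s z : coord b (sh c s z) = coord b z + (if b == c then s else 0).
Proof. by case: b; case: c => /=; rewrite ?addr0. Qed.

Lemma continuous_coord b : continuous (coord b).
Proof. by case: b => z; [exact: cvg_fst|exact: cvg_snd]. Qed.

(** The induction on [n] is over all [Q], since a derivative is again of this form: the inner slope
    [k] is absorbed into the polynomial by [flatZ]. *)
Lemma C_flat n Q b k c : C_ n (fun z => flat Q (k * coord b z + c)).
Proof.
elim: n Q => [|n IH] Q.
  split=> // z; apply: (@continuous_comp _ _ _ (fun z => k * coord b z + c) (flat Q)).
    by apply: continuousD; [apply: continuousM|]; [exact: cst_continuous|
      exact: continuous_coord|exact: cst_continuous].
  exact: continuous_flat.
pose G b' z := if b == b' then flat (k *: flat_next Q) (k * coord b z + c) else 0.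
apply: (@C_S_intro _ _ G).
- move=> z; apply: (@continuous_comp _ _ _ (fun z => k * coord b z + c) (flat Q)).
    by apply: continuousD; [apply: continuousM|]; [exact: cst_continuous|
      exact: continuous_coord|exact: cst_continuous].
  exact: continuous_flat.
- move=> b' z.
  have H : is_derive (0 : R) (1 : R) (fun t => flat Q (k * coord b (sh b' t z) + c)) (G b' z).
    rewrite /G; have [<-|bb'] := eqVneq b b'.
      under eq_fun do rewrite coord_sh eqxx.
      have d1 : is_derive (0 : R) 1 (fun t : R => k * (coord b z + t) + c) k.
        apply: is_derive_eq; rewrite /GRing.scale /=; ring.
      have := @is_derive1_comp _ (flat Q) (fun t : R => k * (coord b z + t) + c) 0 _ _
        (is_derive_flat Q (k * (coord b z + 0) + c)) d1.
      by rewrite addr0 flatZ mulrC.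
    under eq_fun do rewrite coord_sh (negbTE bb') addr0.
    exact: is_derive_cst.
  have [H1 H2] := H; split.
    by have := (derivable_slice b' (fun z => flat Q (k * coord b z + c)) z 0).1 H1; rewrite sh0.
  rewrite -H2 (derive_slice b' (fun z => flat Q (k * coord b z + c)) z 0) sh0.
  by case: b' {G H H1 H2}.
- move=> b'; rewrite /G; case: (b == b'); [exact: IH|exact: C_cst].
Qed.

Lemma C_dd n b phi : C_ n.+1 phi -> C_ n (dd b phi).
Proof. by move=> /C_S[]. Qed.

Definition vanish_off (K : set (R * R)) phi := forall z, ~ K z -> phi z = 0.

Definition box (r : R) : set (R * R) := [set z | `|z.1| <= r /\ `|z.2| <= r].

Lemma compact_box r : compact (box r).
Proof.
have -> : box r = `[- r, r]%classic `*` `[- r, r]%classic.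
  apply/seteqP; split=> -[x y]; rewrite /box/= !in_itv/= => -[? ?].
    by split; rewrite -ler_norml.
  by rewrite !ler_norml.
by apply: compact_setX; exact: segment_compact.
Qed.

Lemma compact_support phi : compact (closure [set z | phi z != 0]) <->
  exists r, vanish_off (box r) phi.
Proof.
split=> [|[r Hr]].
  move=> /compact_bounded[M [_ HM]]; exists (`|M| + 1) => z Kz.
  apply: contrapT => /eqP pz; apply: Kz.
  have /(HM (`|M| + 1)) : M < `|M| + 1 by have := ler_norm M; lra.
  move=> /(_ z) H; have : `|z| <= `|M| + 1 by apply: H; exact: subset_closure.
  by rewrite prod_normE ge_max => /andP[].
apply: (@subclosed_compact _ _ (box r)); [exact: closed_closure|exact: compact_box|].
have cK : closed (box r) by apply: compact_closed => //; exact: compact_box.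
rewrite [X in _ `<=` X](closure_id _).1//; apply: closure_subset => z /= /eqP pz.
by apply: contrapT => /Hr.
Qed.

Lemma vanish_dd n r b phi : C_ n.+1 phi -> vanish_off (box r) phi ->
  vanish_off (box r) (dd b phi).
Proof.
move=> Cphi Hr z Kz; apply: ddP.
apply: (near_eq_is_derive _ (is_derive_cst (0 : R) z (ee b))).
have oK : open (~` box r).
  by apply: closed_openC; apply: compact_closed => //; exact: compact_box.
have : \forall w \near z, (~` box r) w by exact: open_nbhs_nbhs.
by apply: filterS => w Kw; rewrite Hr.
Qed.

Lemma test_dd b phi : test_function phi -> test_function (dd b phi).
Proof.
move=> [H /compact_support[r Hr]]; split=> [n|]; first exact: C_dd (H n.+1).
by apply/compact_support; exists r; exact: vanish_dd (H 1%N) Hr.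
Qed.

(** Since [flat 1 t] is exp(-1/t) for t > 0, this is positive exactly on the strip x < coord < y,
    and dilating by n+1 makes it tend to the indicator of the strip. *)
Definition bump1 b (n : nat) (x y : R) z :=
  flat 1 (n.+1%:R * coord b z - n.+1%:R * x) *
  flat 1 (- n.+1%:R * coord b z + n.+1%:R * y).

Definition bump (n : nat) (x1 y1 x2 y2 : R) z :=
  bump1 true n x1 y1 z * bump1 false n x2 y2 z.

Lemma flat1_itv t : 0 <= flat (1 : {poly R}) t <= 1.
Proof.
rewrite /flat; case: ifP => t0; rewrite ?lexx ?ler01// hornerE mul1r expR_ge0/=.
by rewrite expR_le1 oppr_le0 invr_ge0 ltW.
Qed.

Lemma bump1_itv b n x y z : 0 <= bump1 b n x y z <= 1.
Proof.
rewrite /bump1; have /andP[h1 h2] := flat1_itv (n.+1%:R * coord b z - n.+1%:R * x).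
have /andP[h3 h4] := flat1_itv (- n.+1%:R * coord b z + n.+1%:R * y).
by rewrite mulr_ge0//= mulr_ile1.
Qed.

Lemma bump_itv n x1 y1 x2 y2 z : 0 <= bump n x1 y1 x2 y2 z <= 1.
Proof.
have /andP[h1 h2] := bump1_itv true n x1 y1 z.
have /andP[h3 h4] := bump1_itv false n x2 y2 z.
by rewrite mulr_ge0//= mulr_ile1.
Qed.

Lemma bump1_out b n x y z : ~~ (x < coord b z < y) -> bump1 b n x y z = 0.
Proof.
rewrite negb_and -!leNgt /bump1 => /orP[h|h].
  by rewrite flat_le0 ?mul0r// -mulrBr pmulr_rle0 ?ltr0n// subr_le0.
rewrite [X in _ * X]flat_le0 ?mulr0// mulNr addrC -mulrBr pmulr_rle0 ?ltr0n//.
by rewrite subr_le0.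
Qed.

Lemma test_bump n x1 y1 x2 y2 : test_function (bump n x1 y1 x2 y2).
Proof.
split=> [k|].
  by apply: C_M; apply: C_M; exact: C_flat.
apply/compact_support; exists (`|x1| + `|y1| + `|x2| + `|y2|) => z Kz.
rewrite /bump; have [/andP[h1 h2]|/bump1_out->] := boolP (x1 < coord true z < y1); last first.
  by rewrite mul0r.
have [/andP[h3 h4]|/bump1_out->] := boolP (x2 < coord false z < y2); last by rewrite mulr0.
exfalso; apply: Kz; rewrite /box/= in h1 h2 h3 h4 *; rewrite !ler_norml.
have := ler_norm x1; have := ler_norm (- x1); have := ler_norm x2; have := ler_norm (- x2).
have := ler_norm y1; have := ler_norm (- y1); have := ler_norm y2; have := ler_norm (- y2).
by rewrite !normrN; split; lra.
Qed.

Lemma bump1_cvg b x y z :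
  bump1 b n x y z @[n --> \oo] --> ((x < coord b z < y)%R%:R : R).
Proof.
have [/andP[h1 h2]|/bump1_out H] := boolP (x < coord b z < y); last first.
  by under eq_fun do rewrite H; exact: cvg_cst.
have F (s : R) : 0 < s -> flat 1 (n.+1%:R * s) @[n --> \oo] --> (1 : R).
  move=> s0.
  have -> : (fun n => flat 1 (n.+1%:R * s)) = fun n : nat => expR (- (n.+1%:R^-1 * s^-1)).
    by apply/funext => n; rewrite /flat mulr_gt0 ?ltr0n// hornerE mul1r invfM.
  rewrite -[X in _ --> X]expR0 -oppr0.
  apply: (continuous_cvg _ (@continuous_expR R _)); apply: cvgN.
  rewrite -[X in _ --> X](mul0r s^-1); apply: cvgM; last exact: cvg_cst.
  exact: cvg_harmonic.
rewrite /bump1 -[X in _ --> X]mulr1; apply: cvgM.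
  under eq_fun do rewrite -mulrBr.
  by apply: F; rewrite subr_gt0.
under eq_fun do rewrite mulNr addrC -mulrBr.
by apply: F; rewrite subr_gt0.
Qed.

End directional.

(** * Open rectangles and the fundamental lemma of the calculus of variations *)

Section rectangles.
Variable R : realType.
Notation mR := (measurableTypeR R).
Notation mu := (leb2 R).
Implicit Types (f g u v : R * R -> R) (z : R * R) (b : bool) (h : R).

Definition orect (x1 y1 x2 y2 : R) : set (mR * mR) :=
  `]x1, y1[%classic `*` `]x2, y2[%classic.

Lemma measurable_orect x1 y1 x2 y2 : measurable (orect x1 y1 x2 y2).
Proof. by apply: measurableX; exact: measurable_itv. Qed.

Lemma orectE x1 y1 x2 y2 z : orect x1 y1 x2 y2 z <->
  (x1 < coord true z < y1) && (x2 < coord false z < y2).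
Proof.
rewrite /orect /= !in_itv/=; split => [[-> ->]//|/andP[-> ->]//].
Qed.

Lemma orectI x1 y1 x2 y2 x1' y1' x2' y2' :
  orect x1 y1 x2 y2 `&` orect x1' y1' x2' y2' =
  orect (Num.max x1 x1') (Num.min y1 y1') (Num.max x2 x2') (Num.min y2 y2').
Proof.
apply/seteqP; split => z.
  move=> [] /orectE/andP[/andP[? ?] /andP[? ?]] /orectE/andP[/andP[? ?] /andP[? ?]].
  by apply/orectE; rewrite !gt_max !lt_min; apply/andP; split; apply/andP; split; apply/andP.
move/orectE; rewrite !gt_max !lt_min.
move=> /andP[/andP[/andP[? ?] /andP[? ?]] /andP[/andP[? ?] /andP[? ?]]].
by split; apply/orectE; apply/andP; split; apply/andP.
Qed.

Definition orects : set (set (mR * mR)) :=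
  [set A | exists x1 y1 x2 y2, A = orect x1 y1 x2 y2].

Lemma bigcup_itvoo : \bigcup_n `](- n%:R : R), n%:R[%classic = setT.
Proof.
apply/seteqP; split => // x _; exists (Num.truncn `|x|).+1 => //=.
have /andP[_ H] := truncn_itv (normr_ge0 x).
by rewrite in_itv/= -ltr_norml.
Qed.

(** Bounded open rectangles are the generators suited to a Dynkin argument: they are stable under
    intersection, and their indicators are pointwise limits of test functions. *)
Lemma measurable_orects : @measurable _ (mR * mR)%type = <<s orects >>.
Proof.
rewrite measurable_prod_measurableType; apply/seteqP; split; last first.
  apply: smallest_sub; first exact: smallest_sigma_algebra.
  move=> _ [x1 [y1 [x2 [y2 ->]]]]; apply: sub_sigma_algebra.
  by exists `]x1, y1[%classic; [exact: measurable_itv|exists `]x2, y2[%classic => //; exact: measurable_itv].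
apply: smallest_sub; first exact: smallest_sigma_algebra.
have sG := smallest_sigma_algebra setT orects.
have [s0 sC sU] := sG.
have sC' A : <<s orects >> A -> <<s orects >> (~` A) by rewrite -setTD; exact: sC.
have sI A B : <<s orects >> A -> <<s orects >> B -> <<s orects >> (A `&` B).
  move=> GA GB; rewrite -[_ `&` _]setCK setCI; have := sC'; apply.
  by rewrite -bigcup2E; apply: sU => -[|[|n]] //=; exact: sC'.
have sX A : measurable A -> <<s orects >> (A `*` [set: mR]).
  move=> mA; have {mA} : (@RGenOpens.G R).-sigma.-measurable A.
    by rewrite -RGenOpens.measurableE.
  move: A.
  apply: (@smallest_sub _ _ _ [set A | <<s orects >> (A `*` [set: mR])]).
    split=> /=.
    - by rewrite set0X.
    - move=> B GB; rewrite setTD (_ : _ `*` _ = ~` (B `*` setT)); first exact: sC'.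
      by apply/seteqP; split => z /=; [move=> [? _] []|move=> nB; split => // ?; apply: nB].
    - by move=> F GF; rewrite setX_bigcupl; apply: sU.
  move=> _ [x [y ->]] /=; rewrite -bigcup_itvoo setX_bigcupr; apply: sU => n.
  by apply: sub_sigma_algebra; exists x, y, (- n%:R), n%:R.
have sY A : measurable A -> <<s orects >> ([set: mR] `*` A).
  move=> mA; have {mA} : (@RGenOpens.G R).-sigma.-measurable A.
    by rewrite -RGenOpens.measurableE.
  move: A.
  apply: (@smallest_sub _ _ _ [set A | <<s orects >> ([set: mR] `*` A)]).
    split=> /=.
    - by rewrite setX0.
    - move=> B GB; rewrite setTD (_ : _ `*` _ = ~` (setT `*` B)); first exact: sC'.
      by apply/seteqP; split => z /=; [move=> [_ ?] []|move=> nB; split => // ?; apply: nB].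
    - by move=> F GF; rewrite setX_bigcupr; apply: sU.
  move=> _ [x [y ->]] /=; rewrite -bigcup_itvoo setX_bigcupl; apply: sU => n.
  by apply: sub_sigma_algebra; exists (- n%:R), n%:R, x, y.
move=> _ [A mA] [B mB] <-.
rewrite -[A `*` B]/([set z | A z.1 /\ B z.2]).
rewrite (_ : [set z | _] = (A `*` setT) `&` (setT `*` B)); last first.
  by apply/seteqP; split => [z [? ?]|z [[? _] [_ ?]]].
by apply: sI; [exact: sX|exact: sY].
Qed.

Lemma test_measurable phi : test_function phi -> measurable_fun setT (phi : mR * mR -> R).
Proof. by move=> [H _]; apply: continuous_plane_measurable; exact: C_continuous (H 0%N). Qed.

Lemma sqintg_box r (u : mR * mR -> R) : measurable_fun setT u ->
  (exists2 C, forall z, `|u z| <= C & vanish_off (box r) u) -> sqintg mu u.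
Proof.
move=> mu_ [C HC Hr].
pose q := orect (- (`|r| + 1)) (`|r| + 1) (- (`|r| + 1)) (`|r| + 1).
have mq : measurable q by exact: measurable_orect.
have Iq : intg mu (fun z => C ^+ 2 * \1_q z).
  apply: intgZ; apply/integrableP; split; first by apply/measurable_EFinP; exact: measurable_indic.
  rewrite (eq_integral (fun x => (\1_q x)%:E)); last first.
    by move=> t _; rewrite gee0_abs// lee_fin.
  rewrite integral_indic// setIT /q /orect leb2X//.
  rewrite !lebesgue_measure_itv/=; case: ifP => _; last by rewrite mule0.
  by rewrite -EFinB -EFinM ltry.
split=> //; apply: intg_le Iq; first exact: measurable_funX.
move=> z; have C0 : 0 <= C by apply: le_trans (HC z).
have [bz|/Hr->] := pselect (box r z); last by rewrite expr0n normr0.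
have -> : \1_q z = 1 :> R.
  rewrite indicE mem_set//; apply/orectE; move: bz; rewrite /box/=.
  by have := ler_norm r; rewrite !ler_norml => h [/andP[? ?] /andP[? ?]]; apply/andP; split; lra.
rewrite mulr1 !normrX lerXn2r ?nnegrE//.
by rewrite [leRHS]ger0_norm.
Qed.

Lemma C0_bounded r phi : continuous phi -> vanish_off (box r) phi ->
  exists C, forall z, `|phi z| <= C.
Proof.
move=> cphi Hr.
have cK : compact (phi @` box r).
  by apply: continuous_compact; [exact: continuous_subspaceT|exact: compact_box].
have [M [_ HM]] := compact_bounded cK.
exists (`|M| + 1) => z; have M1 : M < `|M| + 1 by have := ler_norm M; lra.
have [bz|/Hr->] := pselect (box r z); last by rewrite normr0; have := normr_ge0 M; lra.
by apply: (HM _ M1); exists z.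
Qed.

Lemma test_bounded phi : test_function phi ->
  exists r C, (forall z, `|phi z| <= C) /\ vanish_off (box r) phi.
Proof.
move=> [H /compact_support[r Hr]]; exists r.
by have [C HC] := C0_bounded (C_continuous (H 0%N)) Hr; exists C.
Qed.

Lemma test_sqintg phi : test_function phi -> sqintg mu phi.
Proof.
move=> Hphi; have [r [C [HC Hr]]] := test_bounded Hphi.
by apply: (@sqintg_box r); [exact: test_measurable|exists C].
Qed.

Lemma sqintg_orect x1 y1 x2 y2 : sqintg mu (\1_(orect x1 y1 x2 y2)).
Proof.
apply: (@sqintg_box (`|x1| + `|y1| + `|x2| + `|y2|)).
  by apply: measurable_indic; exact: measurable_orect.
exists 1 => [z|z Kz]; first by rewrite indicE ger0_norm// lern1 leq_b1.
rewrite indicE memNset// => /orectE/andP[/andP[h1 h2] /andP[h3 h4]]; apply: Kz.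
rewrite /box/= in h1 h2 h3 h4 *; rewrite !ler_norml.
have := ler_norm x1; have := ler_norm (- x1); have := ler_norm x2; have := ler_norm (- x2).
have := ler_norm y1; have := ler_norm (- y1); have := ler_norm y2; have := ler_norm (- y2).
by rewrite !normrN; split; lra.
Qed.

Lemma bump_cvg x1 y1 x2 y2 z :
  bump n x1 y1 x2 y2 z @[n --> \oo] --> (\1_(orect x1 y1 x2 y2) z : R).
Proof.
have -> : \1_(orect x1 y1 x2 y2) z =
    (x1 < coord true z < y1)%R%:R * (x2 < coord false z < y2)%R%:R :> R.
  rewrite indicE -natrM mulnb; congr (nat_of_bool _)%:R.
  by apply/idP/idP => [/set_mem/orectE//|/orectE/mem_set].
by apply: cvgM; exact: bump1_cvg.
Qed.

(** Dominated convergence: the bumps lie between 0 and the indicator of the rectangle and converge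
    to it. *)
Lemma integral_orect_eq0 f x1 y1 x2 y2 :
  (forall q, sqintg mu q -> intg mu (fun z => f z * q z)) ->
  (forall phi, test_function phi -> \int[mu]_z (f z * phi z) = 0) ->
  (\int[mu]_z (f z * \1_(orect x1 y1 x2 y2) z)%:E = 0)%E.
Proof.
move=> Hf f0; set q := orect x1 y1 x2 y2.
have mq : measurable q by exact: measurable_orect.
have Iq := Hf _ (sqintg_orect x1 y1 x2 y2).
pose F n z := (f z * bump n x1 y1 x2 y2 z)%:E.
have tb n := test_bump n x1 y1 x2 y2.
have Ib n := Hf _ (test_sqintg (tb n)).
have H0 n : (\int[mu]_x F n x = 0)%E.
  have := f0 _ (tb n); rewrite /Rintegral => i0; rewrite -[RHS](congr1 EFin i0) fineK//.
  exact: integrable_fin_num (Ib n).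
have := @dominated_convergence _ _ _ mu setT measurableT F
  (fun z => (f z * \1_q z)%:E) (fun z => `|f z * \1_q z|%:E).
set P := (X in _ -> _ -> _ -> _ -> _ -> X) => DCT.
suff [_ _] : P.
  under eq_fun do rewrite H0.
  move=> H; apply/esym; move: H; apply: cvg_unique; first exact: ereal_hausdorff.
  exact: cvg_cst.
apply: DCT.
- by move=> n; have /integrableP[] := Ib n.
- by have /integrableP[] := Iq.
- apply: aeW => z _; apply: cvg_EFin; first exact: nearW.
  by apply: cvgM; [exact: cvg_cst|exact: bump_cvg].
- exact: intg_norm Iq.
- apply: aeW => z n _ /=; rewrite lee_fin normrM [leRHS]normrM ler_wpM2l//.
  have /andP[b0 b1] := bump_itv n x1 y1 x2 y2 z.
  rewrite ger0_norm// indicE; have [qz|] := boolP (z \in q); first by rewrite normr1.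
  move=> /negP qz; rewrite normr0 /bump.
  have [h1|/bump1_out->] := boolP (x1 < coord true z < y1); last by rewrite mul0r.
  have [h2|/bump1_out->] := boolP (x2 < coord false z < y2); last by rewrite mulr0.
  by exfalso; apply: qz; apply/mem_set/orectE; rewrite h1 h2.
Qed.

(** After localisation to a square, [f] is integrable and the sets over which its integral vanishes
    form a Dynkin class containing the open rectangles. The integrability assumption is the dual
    form of being in L^2: it is what [avg_pairing] gives for an average, without a norm estimate. *)
Lemma fundamental_lemma f :
  (forall q, sqintg mu q -> intg mu (fun z => f z * q z)) ->
  (forall phi, test_function phi -> \int[mu]_z (f z * phi z) = 0) ->
  ae_eq mu setT f (cst 0).
Proof.
move=> Hf f0.
have HN (N : nat) : ae_eq mu setT (fun z => f z * \1_(orect (- N%:R) N%:R (- N%:R) N%:R) z) (cst 0).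
  set q := orect _ _ _ _.
  pose g z := f z * \1_q z.
  have Ig : intg mu g := Hf _ (sqintg_orect _ _ _ _).
  have IgS A : measurable A -> mu.-integrable A (EFin \o g).
    by move=> mA; apply: integrableS Ig.
  have g0T : (\int[mu]_z (g z)%:E = 0)%E by exact: integral_orect_eq0.
  have g0 : forall A : set (mR * mR), measurable A -> (\int[mu]_(z in A) (g z)%:E = 0)%E.
    move=> A mA; have := mA; rewrite measurable_orects => mA'.
    apply: (@dynkin_induction _ _ orects (fun A => \int[mu]_(z in A) (g z)%:E = 0)%E
      measurable_orects _ _ _ _ _ A mA').
    - move=> _ _ [x1 [y1 [x2 [y2 ->]]]] [x1' [y1' [x2' [y2' ->]]]].
      by rewrite orectI; do 4 eexists; reflexivity.
    - exact: integral_orect_eq0.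
    - move=> _ [x1 [y1 [x2 [y2 ->]]]].
      rewrite integral_mkcond -[RHS](integral_orect_eq0 (Num.max x1 (- N%:R))
        (Num.min y1 N%:R) (Num.max x2 (- N%:R)) (Num.min y2 N%:R) Hf f0).
      apply: eq_integral => z _; rewrite -orectI -/q indicI restrict_EFin /= patchE.
      by rewrite /g; case: ifP => h; rewrite !indicE ?h ?mul1r// mul0r mulr0.
    - move=> S mS IS.
      have mg : measurable_fun (S `|` ~` S) (EFin \o g).
        by apply: measurable_funTS; have /integrableP[] := Ig.
      have dS : [disjoint S & ~` S] by apply/disj_setPCl.
      have := integral_setU mu mS (measurableC mS) mg dS.
      by rewrite setUCr IS add0e => <-; have := g0T.
    - move=> F mF tF F0; rewrite integral_bigcup//; last first.
        by apply: IgS; exact: bigcupT_measurable.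
      by under eq_eseriesr do rewrite F0; rewrite eseries0.
  have := integral_ae_eq measurableT (mu := mu) (f := EFin \o g) (g := cst 0%E) Ig.
  move=> /(_ (measurable_cst _)) H; have {H} := H _.
  have H E : E `<=` [set: mR * mR] -> measurable E ->
      (\int[mu]_(x in E) (EFin \o g) x = \int[mu]_(x in E) cst 0 x)%E.
    by move=> _ mE; rewrite g0// integral0.
  by move=> /(_ H); apply: filterS => z h zT; have [] := h zT.
have : {ae mu, forall z, forall N : nat,
    setT z -> f z * \1_(orect (- N%:R) N%:R (- N%:R) N%:R) z = 0}.
  by apply: ae_foralln.
apply: ae_mono => z h _; have [N [_ hN]] : exists N : nat, True /\ (`|z.1| < N%:R /\ `|z.2| < N%:R).
  exists (maxn (Num.truncn `|z.1|).+1 (Num.truncn `|z.2|).+1); split => //.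
  have /andP[_ H1] := truncn_itv (normr_ge0 z.1).
  have /andP[_ H2] := truncn_itv (normr_ge0 z.2).
  by split; [apply: lt_le_trans H1 _|apply: lt_le_trans H2 _]; rewrite ler_nat ?leq_maxl ?leq_maxr.
have := h N I; rewrite indicE mem_set ?mulr1//.
by apply/orectE; rewrite /coord -!ltr_norml; apply/andP.
Qed.

End rectangles.

(** * Averages along segments, and translates of weakly differentiable functions *)

Section averages.
Variable R : realType.
Notation mR := (measurableTypeR R).
Notation mu := (leb2 R).
Notation leb := (@lebesgue_measure R).
Implicit Types (f g u v q : R * R -> R) (z : R * R) (b : bool) (h c s : R).

Lemma leb2_sigma_finite : sigma_finite setT mu.
Proof.
exists (fun n : nat => orect (- n%:R) n%:R (- n%:R) n%:R).
  apply/seteqP; split => // z _.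
  exists (maxn (Num.truncn `|z.1|).+1 (Num.truncn `|z.2|).+1) => //.
  have /andP[_ H1] := truncn_itv (normr_ge0 z.1).
  have /andP[_ H2] := truncn_itv (normr_ge0 z.2).
  apply/orectE; rewrite -!ltr_norml; apply/andP; split.
    by apply: lt_le_trans H1 _; rewrite ler_nat leq_maxl.
  by apply: lt_le_trans H2 _; rewrite ler_nat leq_maxr.
move=> n; split; first exact: measurable_orect.
rewrite /orect leb2X// !lebesgue_measure_itv/=.
by case: ifP => _; rewrite ?mule0// -EFinB -EFinM ltry.
Qed.

(** A copy of [leb2], to which the sigma-finiteness needed by Fubini's theorem can
    be attached. *)
Definition plane_measure : set (mR * mR) -> \bar R := mu.
HB.instance Definition _ := Measure.on plane_measure.
HB.instance Definition _ := Measure_isSigmaFinite.Build _ _ _ plane_measure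
  leb2_sigma_finite.

Definition mu2 : {sigma_finite_measure set (mR * mR)%type -> \bar R} := plane_measure.

Lemma measurable_sh2 b c : measurable_fun setT
  (fun w : (mR * mR) * mR => sh b (c * w.2) w.1 : mR * mR).
Proof.
have m1 : measurable_fun setT (fun w : (mR * mR) * mR => w.1.1) by exact: measurableT_comp.
have m2 : measurable_fun setT (fun w : (mR * mR) * mR => w.1.2) by exact: measurableT_comp.
have m3 : measurable_fun setT (fun w : (mR * mR) * mR => c * w.2) by exact: measurable_funM.
by case: b; apply: measurable_fun_pair => //=; exact: measurable_funD.
Qed.

(** Writes integrals over [0, h] as integrals over the line, so that Fubini's theorem applies to a
    full product space. *)
Definition wt h s : R := \1_`[0, h]%classic s.

Lemma wt_ge0 h s : 0 <= wt h s. Proof. by rewrite /wt indicE. Qed.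

Lemma measurable_wt h : measurable_fun setT (wt h : mR -> R).
Proof. by apply: measurable_indic; exact: measurable_itv. Qed.

Lemma intg_wt h : intg leb (wt h).
Proof. by have := @integrable_indic_itv R 0 h true false. Qed.

Lemma Rint_wt h : 0 <= h -> \int[leb]_s wt h s = h.
Proof.
move=> h0; rewrite /Rintegral /wt integral_indic//.
transitivity (fine (leb `[0, h]%classic)); first by congr (fine (leb _)); exact: setIT.
rewrite lebesgue_measure_itv/= lte_fin; case: ltP => //= h1; first by rewrite subr0.
by apply/eqP; rewrite eq_le h0.
Qed.

(** Not divided by [h], as in the fundamental theorem of calculus. The value [c = 1] integrates
    forward from [z], and [c = -1] backward, which is the adjoint operation. *)
Definition avg b c h g z := \int[leb]_s (wt h s * g (sh b (c * s) z)).

Lemma measurable_shift_kernel b c h g : measurable_fun setT (g : mR * mR -> R) ->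
  measurable_fun setT (fun w : (mR * mR) * mR => wt h w.2 * g (sh b (c * w.2) w.1)).
Proof.
move=> mg; apply: measurable_funM.
  by apply: measurableT_comp => //; exact: measurable_wt.
exact: (measurableT_comp mg (measurable_sh2 b c)).
Qed.

Lemma measurable_avg b c h g : measurable_fun setT (g : mR * mR -> R) ->
  measurable_fun setT (avg b c h g : mR * mR -> R).
Proof.
move=> mg; pose k (w : (mR * mR) * mR) := (wt h w.2 * g (sh b (c * w.2) w.1))%:E.
have mk : measurable_fun setT k.
  by apply/measurable_EFinP; exact: measurable_shift_kernel.
have mF : measurable_fun setT (fun z : mR * mR => (\int[leb]_s k (z, s))%E).
  (* The slice at a given [z] need not be integrable, so the positive and negative parts are treated
     by Tonelli separately. *)
  rewrite (_ : (fun _ => _) = fun z => (\int[leb]_s (k^\+)%E (z, s) - \int[leb]_s (k^\-)%E (z, s))%E).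
    apply: emeasurable_funB.
      apply: (@measurable_fun_fubini_tonelli_F _ _ _ _ _ leb (k^\+)%E) => //.
      exact: measurable_funepos.
    apply: (@measurable_fun_fubini_tonelli_F _ _ _ _ _ leb (k^\-)%E) => //.
    exact: measurable_funeneg.
  apply/funext => z; rewrite [LHS]integralE.
  under eq_integral do rewrite funepos_comp/=.
  by under [X in (_ - X)%E = _]eq_integral do rewrite funeneg_comp/=.
exact: (measurableT_comp (@fine_measurable _ _ measurableT) mF).
Qed.

Lemma shift_pairing_bound b h g q : sqintg mu g -> sqintg mu q ->
  \int[mu]_z `|q z * g (sh b h z)| <= nrm mu q * nrm mu g.
Proof.
move=> Hg Hq; rewrite -(nrm_sh b h Hg).
under eq_Rint do rewrite normrM.
by apply: Rint_normM => //; exact: sqintg_sh.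
Qed.

(** Integrating in z first: Cauchy-Schwarz and translation invariance bound the integral for fixed s
    by the product of the norms. The factor [q] is what brings integrability over the whole
    plane. *)
Lemma intg_shift_kernel b c h g q : sqintg mu g -> sqintg mu q ->
  intg (mu2 \x leb)%E (fun w => q w.1 * (wt h w.2 * g (sh b (c * w.2) w.1))).
Proof.
move=> Hg Hq.
have mk : measurable_fun setT (fun w : (mR * mR) * mR => q w.1 * (wt h w.2 * g (sh b (c * w.2) w.1))).
  apply: measurable_funM; first by apply: measurableT_comp => //; exact: Hq.1.
  by apply: measurable_shift_kernel; exact: Hg.1.
apply/(integrable21ltyP _).
  exact/measurable_EFinP.
apply: (@le_lt_trans _ _ (\int[leb]_s ((nrm mu q * nrm mu g) * wt h s)%:E)%E); last first.
  by apply: integrable_lty => //; apply: intgZ; exact: intg_wt.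
apply: ge0_le_integral => //.
- by move=> s _; apply: integral_ge0.
- apply: (@measurable_fun_fubini_tonelli_G _ _ _ _ _ mu2 (fun w => `|(q w.1 * (wt h w.2 * g (sh b (c * w.2) w.1)))%:E|%E)) => //.
  by apply: measurableT_comp => //; exact/measurable_EFinP.
- by apply/measurable_EFinP; apply: measurable_funM => //; exact: measurable_wt.
- move=> s _.
  have Iqg : intg mu (fun z => `|q z * g (sh b (c * s) z)|).
    by apply: intg_norm; apply: sqintgM => //; exact: sqintg_sh.
  have -> : (\int[mu2]_z `|(q z * (wt h s * g (sh b (c * s) z)))%:E| =
      \int[mu]_z (wt h s * `|q z * g (sh b (c * s) z)|)%:E)%E.
    apply: eq_integral => z _; rewrite /= mulrCA normrM.
    by rewrite (ger0_norm (wt_ge0 _ _)).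
  rewrite -(fineK (integrable_fin_num measurableT (intgZ (wt h s) Iqg))) lee_fin.
  rewrite -[fine _]/(\int[mu]_z (wt h s * `|q z * g (sh b (c * s) z)|)) RintZ// mulrC.
  by rewrite ler_wpM2r ?wt_ge0// shift_pairing_bound.
Qed.

Lemma avg_pairing b c h g q : sqintg mu g -> sqintg mu q ->
  intg mu (fun z => q z * avg b c h g z) /\
  \int[mu]_z (q z * avg b c h g z) =
  \int[leb]_s (wt h s * \int[mu]_z (q z * g (sh b (c * s) z))).
Proof.
move=> Hg Hq; have Ik := intg_shift_kernel b c h Hg Hq.
set k := (fun w => _) in Ik.
have mA : measurable_fun setT (fun z : mR * mR => q z * avg b c h g z).
  by apply: measurable_funM; [exact: Hq.1|apply: measurable_avg; exact: Hg.1].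
have aeF : {ae mu, forall z, (\int[leb]_s (k (z, s))%:E = (q z * avg b c h g z)%:E)%E}.
  have := ae_integrable1 Ik; apply: ae_mono => z /= Iz.
  (* Where [q z = 0] nothing is known about the slice of [g], but both sides vanish. *)
  have [q0|qn0] := eqVneq (q z) 0.
    rewrite q0 mul0r; under eq_integral do rewrite /k /= q0 mul0r.
    by rewrite integral0.
  have Iw : intg leb (fun s => wt h s * g (sh b (c * s) z)).
    have := intgZ (q z)^-1 (Iz : intg leb (fun s => k (z, s))).
    by apply: eq_intg => s; rewrite /k /= mulKf.
  rewrite /avg -RintZ// /Rintegral fineK//.
  by apply: (integrable_fin_num measurableT); exact: (intgZ (q z) Iw).
have IF := integrable_fubini_F Ik.
have IA : intg mu (fun z => q z * avg b c h g z).
  apply/integrableP; split; first exact/measurable_EFinP.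
  have /integrableP[mF] := IF; apply: le_lt_trans.
  rewrite le_eqVlt; apply/orP; left; apply/eqP.
  apply: ge0_ae_eq_integral => //.
  - by apply: measurableT_comp => //; exact/measurable_EFinP.
  - exact: measurableT_comp.
  - by move: aeF; apply: ae_mono => z /= h1 _; rewrite /fubini_F h1.
split => //.
have E1 : (\int[mu]_z (q z * avg b c h g z)%:E = \int[mu2]_z \int[leb]_s (k (z, s))%:E)%E.
  apply: ae_eq_integral => //.
  - exact/measurable_EFinP.
  - by have /integrableP[] := IF.
  - by move: aeF; apply: ae_mono => z /= h1 _; rewrite h1.
rewrite /Rintegral E1 (Fubini Ik); congr fine; apply: eq_integral => s _.
rewrite -[RHS]/((wt h s * \int[mu]_z (q z * g (sh b (c * s) z)))%:E).
have Iqg : intg mu (fun z => q z * g (sh b (c * s) z)).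
  by apply: sqintgM => //; exact: sqintg_sh.
rewrite -RintZ// /Rintegral fineK; last first.
  by apply: (integrable_fin_num measurableT); exact: (intgZ (wt h s) Iqg).
by apply: eq_integral => z _; rewrite /k /= mulrCA.
Qed.

Lemma intg_shift_pairing b c h g q : sqintg mu g -> sqintg mu q ->
  intg leb (fun s => wt h s * \int[mu]_z (q z * g (sh b (c * s) z))).
Proof.
move=> Hg Hq; have Ik := intg_shift_kernel b c h Hg Hq.
have mG := measurable_fubini_G Ik.
have E s : fubini_G mu2 (EFin \o (fun w => q w.1 * (wt h w.2 * g (sh b (c * w.2) w.1)))) s =
    (wt h s * \int[mu]_z (q z * g (sh b (c * s) z)))%:E.
  have Iqg : intg mu (fun z => q z * g (sh b (c * s) z)).
    by apply: sqintgM => //; exact: sqintg_sh.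
  rewrite /fubini_G /= -RintZ// /Rintegral fineK; last first.
    by apply: (integrable_fin_num measurableT); exact: (intgZ (wt h s) Iqg).
  by apply: eq_integral => z _; rewrite /= mulrCA.
have {}mG : measurable_fun setT (fun s : mR => (wt h s * \int[mu]_z (q z * g (sh b (c * s) z)))%:E).
  by apply: eq_measurable_fun mG => s _; exact: E.
apply: (@intg_le _ _ _ leb _ (fun s : mR => (nrm mu q * nrm mu g) * wt h s)).
- exact/measurable_EFinP.
- move=> s; rewrite !normrM (ger0_norm (wt_ge0 _ _)) !(ger0_norm (nrm_ge0 _ _)) mulrC.
  rewrite ler_wpM2r ?wt_ge0// -(nrm_sh b (c * s) Hg).
  by apply: cauchy_schwarz => //; exact: sqintg_sh.
- by apply: intgZ; exact: intg_wt.
Qed.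

Lemma avg_pairing1 b h g q : sqintg mu g -> sqintg mu q ->
  intg mu (fun z => q z * avg b 1 h g z) /\
  \int[mu]_z (q z * avg b 1 h g z) =
  \int[leb]_s (wt h s * \int[mu]_z (q z * g (sh b s z))).
Proof.
move=> Hg Hq; have [? ->] := avg_pairing b 1 h Hg Hq; split => //.
by apply: eq_Rint => s; congr (_ * _); apply: eq_Rint => z; rewrite mul1r.
Qed.

Lemma intg_shift_pairing1 b h g q : sqintg mu g -> sqintg mu q ->
  intg leb (fun s => wt h s * \int[mu]_z (q z * g (sh b s z))).
Proof.
move=> Hg Hq; have := intg_shift_pairing b 1 h Hg Hq; apply: eq_intg => s.
by congr (_ * _); apply: eq_Rint => z; rewrite mul1r.
Qed.

Lemma Rint_wtE h (f : R -> R) :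
  \int[leb]_s (wt h s * f s) = \int[leb]_(s in `[0, h]) f s.
Proof.
rewrite [RHS]Rintegral_mkcond; apply: eq_Rint => s; rewrite patchE /wt indicE.
by case: ifP => _; rewrite ?mul1r ?mul0r.
Qed.

Lemma Rint_wt_le h (f : R -> R) C : 0 <= h -> intg leb (fun s => wt h s * f s) ->
  (forall s, 0 <= s <= h -> f s <= C) -> \int[leb]_s (wt h s * f s) <= C * h.
Proof.
move=> h0 If fC; rewrite -[X in _ <= _ * X](Rint_wt h0) -RintZ; last exact: intg_wt.
apply: le_Rint => //; first by apply: intgZ; exact: intg_wt.
move=> s; rewrite mulrC /wt indicE; case: (boolP (s \in _)) => [/set_mem|_]; last by rewrite !mulr0.
by rewrite /= in_itv/= !mulr1 => /fC.
Qed.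

Lemma norm_Rint_wt_le h (f : R -> R) C : 0 <= h -> intg leb (fun s => wt h s * f s) ->
  (forall s, 0 <= s <= h -> `|f s| <= C) -> `|\int[leb]_s (wt h s * f s)| <= C * h.
Proof.
move=> h0 If fC; apply: le_trans (norm_Rint If) _.
under eq_Rint do rewrite normrM (ger0_norm (wt_ge0 _ _)).
apply: (Rint_wt_le h0) => //.
have := intg_norm If; apply: eq_intg => s.
by rewrite normrM (ger0_norm (wt_ge0 _ _)).
Qed.

Lemma is_derive_sh n b (c : bool) h phi z : C_ n.+1 phi ->
  is_derive z (ee R c) (fun z => phi (sh b h z)) (dd c phi (sh b h z)).
Proof.
move=> /C_S[_ D _]; split.
  rewrite -[z](sh0 c); apply/derivable_slice.
  under eq_fun do rewrite shC.
  by apply/derivable_slice; rewrite sh0; exact: D.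
transitivity (dd c (fun z => phi (sh b h z)) z); first by case: c.
rewrite -[z in LHS](sh0 c) -derive_slice.
under eq_fun do rewrite shC.
by rewrite derive_slice sh0.
Qed.

Lemma dd_sh n b (c : bool) h phi z : C_ n.+1 phi ->
  dd c (fun z => phi (sh b h z)) z = dd c phi (sh b h z).
Proof. by move=> Hphi; apply: ddP; exact: is_derive_sh Hphi. Qed.

Lemma test_sh b h phi : test_function phi -> test_function (fun z => phi (sh b h z)).
Proof.
have csh : continuous (sh b h : R * R -> R * R).
  have -> : sh b h = (fun z : R * R => h *: ee R b + z) by apply/funext => z; rewrite sh_ee.
  by move=> z; apply: cvgD; [exact: cvg_cst|exact: cvg_id].
move=> [Hphi /compact_support[r Hr]]; split; last first.
  apply/compact_support; exists (`|r| + `|h|) => z Kz; apply: Hr => Krz; apply: Kz.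
  move: Krz; rewrite /box/sh; have := ler_norm r; have := ler_norm h; have := ler_norm (- h).
  have := normr_ge0 h; rewrite normrN.
  by case: b {csh} => /= ? ? ? ? []; rewrite !ler_norml => /andP[? ?] /andP[? ?]; split; apply/andP; split; lra.
move=> n; elim: n phi Hphi {Hr} => [|n IH] phi Hphi.
  by split => // z; apply: continuous_comp; [exact: csh|exact: (C_continuous (Hphi 0%N))].
apply: (C_S_intro (g := fun (c : bool) z => dd c phi (sh b h z))).
- by move=> z; apply: continuous_comp; [exact: csh|exact: (C_continuous (Hphi 0%N))].
- by move=> c z; exact: is_derive_sh (Hphi 1%N).
- by move=> c; apply: IH => k; exact: C_dd (Hphi k.+1).
Qed.

Lemma avg_dd b h phi z : 0 <= h -> test_function phi ->
  avg b (-1) h (dd b phi) z = phi z - phi (sh b (- h) z).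
Proof.
move=> h0 [Hphi _]; rewrite /avg Rint_wtE.
move: h0; rewrite le_eqVlt => /predU1P[<-|h0].
  by rewrite oppr0 sh0 subrr set_itv1 Rintegral_set1.
pose F (s : R) := - phi (sh b (- s) z).
have dF (s : R) : is_derive s 1 F (dd b phi (sh b (-1 * s) z)).
  have d1 : is_derive s (1 : R) (fun t : R => - t) (-1) by exact: is_deriveNid.
  have := @is_derive1_comp _ (fun t => phi (sh b t z)) (fun t : R => - t) s _ _
    (is_derive_slice b z (- s) (Hphi 1%N)) d1.
  move=> /is_deriveN; rewrite mulrN1 opprK mulN1r; exact.
have cF : continuous F.
  by move=> s; apply/differentiable_continuous/derivable1_diffP; have [] := dF s.
have cf : continuous (fun s => dd b phi (sh b (-1 * s) z)).
  move=> s; apply/differentiable_continuous/derivable1_diffP.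
  have d1 : is_derive s (1 : R) (fun t : R => -1 * t) (-1).
    by apply: is_derive_eq; rewrite /GRing.scale /=; ring.
  have := @is_derive1_comp _ (fun t => dd b phi (sh b t z)) (fun t : R => -1 * t) s _ _
    (is_derive_slice b z (-1 * s) (C_dd b (Hphi 2%N))) d1.
  by case.
rewrite /Rintegral (@continuous_FTC2 _ _ F)//.
- by rewrite -EFinB /= /F oppr0 sh0 opprK addrC.
- exact: continuous_subspaceT.
- split.
  + by move=> s _; have [] := dF s.
  + exact: cvg_at_right_filter (cF 0).
  + exact: cvg_at_left_filter (cF h).
- by move=> s _; rewrite derive1E; have [] := dF s.
Qed.

Definition wd b u g := [/\ sqintg mu u, sqintg mu g &
  forall phi, test_function phi ->
    \int[mu]_z (u z * dd b phi z) = - \int[mu]_z (g z * phi z)].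

Lemma Rint_shM b h u v : sqintg mu u -> sqintg mu v ->
  \int[mu]_z (u (sh b h z) * v z) = \int[mu]_z (u z * v (sh b (- h) z)).
Proof.
move=> Hu Hv; rewrite -(Rint_sh b h (f := fun z => u z * v (sh b (- h) z))).
  by apply: eq_Rint => z; rewrite shD subrr sh0.
by apply: sqintgM => //; exact: sqintg_sh.
Qed.

(** The fundamental theorem of calculus in weak form. Tested against phi, the increment of u moves
    to phi(. - h) - phi, an integral of translates of the derivative of phi; each translate is
    itself a test function, so the definition of [g] applies under the integral. *)
Lemma wd_avg b u g h : 0 <= h -> wd b u g ->
  ae_eq mu setT (fun z => u (sh b h z) - u z) (avg b 1 h g).
Proof.
move=> h0 [Hu Hg ug].
have Hw : sqintg mu (fun z => u (sh b h z) - u z) by apply: sqintgB => //; exact: sqintg_sh.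
have H1 q : sqintg mu q -> intg mu (fun z => (u (sh b h z) - u z - avg b 1 h g z) * q z).
  move=> Hq; have [Iq _] := avg_pairing b 1 h Hg Hq.
  have := intgB (sqintgM Hw Hq) Iq; apply: eq_intg => z; ring.
have : ae_eq mu setT (fun z => u (sh b h z) - u z - avg b 1 h g z) (cst 0).
  apply: fundamental_lemma => // phi Hphi.
  have Hp := test_sqintg Hphi; have [Iq Eq] := avg_pairing b 1 h Hg Hp.
  have Hd : sqintg mu (dd b phi) by apply: test_sqintg; exact: test_dd.
  transitivity (\int[mu]_z ((u (sh b h z) * phi z - u z * phi z) - phi z * avg b 1 h g z)).
    by apply: eq_Rint => z; ring.
  have I1 : intg mu (fun z => u (sh b h z) * phi z) by apply: sqintgM => //; exact: sqintg_sh.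
  have I2 := sqintgM Hu Hp.
  rewrite RintB//; last exact: intgB.
  rewrite RintB// Eq Rint_shM//.
  have E s : wt h s * \int[mu]_z (phi z * g (sh b (1 * s) z)) =
      - (wt h s * \int[mu]_z (u z * dd b phi (sh b (-1 * s) z))).
    rewrite -mulrN; congr (_ * _).
    have Ht := test_sh b (- s) Hphi.
    transitivity (\int[mu]_z (g z * phi (sh b (- s) z))).
      by rewrite -Rint_shM//; apply: eq_Rint => z; rewrite mul1r mulrC.
    rewrite -[LHS]opprK -ug//; congr (- _); apply: eq_Rint => z; congr (_ * _).
    by rewrite (@dd_sh 0%N) ?mulN1r//; exact: Hphi.1 1%N.
  under [X in _ - _ - X]eq_Rint do rewrite E.
  rewrite RintN; last exact: intg_shift_pairing.
  have [Iu Eu] := avg_pairing b (-1) h Hd Hu.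
  rewrite -Eu.
  under [X in _ - - X]eq_Rint do rewrite avg_dd//.
  have -> : \int[mu]_z (u z * (phi z - phi (sh b (- h) z))) =
      \int[mu]_z (u z * phi z) - \int[mu]_z (u z * phi (sh b (- h) z)).
    rewrite -RintB//; last by apply: sqintgM => //; exact: sqintg_sh.
    by apply: eq_Rint => z; rewrite mulrBr.
  by ring.
by apply: ae_mono => z h1 /h1 /eqP; rewrite subr_eq0 => /eqP.
Qed.

Lemma wd_pairing b u g h q : 0 <= h -> wd b u g -> sqintg mu q ->
  \int[mu]_z ((u (sh b h z) - u z) * q z) =
  \int[leb]_s (wt h s * \int[mu]_z (q z * g (sh b s z))).
Proof.
move=> h0 Hug Hq; have [Hu Hg _] := Hug; have [Iq] := avg_pairing b 1 h Hg Hq.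
under [X in _ = X -> _]eq_Rint do under eq_Rint do rewrite mul1r.
move=> <-; apply: ae_Rint.
- by apply: measurable_funM; [apply: (sqintgB (sqintg_sh b h Hu) Hu).1|exact: Hq.1].
- exact: intg_measurable Iq.
- by have := wd_avg h0 Hug; apply: ae_mono => z e /e ->; rewrite mulrC.
Qed.

End averages.

(** * Estimates from weak derivatives: increments in L^2 and an essential bound *)

Section weak_derivatives.
Variable R : realType.
Notation mR := (measurableTypeR R).
Notation mu := (leb2 R).
Notation leb := (@lebesgue_measure R).
Implicit Types (f g u v q : R * R -> R) (z : R * R) (b : bool) (h c s : R).

(** Minkowski's integral inequality by duality: the increment is paired with itself in [wd_pairing],
    and one factor of its norm is divided out. *)
Lemma wd_lip b u g h : 0 <= h -> wd b u g ->
  nrm mu (fun z => u (sh b h z) - u z) <= h * nrm mu g.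
Proof.
move=> h0 Hug; have [Hu Hg _] := Hug; set w := fun z => _.
have Hw : sqintg mu w by apply: sqintgB => //; exact: sqintg_sh.
have [w0|wn0] := eqVneq (nrm mu w) 0; first by rewrite w0 mulr_ge0// nrm_ge0.
have wp : 0 < nrm mu w by rewrite lt_neqAle eq_sym wn0 nrm_ge0.
rewrite -(ler_pM2l wp) -expr2 nrm_sqr.
under eq_Rint do rewrite expr2.
rewrite (wd_pairing h0 Hug Hw) mulrCA mulrC; apply: Rint_wt_le => //.
  have := intg_shift_pairing b 1 h Hg Hw; apply: eq_intg => s.
  by congr (_ * _); apply: eq_Rint => z; rewrite mul1r.
move=> s _; apply: le_trans (ler_norm _) _; rewrite -(nrm_sh b s Hg).
by apply: cauchy_schwarz => //; exact: sqintg_sh.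
Qed.

Lemma wd_difference b u g h q C : 0 <= h -> 0 <= C -> wd b u g -> sqintg mu q ->
  (forall s, 0 <= s <= h -> nrm mu (fun z => q (sh b s z) - q z) <= C * s) ->
  `|\int[mu]_z ((u (sh b h z) - u z) * q z) - h * \int[mu]_z (g z * q z)| <=
    nrm mu g * C * h ^+ 2.
Proof.
move=> h0 C0 Hug Hq qC; have [Hu Hg _] := Hug.
have I1 : intg leb (fun s => wt h s * \int[mu]_z (q z * g (sh b s z))).
  have := intg_shift_pairing b 1 h Hg Hq; apply: eq_intg => s.
  by congr (_ * _); apply: eq_Rint => z; rewrite mul1r.
have I2 : intg leb (fun s => \int[mu]_z (g z * q z) * wt h s) by apply: intgZ; exact: intg_wt.
rewrite (wd_pairing h0 Hug Hq) -[h in h * _](Rint_wt h0) mulrC -RintZ; last exact: intg_wt.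
rewrite -RintB//.
(* Translation invariance moves the increment from [g], which is merely in L^2, to [q], whose
   increments are O(s); integrating over [0, h] gives the second factor h. *)
have E s : wt h s * \int[mu]_z (q z * g (sh b s z)) - \int[mu]_z (g z * q z) * wt h s =
    wt h s * \int[mu]_z ((q z - q (sh b s z)) * g (sh b s z)).
  rewrite [\int[mu]_z (g z * q z) * _]mulrC -mulrBr; congr (_ * _).
  rewrite -(Rint_sh b s (sqintgM Hg Hq)) -RintB//.
  - by apply: eq_Rint => z; ring.
  - by apply: sqintgM => //; exact: sqintg_sh.
  - by apply: sqintgM => //; exact: sqintg_sh.
under eq_Rint do rewrite E.
rewrite expr2 mulrA; apply: norm_Rint_wt_le => //.
  by have := intgB I1 I2; apply: eq_intg => s; rewrite E.
move=> s /andP[s0 s_h].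
apply: le_trans (cauchy_schwarz _ _) _.
- by apply: sqintgB => //; exact: sqintg_sh.
- exact: sqintg_sh.
rewrite nrm_sh// mulrC -mulrA ler_wpM2l ?nrm_ge0//.
rewrite (_ : nrm _ _ = nrm mu (fun z => q (sh b s z) - q z)).
  by apply: le_trans (qC _ _) _; [rewrite s0 s_h|rewrite ler_wpM2l].
transitivity (nrm mu (fun z => - (q (sh b s z) - q z))).
  by apply: eq_nrm => z; rewrite opprB.
by apply: nrmN; apply: sqintgB => //; exact: sqintg_sh.
Qed.

(** The test function is the indicator of f < 0 cut off to a square, and the squares exhaust the
    plane. *)
Lemma ae_ge0_pairing f : (forall q, sqintg mu q -> intg mu (fun z => f z * q z)) ->
  measurable_fun setT (f : mR * mR -> R) ->
  (forall q, sqintg mu q -> (forall z, 0 <= q z) -> 0 <= \int[mu]_z (f z * q z)) ->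
  {ae mu, forall z, 0 <= f z}.
Proof.
move=> If mf f0.
pose S := [set z | f z < 0].
have mS : measurable (S : set (mR * mR)).
  rewrite -[S]setTI; have := mf measurableT `]-oo, 0[%classic (measurable_itv _).
  rewrite (_ : [set: mR * mR] `&` f @^-1` _ = [set: mR * mR] `&` S)//.
have HN (N : nat) : {ae mu, forall z, orect (- N%:R) N%:R (- N%:R) N%:R z -> 0 <= f z}.
  set Q := orect _ _ _ _.
  pose q z : R := \1_S z * \1_Q z.
  have q0 z : 0 <= q z by rewrite /q !indicE mulr_ge0.
  have Hq : sqintg mu q.
    apply: (@sqintg_le _ _ _ _ _ (\1_Q)); last exact: sqintg_orect.
      by apply: measurable_funM; apply: measurable_indic => //; exact: measurable_orect.
    move=> z; rewrite ger0_norm// ger0_norm ?indicE// /q !indicE ler_piMl//.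
    by rewrite lern1 leq_b1.
  have fq z : f z * q z <= 0.
    rewrite /q [\1_S z]indicE; case: (boolP (z \in S)) => [/set_mem Sz|_].
      by rewrite mul1r mulr_le0_ge0// ?ltW// indicE.
    by rewrite mul0r mulr0.
  have I0 : \int[mu]_z (f z * q z) = 0.
    apply/eqP; rewrite eq_le f0// andbT -oppr_ge0 -RintN; last exact: If.
    by apply: Rint_ge0 => z; rewrite oppr_ge0.
  have : ae_eq mu setT (fun z => (f z * q z)%:E) (cst 0%E).
    apply/ae_eq_integral_abs => //; first by have /integrableP[] := If _ Hq.
    have := integrable_fin_num measurableT (intg_norm (If _ Hq)) => fi.
    rewrite -[RHS]/(0%:E) -[X in _ = X%:E]oppr0 -I0 -RintN; last exact: If.
    rewrite /Rintegral fineK; last first.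
      by have := integrable_fin_num measurableT (intgN (If _ Hq)).
    by apply: eq_integral => z _ /=; rewrite ler0_norm.
  apply: ae_mono => z /(_ I) [] fz Qz; rewrite leNgt; apply/negP => fz0.
  move: fz; rewrite /q !indicE !mem_set// !mulr1 => fz.
  by move: fz0; rewrite fz ltxx.
have := ae_foralln HN; apply: ae_mono => z h.
apply: (h (maxn (Num.truncn `|z.1|).+1 (Num.truncn `|z.2|).+1)).
have /andP[_ H1] := truncn_itv (normr_ge0 z.1).
have /andP[_ H2] := truncn_itv (normr_ge0 z.2).
apply/orectE; rewrite -!ltr_norml; apply/andP; split.
  by apply: lt_le_trans H1 _; rewrite ler_nat leq_maxl.
by apply: lt_le_trans H2 _; rewrite ler_nat leq_maxr.
Qed.

(** Averaging |u| <= |u(. + h)| + |u(. + h) - u| over h in [0, 1]; done in dual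
    form, so that only integrals against q >= 0 are exchanged. *)
Lemma wd_abs_avg b u g : wd b u g ->
  {ae mu, forall z, `|u z| <= avg b 1 1 (fun z => `|u z| + `|g z|) z}.
Proof.
move=> Hug; have [Hu Hg _] := Hug.
have Hau := sqintg_norm Hu; have Hag := sqintg_norm Hg.
have Hs := sqintgD Hau Hag.
suff : {ae mu, forall z, 0 <= avg b 1 1 (fun z => `|u z| + `|g z|) z - `|u z|}.
  by apply: ae_mono => z; rewrite subr_ge0.
apply: ae_ge0_pairing.
- move=> q Hq; have [Iq _] := avg_pairing b 1 1 Hs Hq.
  have := intgB Iq (sqintgM Hau Hq); apply: eq_intg => z; ring.
- by apply: measurable_funB; [apply: measurable_avg; exact: Hs.1|exact: Hau.1].
move=> q Hq q0; have [Iq Eq] := avg_pairing1 b 1 Hs Hq.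
pose B := \int[leb]_s (wt 1 s * \int[mu]_z (q z * `|g (sh b s z)|)).
have IB h := intg_shift_pairing1 b h Hag Hq.
have Iu h := intg_shift_pairing1 b h Hau Hq.
have step h : 0 <= h <= 1 ->
    \int[mu]_z (`|u z| * q z) <= \int[mu]_z (q z * `|u (sh b h z)|) + B.
  move=> /andP[h0 h1]; pose w z := u (sh b h z) - u z.
  have Hw : sqintg mu w by apply: sqintgB => //; exact: sqintg_sh.
  (* [q] times the sign of [w] (taken as 1 where [w] vanishes), so that pairing it with [w] yields
     the absolute value. *)
  pose q' z := q z * (1 - 2 * \1_[set z | w z < 0] z).
  have mS : measurable ([set z | w z < 0] : set (mR * mR)).
    rewrite -[X in measurable X]setTI.
    rewrite (_ : _ `&` _ = [set: mR * mR] `&` w @^-1` `]-oo, 0[%classic).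
      exact: (Hw.1 measurableT _ (measurable_itv _)).
    by apply/seteqP; split => z [_ ?]; split => //; rewrite /= in_itv in *.
  have wq z : w z * q' z = `|w z| * q z.
    rewrite /q' indicE; case: (boolP (z \in _)) => [/set_mem/= wz|].
      by rewrite ltr0_norm// ; ring.
    move=> /negP wz; rewrite mulr0 subr0 mulr1 ger0_norm// leNgt; apply/negP => w0.
    by apply: wz; apply/mem_set.
  have q'q z : `|q' z| = q z.
    rewrite /q' normrM ger0_norm// indicE; case: (z \in _).
      by rewrite mulr1 (_ : 1 - 2 = -1 :> R) ?normrN1 ?mulr1//; ring.
    by rewrite mulr0 subr0 normr1 mulr1.
  have Hq' : sqintg mu q'.
    have mq' : measurable_fun setT (q' : mR * mR -> R).
      apply: measurable_funM; first exact: Hq.1.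
      apply: measurable_funB => //; apply: measurable_funM => //.
    have q'le z : `|q' z| <= `|q z| by rewrite q'q ler_norm.
    exact: (sqintg_le mq' q'le Hq).
  have Iuh : intg mu (fun z => q z * `|u (sh b h z)|).
    by apply: sqintgM => //; apply: (@sqintg_sh _ b h (fun z => `|u z|)).
  have IwB : intg mu (fun z => `|w z| * q z) by apply: sqintgM => //; exact: sqintg_norm.
  apply: (@le_trans _ _ (\int[mu]_z (q z * `|u (sh b h z)|) + \int[mu]_z (`|w z| * q z))).
    rewrite -RintD//; apply: le_Rint; [exact: sqintgM|exact: intgD|] => z.
    rewrite [q z * _]mulrC -mulrDl ler_wpM2r//.
    by have := ler_normB (u (sh b h z)) (w z); rewrite /w opprB addrC subrK.
  rewrite lerD2l.
  have -> : \int[mu]_z (`|w z| * q z) = \int[mu]_z (w z * q' z).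
    by apply: eq_Rint => z; rewrite wq.
  rewrite (wd_pairing h0 Hug Hq'); apply: le_Rint; [exact: intg_shift_pairing1|exact: IB|] => s.
  have le1 : \int[mu]_z (q' z * g (sh b s z)) <= \int[mu]_z (q z * `|g (sh b s z)|).
    apply: le_Rint.
    - by apply: sqintgM => //; exact: sqintg_sh.
    - by apply: sqintgM => //; apply: (@sqintg_sh _ b s (fun z => `|g z|)).
    - by move=> z; apply: le_trans (ler_norm _) _; rewrite normrM q'q.
  have ge1 : 0 <= \int[mu]_z (q z * `|g (sh b s z)|).
    by apply: Rint_ge0 => z; rewrite mulr_ge0.
  apply: le_trans (ler_wpM2l (wt_ge0 h s) le1) _.
  rewrite ler_wpM2r// /wt !indicE ler_nat; case: (boolP (s \in `[0, h]%classic)) => // /set_mem.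
  rewrite /= in_itv/= => /andP[s0 s_h]; rewrite mem_set//= in_itv/= s0/=.
  exact: le_trans s_h h1.
rewrite [leRHS](_ : _ = \int[mu]_z (q z * avg b 1 1 (fun z => `|u z| + `|g z|) z - `|u z| * q z)); last first.
  by apply: eq_Rint => z; ring.
rewrite RintB//; last exact: sqintgM.
rewrite subr_ge0 Eq.
have -> : \int[leb]_s (wt 1 s * \int[mu]_z (q z * (`|u (sh b s z)| + `|g (sh b s z)|))) =
   \int[leb]_s (wt 1 s * \int[mu]_z (q z * `|u (sh b s z)|)) + B.
  rewrite -RintD//.
  apply: eq_Rint => s; rewrite -mulrDr; congr (_ * _); rewrite -RintD.
  - by apply: eq_Rint => z; rewrite mulrDr.
  - by apply: sqintgM => //; apply: (@sqintg_sh _ b s (fun z => `|u z|)).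
  - by apply: sqintgM => //; apply: (@sqintg_sh _ b s (fun z => `|g z|)).
rewrite -lerBlDr.
(* Here [step] is integrated over h in [0, 1], an interval of length 1, so the constant side is
   unchanged. *)
set c := _ - _; rewrite -[c]mulr1 -[X in c * X](Rint_wt ler01) -RintZ; last exact: intg_wt.
apply: le_Rint; [by apply: intgZ; exact: intg_wt|exact: Iu|] => s.
rewrite mulrC /wt indicE; case: (boolP (s \in _)) => [/set_mem|_]; last by rewrite !mul0r.
by rewrite /= in_itv/= => /step h; rewrite !mul1r /c lerBlDr.
Qed.

(** The indicator of a null set, translated by s, integrates to 0 over the product of plane and
    line; by Tonelli almost every slice of it is null. *)
Lemma ae_slice b (S : set (R * R)) : {ae mu, forall z, S z} ->
  {ae mu, forall z, {ae leb, forall s, S (sh b s z)}}.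
Proof.
move=> [N [mN N0 SN]].
pose k (w : (mR * mR) * mR) : \bar R := (\1_N (sh b (1 * w.2) w.1))%:E.
have mk : measurable_fun setT k.
  apply/measurable_EFinP; apply: (measurableT_comp _ (measurable_sh2 b 1)).
  exact: measurable_indic.
have k0 w : (0 <= k w)%E by rewrite lee_fin indicE.
have E := @fubini_tonelli _ _ _ _ _ (mu2 R) leb k mk k0.
have G0 : (\int[leb]_s \int[(mu2 R)]_z k (z, s) = 0)%E.
  apply: integral0_eq => s _; rewrite /k /=.
  transitivity (\int[mu]_z (\1_N z)%:E)%E.
    rewrite -(ge0_int_sh b (1 * s) (f := fun z => (\1_N z)%:E))//.
    by apply/measurable_EFinP; exact: measurable_indic.
  by rewrite integral_indic// setIT.
have mF : measurable_fun setT (fubini_F leb k).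
  exact: (@measurable_fun_fubini_tonelli_F _ _ _ _ _ leb k).
have : ae_eq (mu2 R) setT (fubini_F leb k) (cst 0%E).
  apply/ae_eq_integral_abs => //.
  rewrite -[RHS]G0 -E; apply: eq_integral => z _.
  by rewrite gee0_abs//; apply: integral_ge0.
apply: ae_mono => z /(_ I); rewrite /fubini_F /= => F0.
have mks : measurable_fun setT (fun s => k (z, s)).
  by apply: (measurableT_comp mk); exact: pair1_measurable.
have : ae_eq leb setT (fun s => k (z, s)) (cst 0%E).
  apply/ae_eq_integral_abs => //; rewrite -[RHS]F0; apply: eq_integral => s _.
  by rewrite gee0_abs.
apply: ae_mono => s /(_ I); rewrite /k /= indicE => -[] /eqP; rewrite pnatr_eq0 eqb0 => /negP.
rewrite mul1r => nN; apply: contrapT => /SN Nz; apply: nN; exact: mem_set.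
Qed.

(** Only an inequality, because the real-valued average is 0 when the integral is infinite. *)
Lemma avg_le_integral b h f z : (forall z, 0 <= f z) ->
  ((avg b 1 h f z)%:E <= \int[leb]_s (wt h s * f (sh b s z))%:E)%E.
Proof.
move=> f0; rewrite /avg /Rintegral.
under eq_integral do rewrite mul1r.
have : (0 <= \int[leb]_s (wt h s * f (sh b s z))%:E)%E.
  by apply: integral_ge0 => s _; rewrite lee_fin mulr_ge0// wt_ge0.
by case: (\int[leb]_s _)%E => //= _; rewrite leey.
Qed.

Lemma sqintg_square : sqintg mu (fun z => wt 1 z.1 * wt 1 z.2).
Proof.
apply: (@sqintg_box _ 1).
  by apply: measurable_funM; apply: measurableT_comp => //; exact: measurable_wt.
exists 1 => [z|z Kz].
  rewrite ger0_norm ?mulr_ge0 ?wt_ge0//.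
  by rewrite /wt !indicE -natrM lern1; case: (_ \in _); case: (_ \in _).
rewrite /wt !indicE -natrM mulnb; apply/eqP; rewrite pnatr_eq0 eqb0; apply/negP.
move=> /andP[/set_mem/= h1 /set_mem/= h2]; apply: Kz; rewrite /box/=.
move: h1 h2; rewrite !in_itv/= => /andP[? ?] /andP[? ?].
by rewrite !ger0_norm.
Qed.

(** [wd_abs_avg] in both directions bounds [|u|] by the integral of
    [|u| + |d1 u| + |d2 u| + |d12 u|] over a unit square. *)
Lemma wd_bounded u g1 g2 g12 : wd true u g1 -> wd false u g2 -> wd false g1 g12 ->
  exists M, essbnd mu M u.
Proof.
move=> H1 H2 H12; have [Hu Hg1 _] := H1; have [_ Hg2 _] := H2; have [_ Hg12 _] := H12.
pose F z := (`|u z| + `|g2 z|) + (`|g1 z| + `|g12 z|).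
have HF : sqintg mu F.
  by apply: sqintgD; apply: sqintgD; exact: sqintg_norm.
exists (nrm mu (fun z => wt 1 z.1 * wt 1 z.2) * nrm mu F).
have F0 z : 0 <= F z by rewrite !addr_ge0.
(* Kept in the extended reals: the vertical slices of [F] are not known to be integrable at every
   z. *)
pose H z := (\int[leb]_t (wt 1 t * F (sh false t z))%:E)%E.
have mwF (c : bool) (f : R * R -> R) z : measurable_fun setT (f : mR * mR -> R) ->
    measurable_fun setT (fun t : mR => (wt 1 t * f (sh c t z))%:E).
  move=> mf; apply/measurable_EFinP; apply: measurable_funM; first exact: measurable_wt.
  apply: (measurableT_comp mf).
  have := measurableT_comp (@measurable_sh2 R c 1) (@pair1_measurable _ _ (mR * mR)%type mR z).
  by rewrite /=; under eq_fun do rewrite mul1r.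
have fH : {ae mu, forall z, ((`|u z| + `|g1 z|)%:E <= H z)%E}.
  move: (wd_abs_avg H2) (wd_abs_avg H12); apply: ae_mono2 => z h1 h2.
  have f1 w : 0 <= `|u w| + `|g2 w| by rewrite addr_ge0.
  have f2 w : 0 <= `|g1 w| + `|g12 w| by rewrite addr_ge0.
  rewrite EFinD; apply: (@le_trans _ _
    (\int[leb]_t (wt 1 t * (`|u (sh false t z)| + `|g2 (sh false t z)|))%:E +
     \int[leb]_t (wt 1 t * (`|g1 (sh false t z)| + `|g12 (sh false t z)|))%:E)%E).
    apply: leeD.
      by apply: le_trans (avg_le_integral false 1 z f1); rewrite lee_fin.
    by apply: le_trans (avg_le_integral false 1 z f2); rewrite lee_fin.
  rewrite -ge0_integralD//.
  - by rewrite le_eqVlt; apply/orP; left; apply/eqP; apply: eq_integral => t _;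
      rewrite -EFinD -mulrDr.
  - by move=> t _; rewrite lee_fin mulr_ge0// wt_ge0.
  - by apply: (mwF false (fun z => `|u z| + `|g2 z|)); apply: (sqintgD (sqintg_norm Hu) (sqintg_norm Hg2)).1.
  - by move=> t _; rewrite lee_fin mulr_ge0// wt_ge0.
  - by apply: (mwF false (fun z => `|g1 z| + `|g12 z|)); apply: (sqintgD (sqintg_norm Hg1) (sqintg_norm Hg12)).1.
have mH : measurable_fun setT (H : mR * mR -> \bar R).
  have mk : measurable_fun setT (fun w : (mR * mR) * mR => (wt 1 w.2 * F (sh false (1 * w.2) w.1))%:E).
    by apply/measurable_EFinP; apply: measurable_shift_kernel; exact: HF.1.
  have mF : measurable_fun setT (fubini_F leb (fun w : (mR * mR) * mR => (wt 1 w.2 * F (sh false (1 * w.2) w.1))%:E)).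
    apply: (@measurable_fun_fubini_tonelli_F _ _ _ _ _ leb) => // w.
    by rewrite lee_fin mulr_ge0// wt_ge0.
  apply: eq_measurable_fun mF => w _; rewrite /fubini_F /H.
  by apply: eq_integral => t _; rewrite /= mul1r.
move: (wd_abs_avg H1) (ae_slice true fH); apply: ae_mono2 => z h1 h2.
rewrite -lee_fin; apply: (@le_trans _ _ (\int[leb]_s (wt 1 s * (`|u (sh true s z)| + `|g1 (sh true s z)|))%:E)%E).
  apply: le_trans (avg_le_integral true 1 z (f := fun z => `|u z| + `|g1 z|) _).
    by rewrite lee_fin.
  by move=> w; rewrite addr_ge0.
have mHs : measurable_fun setT (fun s : mR => H (sh true s z)).
  apply: (measurableT_comp mH).
  have := measurableT_comp (@measurable_sh2 R true 1) (@pair1_measurable _ _ (mR * mR)%type mR z).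
  by rewrite /=; under eq_fun do rewrite mul1r.
apply: (@le_trans _ _ (\int[leb]_s ((wt 1 s)%:E * H (sh true s z)))%E).
  apply: ae_ge0_le_integral => //.
  - by move=> s _; rewrite lee_fin mulr_ge0 ?wt_ge0// addr_ge0.
  - by apply: (mwF true (fun z => `|u z| + `|g1 z|)); apply: (sqintgD (sqintg_norm Hu) (sqintg_norm Hg1)).1.
  - move=> s _; rewrite mule_ge0 ?lee_fin ?wt_ge0//.
    by apply: integral_ge0 => t _; rewrite lee_fin mulr_ge0// wt_ge0.
  - by apply: emeasurable_funM => //; apply/measurable_EFinP; exact: measurable_wt.
  - by move: h2; apply: ae_mono => s hs _; rewrite EFinM lee_wpmul2l// lee_fin wt_ge0.
(* The two nested segment integrals become one integral over the unit square with lower left corner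
   z. *)
pose K (w : mR * mR) := wt 1 w.1 * wt 1 w.2 * F (sh false z.2 (sh true z.1 w)).
have HFz : sqintg mu (fun w => F (sh false z.2 (sh true z.1 w))).
  by apply: (@sqintg_sh _ true z.1 (fun w => F (sh false z.2 w))); exact: sqintg_sh.
have IK : intg mu K by apply: sqintgM => //; exact: sqintg_square.
have K0 w : (0 <= (K w)%:E)%E by rewrite lee_fin !mulr_ge0// wt_ge0.
apply: (@le_trans _ _ (\int[mu]_w (K w)%:E)%E).
  have -> : (\int[mu]_w (K w)%:E = \int[leb]_s \int[leb]_t (K (s, t))%:E)%E.
    apply: (@fubini_tonelli1 _ _ _ _ _ leb leb (EFin \o K)) => //.
    by have /integrableP[] := IK.
  rewrite le_eqVlt; apply/orP; left; apply/eqP; apply: eq_integral => s _.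
  rewrite -ge0_integralZl//.
  - apply: eq_integral => t _; rewrite -EFinM mulrA; congr (_ * F _)%:E.
    by rewrite /sh /= addrC [z.2 + t]addrC.
  - by apply: mwF; exact: HF.1.
  - by move=> t _; rewrite lee_fin mulr_ge0// wt_ge0.
  - by rewrite lee_fin wt_ge0.
(* Against the indicator of the unit square, Cauchy-Schwarz gives a bound that does not depend on z,
   the norm of [F] being translation invariant. *)
have := cauchy_schwarz sqintg_square HFz.
rewrite (nrm_sh true z.1 (u := fun w => F (sh false z.2 w))); last exact: sqintg_sh.
rewrite nrm_sh// => /(le_trans (ler_norm _)).
rewrite -lee_fin => h3; apply: le_trans h3.
by rewrite /Rintegral fineK//; exact: (integrable_fin_num measurableT IK).
Qed.

End weak_derivatives.

(** * Product rule, chain rule and integration by parts through translates *)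

Section regular_functions.
Variable R : realType.
Notation mR := (measurableTypeR R).
Notation mu := (leb2 R).
Implicit Types (f g u v q r : R * R -> R) (z : R * R) (b : bool) (h : R).

Definition delta b h u z := u (sh b h z) - u z.

(** The functions with bounded representative and O(h) translates in L^2 form an
    algebra, and the first-order expansion of translates tested against that
    algebra satisfies the product and chain rules and integrates by parts: this
    dispenses with mollification. *)
Definition regular u := [/\ sqintg mu u, exists2 M, 0 <= M & essbnd mu M u &
  exists2 C, 0 <= C &
    forall b h, 0 <= h <= 1 -> nrm mu (delta b h u) <= C * h].

Definition has_d b u g := [/\ regular u, sqintg mu g &
  forall q, regular q -> exists C, forall h, 0 <= h <= 1 ->
    `|\int[mu]_z (delta b h u z * q z) - h * \int[mu]_z (g z * q z)| <= C * h ^+ 2].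

Lemma sqintg_le_ae u v : measurable_fun setT (u : mR * mR -> R) -> sqintg mu v ->
  {ae mu, forall z, `|u z| <= `|v z|} -> sqintg mu u.
Proof.
move=> mu_ Hv uv; have mv := (sqintg_norm Hv).1.
pose w z : R := Num.max (- `|v z|) (Num.min (u z) `|v z|).
have mw : measurable_fun setT (w : mR * mR -> R).
  by apply: measurable_maxr; [exact: measurableT_comp|exact: measurable_minr].
have wu : ae_eq mu setT w u.
  move: uv; apply: ae_mono => z; rewrite ler_norml => /andP[h1 h2] _.
  by rewrite /w min_l// max_r.
have wv z : `|w z| <= `|v z|.
  rewrite /w ler_norml; have v0 := normr_ge0 (v z).
  by rewrite le_max lexx/= ge_max ge_min lexx orbT andbT; lra.
exact: ae_sqintg mu_ wu (sqintg_le mw wv Hv).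
Qed.

Lemma sqintg_delta b h u : sqintg mu u -> sqintg mu (delta b h u).
Proof. by move=> Hu; apply: sqintgB => //; exact: sqintg_sh. Qed.

Lemma essbnd_sh b h M u : essbnd mu M u -> essbnd mu M (fun z => u (sh b h z)).
Proof. exact: (@ae_sh _ b h [set z | `|u z| <= M]). Qed.

Lemma regular_sqintg u : regular u -> sqintg mu u. Proof. by case. Qed.

Lemma regularD u v : regular u -> regular v -> regular (fun z => u z + v z).
Proof.
move=> [Hu [M M0 uM] [C C0 uC]] [Hv [N N0 vN] [D D0 vD]]; split.
- exact: sqintgD.
- exists (M + N); first exact: addr_ge0.
  move: uM vN; apply: ae_mono2 => z h1 h2.
  by apply: le_trans (ler_normD _ _) _; exact: lerD.
- exists (C + D) => [|b h h01]; first exact: addr_ge0.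
  rewrite (_ : delta _ _ _ = fun z => delta b h u z + delta b h v z); last first.
    by apply/funext => z; rewrite /delta; ring.
  apply: le_trans (nrmD _ _) _; [exact: sqintg_delta..|].
  by rewrite mulrDl lerD ?uC ?vD.
Qed.

Lemma regularZ k u : regular u -> regular (fun z => k * u z).
Proof.
move=> [Hu [M M0 uM] [C C0 uC]]; split.
- exact: sqintgZ.
- exists (`|k| * M); first exact: mulr_ge0.
  by move: uM; apply: ae_mono => z h1; rewrite normrM ler_wpM2l.
- exists (`|k| * C) => [|b h h01]; first exact: mulr_ge0.
  rewrite (_ : delta _ _ _ = fun z => k * delta b h u z); last first.
    by apply/funext => z; rewrite /delta; ring.
  by rewrite (nrmZ k (sqintg_delta b h Hu)) -mulrA ler_wpM2l// uC.
Qed.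

Lemma regularM u v : regular u -> regular v -> regular (fun z => u z * v z).
Proof.
move=> [Hu [M M0 uM] [C C0 uC]] [Hv [N N0 vN] [D D0 vD]]; split.
- exact: sqintg_bndM Hu.1 uM Hv.
- exists (M * N); first exact: mulr_ge0.
  by move: uM vN; apply: ae_mono2 => z h1 h2; rewrite normrM ler_pM.
- exists (M * D + N * C) => [|b h h01]; first by rewrite addr_ge0 ?mulr_ge0.
  rewrite (_ : delta _ _ _ = fun z => u (sh b h z) * delta b h v z + v z * delta b h u z); last first.
    by apply/funext => z; rewrite /delta; ring.
  have uMs := essbnd_sh b h uM; have mus := (sqintg_sh b h Hu).1.
  apply: le_trans (nrmD _ _) _.
  + by apply: (sqintg_bndM mus uMs); exact: sqintg_delta.
  + by apply: (sqintg_bndM Hv.1 vN); exact: sqintg_delta.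
  rewrite mulrDl -!mulrA lerD//.
    apply: le_trans (nrm_bndM M0 mus uMs (sqintg_delta b h Hv)) _.
    by rewrite ler_wpM2l// vD.
  apply: le_trans (nrm_bndM N0 Hv.1 vN (sqintg_delta b h Hu)) _.
  by rewrite ler_wpM2l// uC.
Qed.

Lemma regular_comp (F : R -> R) u : continuous F -> F 0 = 0 ->
  (forall M, 0 <= M -> exists2 K, 0 <= K & forall x y, `|x| <= M -> `|y| <= M ->
    `|F y - F x| <= K * `|y - x|) ->
  regular u -> regular (fun z => F (u z)).
Proof.
move=> cF F0 FL [Hu [M M0 uM] [C C0 uC]]; have [K K0 FK] := FL M M0.
have mF : measurable_fun setT (fun z : mR * mR => F (u z)).
  by apply: measurableT_comp; [exact: continuous_measurable_fun|exact: Hu.1].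
have FuK : {ae mu, forall z, `|F (u z)| <= K * `|u z|}.
  move: uM; apply: ae_mono => z h1; have := FK 0 (u z); rewrite F0 !subr0; apply => //.
  by rewrite normr0.
have HFu : sqintg mu (fun z => F (u z)).
  apply: (sqintg_le_ae mF (sqintgZ K (sqintg_norm Hu))).
  by move: FuK; apply: ae_mono => z h1; rewrite normrM normr_id (ger0_norm K0).
split => //.
- exists (K * M); first exact: mulr_ge0.
  move: FuK uM; apply: ae_mono2 => z h1 h2; apply: le_trans h1 _.
  by rewrite ler_wpM2l.
- exists (K * C) => [|b h h01]; first exact: mulr_ge0.
  apply: (@le_trans _ _ (nrm mu (fun z => K * delta b h u z))).
    apply: nrm_le_ae; [exact: sqintg_delta|by apply: sqintgZ; exact: sqintg_delta|].
    move: uM (essbnd_sh b h uM); apply: ae_mono2 => z h1 h2.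
    by rewrite normrM (ger0_norm K0) /delta FK.
  by rewrite (nrmZ K (sqintg_delta b h Hu)) (ger0_norm K0) -mulrA ler_wpM2l// uC.
Qed.

Lemma has_d_sqintg b u g : has_d b u g -> sqintg mu g. Proof. by case. Qed.
Lemma has_d_regular b u g : has_d b u g -> regular u. Proof. by case. Qed.

Lemma eq_has_d b u v g k : u =1 v -> g =1 k -> has_d b u g -> has_d b v k.
Proof. by move=> /funext-> /funext->. Qed.

Lemma has_dD b u v g k : has_d b u g -> has_d b v k ->
  has_d b (fun z => u z + v z) (fun z => g z + k z).
Proof.
move=> [Hu Hg ug] [Hv Hk vk]; split; [exact: regularD|exact: sqintgD|].
move=> q Hq; have [C uC] := ug q Hq; have [D vD] := vk q Hq.
have Sq := regular_sqintg Hq.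
have Su b' h := sqintg_delta b' h (regular_sqintg Hu).
have Sv b' h := sqintg_delta b' h (regular_sqintg Hv).
exists (C + D) => h h01.
have -> : \int[mu]_z (delta b h (fun z => u z + v z) z * q z) =
    \int[mu]_z (delta b h u z * q z) + \int[mu]_z (delta b h v z * q z).
  rewrite -RintD; [|exact: sqintgM..]; apply: eq_Rint => z; rewrite /delta; ring.
have -> : \int[mu]_z ((g z + k z) * q z) = \int[mu]_z (g z * q z) + \int[mu]_z (k z * q z).
  rewrite -RintD; [|exact: sqintgM..]; apply: eq_Rint => z; ring.
have := uC h h01; have := vD h h01; rewrite mulrDl.
set a := _ - _; set a' := _ - _; set a'' := _ - _ => h1 h2.
have -> : a'' = a' + a by rewrite /a /a' /a''; ring.
by apply: le_trans (ler_normD _ _) _; exact: lerD.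
Qed.

Lemma has_dZ b c u g : has_d b u g -> has_d b (fun z => c * u z) (fun z => c * g z).
Proof.
move=> [Hu Hg ug]; split; [exact: regularZ|exact: sqintgZ|].
move=> q Hq; have [C uC] := ug q Hq; have Sq := regular_sqintg Hq.
have Su b' h := sqintg_delta b' h (regular_sqintg Hu).
exists (`|c| * C) => h h01.
have -> : \int[mu]_z (delta b h (fun z => c * u z) z * q z) =
    c * \int[mu]_z (delta b h u z * q z).
  rewrite -RintZ; [|exact: sqintgM..]; apply: eq_Rint => z; rewrite /delta; ring.
have -> : \int[mu]_z (c * g z * q z) = c * \int[mu]_z (g z * q z).
  rewrite -RintZ; [|exact: sqintgM..]; apply: eq_Rint => z; ring.
by rewrite mulrCA -mulrBr normrM -mulrA ler_wpM2l// uC.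
Qed.

Lemma has_dN b u g : has_d b u g -> has_d b (fun z => - u z) (fun z => - g z).
Proof. by move=> /(has_dZ (-1)); apply: eq_has_d => z; rewrite mulN1r. Qed.

Lemma has_dB b u v g k : has_d b u g -> has_d b v k ->
  has_d b (fun z => u z - v z) (fun z => g z - k z).
Proof. by move=> Hu /has_dN; exact: has_dD. Qed.

(** The common source of the O(h^2) errors in the product and chain rules: two increments of size
    O(h) in L^2, times a bounded factor. *)
Lemma delta_delta_bound b u v q : regular u -> regular v -> regular q ->
  exists2 C, 0 <= C & forall h, 0 <= h <= 1 ->
    \int[mu]_z `|delta b h u z * delta b h v z * q z| <= C * h ^+ 2.
Proof.
move=> [Hu _ [C C0 uC]] [Hv _ [D D0 vD]] [Hq [Q Q0 qQ] _].
exists (Q * (C * D)) => [|h h01]; first by rewrite !mulr_ge0.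
have Su := sqintg_delta b h Hu; have Sv := sqintg_delta b h Hv.
have Sqv := sqintg_bndM Hq.1 qQ Sv.
have -> : \int[mu]_z `|delta b h u z * delta b h v z * q z| =
    \int[mu]_z (`|delta b h u z| * `|q z * delta b h v z|).
  by apply: eq_Rint => z; rewrite -normrM; congr `|_|; ring.
apply: le_trans (Rint_normM Su Sqv) _.
have n1 := uC b h h01; have n2 := nrm_bndM Q0 Hq.1 qQ Sv; have n3 := vD b h h01.
have h0 : 0 <= h by case/andP: h01.
apply: (@le_trans _ _ ((C * h) * (Q * (D * h)))); last by rewrite le_eqVlt; apply/orP; left; apply/eqP; ring.
apply: ler_pM => //; try exact: nrm_ge0.
by apply: le_trans n2 _; rewrite ler_wpM2l.
Qed.

Lemma intg3 u v q : sqintg mu u -> sqintg mu v -> regular q ->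
  intg mu (fun z => u z * v z * q z).
Proof.
move=> Hu Hv [Hq [Q Q0 qQ] _]; have := sqintgM Hu (sqintg_bndM Hq.1 qQ Hv).
by apply: eq_intg => z; ring.
Qed.

Lemma delta_delta_Rint b u v q : regular u -> regular v -> regular q ->
  exists2 C, 0 <= C & forall h, 0 <= h <= 1 ->
    `|\int[mu]_z (delta b h u z * delta b h v z * q z)| <= C * h ^+ 2.
Proof.
move=> Hu Hv Hq; have [C C0 uC] := delta_delta_bound b Hu Hv Hq.
exists C => // h h01; apply: le_trans (norm_Rint _) (uC h h01).
apply: intg3 => //; apply: sqintg_delta; exact: regular_sqintg.
Qed.

(** The increment of u v is v du + u dv + du dv. The first two terms are tested against v q and u q,
    which are again regular, and the last one is O(h^2). *)
Lemma has_dM b u v g k : has_d b u g -> has_d b v k ->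
  has_d b (fun z => u z * v z) (fun z => g z * v z + u z * k z).
Proof.
move=> [Hu Hg ug] [Hv Hk vk].
have [Su [M M0 uM] _] := Hu; have [Sv [N N0 vN] _] := Hv.
have Sgv : sqintg mu (fun z => g z * v z).
  by have := sqintg_bndM Sv.1 vN Hg; under eq_fun do rewrite mulrC.
have Suk := sqintg_bndM Su.1 uM Hk.
split; [exact: regularM|exact: sqintgD|] => q Hq.
have Sq := regular_sqintg Hq.
have [C1 H1] := ug _ (regularM Hv Hq); have [C2 H2] := vk _ (regularM Hu Hq).
have [C3 _ H3] := delta_delta_Rint b Hu Hv Hq.
exists (C1 + C2 + C3) => h h01.
have Du := sqintg_delta b h Su; have Dv := sqintg_delta b h Sv.
have I1 : intg mu (fun z => delta b h u z * (v z * q z)).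
  by apply: sqintgM => //; exact: regular_sqintg (regularM Hv Hq).
have I2 : intg mu (fun z => delta b h v z * (u z * q z)).
  by apply: sqintgM => //; exact: regular_sqintg (regularM Hu Hq).
have I3 := intg3 Du Dv Hq.
have -> : \int[mu]_z (delta b h (fun z => u z * v z) z * q z) =
    \int[mu]_z (delta b h u z * (v z * q z)) + \int[mu]_z (delta b h v z * (u z * q z)) +
    \int[mu]_z (delta b h u z * delta b h v z * q z).
  rewrite -RintD// -RintD//; last exact: intgD.
  by apply: eq_Rint => z; rewrite /delta; ring.
have -> : \int[mu]_z ((g z * v z + u z * k z) * q z) =
    \int[mu]_z (g z * (v z * q z)) + \int[mu]_z (k z * (u z * q z)).
  rewrite -RintD.
  - by apply: eq_Rint => z; ring.
  - by apply: sqintgM => //; exact: regular_sqintg (regularM Hv Hq).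
  - by apply: sqintgM => //; exact: regular_sqintg (regularM Hu Hq).
have := H1 h h01; have := H2 h h01; have := H3 h h01; rewrite !mulrDl.
set t := \int[mu]_z (delta b h u z * delta b h v z * q z).
set a := _ - _; set a' := _ - _; set a'' := _ - _ => h1 h2 h3.
have -> : a'' = a' + a + t by rewrite /a /a' /a'' /t; ring.
apply: le_trans (ler_normD _ _) _; apply: lerD => //.
by apply: le_trans (ler_normD _ _) _; exact: lerD.
Qed.

(** The increment of u q has integral 0 by translation invariance. Expanding it to first order shows
    that h times the sum of both pairings is O(h^2), so that sum is 0. *)
Lemma has_d_ibp b u g q r : has_d b u g -> has_d b q r ->
  \int[mu]_z (g z * q z) = - \int[mu]_z (u z * r z).
Proof.
move=> Hug Hqr; have [Hu Hg ug] := Hug; have [Hq Hr qr] := Hqr.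
have [C1 H1] := ug _ Hq; have [C2 H2] := qr _ Hu.
have Su := regular_sqintg Hu; have Sq := regular_sqintg Hq.
have [Hu' _ [Cu Cu0 uC]] := Hu; have [Hq' _ [Cq Cq0 qC]] := Hq.
set A := \int[mu]_z (g z * q z); set B := \int[mu]_z _.
have key h : 0 <= h <= 1 -> `|h * (A + B)| <= (C1 + C2 + Cu * Cq) * h ^+ 2.
  move=> h01.
  have Du := sqintg_delta b h Su; have Dq := sqintg_delta b h Sq.
  have Iuq := sqintgM Su Sq.
  have I1 := sqintgM Du Sq; have I2 := sqintgM Dq Su; have I3 := sqintgM Du Dq.
  have E0 : \int[mu]_z (delta b h u z * q z) + \int[mu]_z (delta b h q z * u z) +
      \int[mu]_z (delta b h u z * delta b h q z) = 0.
    rewrite -RintD// -RintD//; last exact: intgD.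
    transitivity (\int[mu]_z (u (sh b h z) * q (sh b h z) - u z * q z)).
      by apply: eq_Rint => z; rewrite /delta; ring.
    rewrite RintB//; last exact: (@intg_sh _ b h (fun z => u z * q z)).
    by rewrite (Rint_sh b h (f := fun z => u z * q z))// subrr.
  have := H1 h h01; have := H2 h h01; have := cauchy_schwarz Du Dq.
  have -> : \int[mu]_z (r z * u z) = B by apply: eq_Rint => z; rewrite mulrC.
  rewrite -/A !mulrDl.
  set t := \int[mu]_z _ => h3; set a := _ - _; set a' := _ - _ => h1 h2.
  have -> : h * (A + B) = - (a' + a + t).
    by move: E0; rewrite /a /a' /t; lra.
  rewrite normrN; apply: le_trans (ler_normD _ _) _; apply: lerD.
    by apply: le_trans (ler_normD _ _) _; exact: lerD.
  apply: le_trans h3 _.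
  apply: (@le_trans _ _ ((Cu * h) * (Cq * h))); last by rewrite le_eqVlt; apply/orP; left; apply/eqP; ring.
  by apply: ler_pM; [exact: nrm_ge0|exact: nrm_ge0|exact: uC|exact: qC].
suff : A + B = 0 by move=> /eqP; rewrite addr_eq0 => /eqP.
set K := C1 + C2 + Cu * Cq in key.
apply/eqP; rewrite -normr_eq0 eq_le normr_ge0 andbT; apply/ler_addgt0Pr => e e0.
rewrite add0r; pose h := Num.min 1 (e / (`|K| + 1)).
have k1 : 0 < `|K| + 1 by have := normr_ge0 K; lra.
have h0 : 0 < h by rewrite lt_min ltr01/= divr_gt0.
have h1 : h <= 1 by rewrite ge_min lexx.
have := key h; rewrite (ltW h0) h1 => /(_ isT).
rewrite normrM (gtr0_norm h0) expr2 mulrCA ler_pM2l// => h2.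
apply: le_trans h2 _; apply: le_trans (ler_wpM2r (ltW h0) (ler_norm K)) _.
have : h <= e / (`|K| + 1) by rewrite ge_min lexx orbT.
rewrite ler_pdivlMr// => h3; apply: le_trans h3; rewrite mulrC ler_wpM2l ?ltW//; lra.
Qed.

(** The Taylor remainder of F is at most K (du)^2, hence O(h^2) after integration; regularity of u
    supplies the bound M on which K depends. Since F and F' vanish at 0, the compositions stay in
    L^2. *)
Lemma has_d_comp (F F' : R -> R) b u g : continuous F -> continuous F' ->
  F 0 = 0 -> F' 0 = 0 ->
  (forall M, 0 <= M -> exists2 K, 0 <= K & forall x y, `|x| <= M -> `|y| <= M ->
    `|F y - F x - F' x * (y - x)| <= K * (y - x) ^+ 2 /\
    `|F' y - F' x| <= K * `|y - x|) ->
  has_d b u g -> has_d b (fun z => F (u z)) (fun z => F' (u z) * g z).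
Proof.
move=> cF cF' F0 F'0 FL [Hu Hg ug].
have HF' : regular (fun z => F' (u z)).
  apply: regular_comp => // M M0; have [K K0 FK] := FL M M0.
  by exists K => // x y Mx My; have [] := FK x y Mx My.
have HF : regular (fun z => F (u z)).
  apply: regular_comp => // M M0; have [K K0 FK] := FL M M0.
  (* On [-M, M], F' is at most K M as it vanishes at 0, and the quadratic remainder contributes 2 K
     M because increments are at most 2 M. *)
  exists (3 * (K * M)) => [|x y Mx My]; first by rewrite !mulr_ge0.
  have [h1 _] := FK x y Mx My.
  have := FK 0 x; rewrite normr0 => /(_ M0 Mx)[_]; rewrite F'0 !subr0 => h2.
  have -> : F y - F x = (F y - F x - F' x * (y - x)) + F' x * (y - x) by ring.
  apply: le_trans (ler_normD _ _) _.
  have h3 : `|F' x * (y - x)| <= (K * M) * `|y - x|.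
    rewrite normrM ler_wpM2r//; apply: le_trans h2 _; by rewrite ler_wpM2l.
  have h4 : K * (y - x) ^+ 2 <= 2 * (K * M) * `|y - x|.
    have -> : 2 * (K * M) * `|y - x| = K * ((2 * M) * `|y - x|) by ring.
    rewrite ler_wpM2l// -real_normK ?num_real// expr2 ler_wpM2r//.
    by apply: le_trans (ler_normB _ _) _; lra.
  have := le_trans h1 h4; lra.
have [Su [M M0 uM] [C C0 uC]] := Hu.
have [SF' [M' M'0 uM'] _] := HF'.
split => //; first exact: sqintg_bndM SF'.1 uM' Hg.
move=> q Hq; have Sq := regular_sqintg Hq.
have [C1 H1] := ug _ (regularM HF' Hq).
have [K K0 FK] := FL M M0.
have [C2 C20 H2] := delta_delta_bound b Hu Hu Hq.
exists (C1 + K * C2) => h h01.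
have Du := sqintg_delta b h Su.
pose rem z := delta b h (fun z => F (u z)) z - F' (u z) * delta b h u z.
have I1 : intg mu (fun z => delta b h u z * (F' (u z) * q z)).
  by apply: sqintgM => //; exact: regular_sqintg (regularM HF' Hq).
have I2 : intg mu (fun z => rem z * q z).
  apply: sqintgM => //; apply: sqintgB; last exact: sqintg_bndM SF'.1 uM' Du.
  exact: sqintg_delta (regular_sqintg HF).
have -> : \int[mu]_z (delta b h (fun z => F (u z)) z * q z) =
    \int[mu]_z (delta b h u z * (F' (u z) * q z)) + \int[mu]_z (rem z * q z).
  by rewrite -RintD//; apply: eq_Rint => z; rewrite /rem; ring.
have -> : \int[mu]_z (F' (u z) * g z * q z) = \int[mu]_z (g z * (F' (u z) * q z)).
  by apply: eq_Rint => z; ring.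
have h3 : `|\int[mu]_z (rem z * q z)| <= K * C2 * h ^+ 2.
  apply: le_trans (norm_Rint I2) _; rewrite -mulrA.
  apply: le_trans (ler_wpM2l K0 (H2 h h01)).
  have I3 := intg_norm (intg3 Du Du Hq).
  rewrite -RintZ//; apply: ae_le_Rint; [exact: intg_norm|exact: intgZ|].
  move: uM (essbnd_sh b h uM); apply: ae_mono2 => z h4 h5.
  rewrite [leLHS]normrM (normrM (_ * _) (q z)) mulrA ler_wpM2r// -expr2.
  rewrite (ger0_norm (sqr_ge0 (delta b h u z))).
  by have [] := FK _ _ h4 h5.
have := H1 h h01; rewrite mulrDl.
set a := _ - _; set a'' := _ - _ => h1.
have -> : a'' = a + \int[mu]_z (rem z * q z) by rewrite /a /a''; ring.
by apply: le_trans (ler_normD _ _) _; exact: lerD.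
Qed.

Lemma wd_regular u g1 g2 g12 : wd true u g1 -> wd false u g2 -> wd false g1 g12 ->
  regular u.
Proof.
move=> H1 H2 H12; have [M uM] := wd_bounded H1 H2 H12; have [Hu Hg1 _] := H1.
split => //.
  exists `|M| => //; move: uM; apply: ae_mono => z h; apply: le_trans h _; exact: ler_norm.
exists (nrm mu g1 + nrm mu g2) => [|b h /andP[h0 h1]].
  by rewrite addr_ge0// nrm_ge0.
rewrite mulrC; case: b.
  by apply: le_trans (wd_lip h0 H1) _; rewrite ler_wpM2l// lerDl nrm_ge0.
by apply: le_trans (wd_lip h0 H2) _; rewrite ler_wpM2l// lerDr nrm_ge0.
Qed.

Lemma wd_has_d b u g : regular u -> wd b u g -> has_d b u g.
Proof.
move=> Hu Hug; have [_ Hg _] := Hug; split => // q [Hq _ [C C0 qC]].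
exists (nrm mu g * C) => h /andP[h0 h1].
apply: wd_difference => // s /andP[s0 sh1]; apply: qC.
by rewrite s0 (le_trans sh1).
Qed.

End regular_functions.

(** * Test functions in this calculus, symmetry of second derivatives, and uniqueness of weak
    derivatives *)

Section test_functions.
Variable R : realType.
Notation mR := (measurableTypeR R).
Notation mu := (leb2 R).
Implicit Types (f g u v q r phi : R * R -> R) (z : R * R) (b c : bool) (h : R).

Lemma mean_value_slice n b phi z h : 0 <= h -> C_ n.+1 phi ->
  exists2 x, 0 <= x <= h & phi (sh b h z) - phi z = h * dd b phi (sh b x z).
Proof.
move=> h0 Hphi.
have dF (s : R) : is_derive s (1 : R) (fun t => phi (sh b t z)) (dd b phi (sh b s z)).
  exact: is_derive_slice Hphi.
have cF : continuous (fun t => phi (sh b t z)).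
  by move=> s; apply/differentiable_continuous/derivable1_diffP; have [] := dF s.
have [x] := @MVT_segment _ _ _ 0 h h0 (fun s _ => dF s) (continuous_subspaceT cF).
rewrite in_itv/= => x0h; rewrite sh0 subr0 mulrC => E.
by exists x.
Qed.

Lemma second_difference n b c phi z h : 0 <= h -> C_ n.+2 phi ->
  exists x y, [/\ 0 <= x <= h, 0 <= y <= h &
    phi (sh c h (sh b h z)) - phi (sh b h z) - phi (sh c h z) + phi z =
      h ^+ 2 * dd c (dd b phi) (sh c y (sh b x z))].
Proof.
move=> h0 Hphi.
pose g z := phi (sh c h z) + -1 * phi z.
have C1 : C_ n.+1 phi by exact: C_W.
have dg w : dd b g w = dd b phi (sh c h w) - dd b phi w.
  apply: ddP.
  have := is_deriveD (is_derive_sh c b h w C1) (is_deriveZ (-1) (is_derive_dd b w C1)).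
  by rewrite scaleN1r.
have Cg : forall z s, is_derive s (1 : R) (fun t => g (sh b t z)) (dd b g (sh b s z)).
  move=> w s; rewrite dg.
  have d1 := is_derive_slice b (sh c h w) s C1; have d2 := is_derive_slice b w s C1.
  have := is_deriveD d1 (is_deriveZ (-1) d2); rewrite scaleN1r shC.
  rewrite (_ : (_ + _) = fun t => g (sh b t w))//.
  by apply/funext => t; rewrite /g shC.
have cF : continuous (fun t => g (sh b t z)).
  by move=> s; apply/differentiable_continuous/derivable1_diffP; have [] := Cg z s.
have [x] := @MVT_segment _ _ _ 0 h h0 (fun s _ => Cg z s) (continuous_subspaceT cF).
rewrite in_itv/= => x0h; rewrite sh0 subr0 dg.
have [y y0h ->] := mean_value_slice c (sh b x z) h0 (C_dd b Hphi).
move=> E; exists x, y; split => //.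
rewrite (_ : _ + phi z = g (sh b h z) - g z); last by rewrite /g; ring.
by rewrite E; ring.
Qed.

Lemma continuous_near (A : R * R -> R) z e : continuous A -> 0 < e ->
  exists2 d, 0 < d & forall b c x y, 0 <= x < d -> 0 <= y < d ->
    `|A (sh b x (sh c y z)) - A z| < e.
Proof.
move=> cA e0.
have /cvgrPdist_lt/(_ e e0) : A w @[w --> z] --> A z by exact: cA.
move=> /nbhs_ballP[d /= d0 dA]; exists (d / 2); first by rewrite divr_gt0.
move=> b c x y /andP[x0 xd] /andP[y0 yd]; rewrite distrC; apply: dA.
have bl (s w : R) : `|s - w| < d -> ball s d w by rewrite -ball_normE.
by case: b; case: c; split => /=; apply: bl; rewrite ltr_norml; lra.
Qed.

(** The second difference over a small square is symmetric in the two directions, and by the mean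
    value theorem it is h^2 times either mixed derivative at some nearby point. *)
Lemma schwarz n b c phi z : C_ n.+2 phi -> dd c (dd b phi) z = dd b (dd c phi) z.
Proof.
move=> Hphi; apply/eqP; rewrite -subr_eq0 -normr_eq0 eq_le normr_ge0 andbT.
apply/ler_addgt0Pr => e e0; rewrite add0r.
have c1 : continuous (dd c (dd b phi)) by exact: C_continuous (C_dd c (C_dd b Hphi)).
have c2 : continuous (dd b (dd c phi)) by exact: C_continuous (C_dd b (C_dd c Hphi)).
have e2 : 0 < e / 2 by rewrite divr_gt0.
have [d1 d10 H1] := continuous_near z c1 e2.
have [d2 d20 H2] := continuous_near z c2 e2.
pose h := Num.min d1 d2 / 2.
have h0 : 0 < h by rewrite divr_gt0// lt_min d10.
have m1 : Num.min d1 d2 <= d1 by rewrite ge_min lexx.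
have m2 : Num.min d1 d2 <= d2 by rewrite ge_min lexx orbT.
have [x [y [/andP[x0 xh] /andP[y0 yh] E1]]] := second_difference b c z (ltW h0) Hphi.
have [x' [y' [/andP[x0' xh'] /andP[y0' yh'] E2]]] := second_difference c b z (ltW h0) Hphi.
have h2 : h ^+ 2 != 0 by rewrite sqrf_eq0 gt_eqF.
have E : dd c (dd b phi) (sh c y (sh b x z)) = dd b (dd c phi) (sh b y' (sh c x' z)).
  apply: (mulfI h2); rewrite -E1 -E2 (shC b c); ring.
have := H1 c b y x; rewrite x0 y0 => /(_ _ _)/ltW L1.
have := H2 b c y' x'; rewrite x0' y0' => /(_ _ _)/ltW L2.
have hh : h = Num.min d1 d2 / 2 by [].
rewrite (_ : _ - _ = (dd b (dd c phi) (sh b y' (sh c x' z)) - dd b (dd c phi) z) -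
  (dd c (dd b phi) (sh c y (sh b x z)) - dd c (dd b phi) z)); last by rewrite E; ring.
apply: le_trans (ler_normB _ _) _.
have l1 : `|dd c (dd b phi) (sh c y (sh b x z)) - dd c (dd b phi) z| <= e / 2.
  by apply: L1; lra.
have l2 : `|dd b (dd c phi) (sh b y' (sh c x' z)) - dd b (dd c phi) z| <= e / 2.
  by apply: L2; lra.
lra.
Qed.

(** The margin 2 exceeds the largest translation used, 1, so that outside this square both a point
    and its translate miss [box r0]; the absolute value covers negative [r0]. *)
Definition bigbox (r0 : R) : set (mR * mR) :=
  orect (- (`|r0| + 2)) (`|r0| + 2) (- (`|r0| + 2)) (`|r0| + 2).

Lemma sh_out_box b (r0 h : R) z : 0 <= h <= 1 -> ~ bigbox r0 z -> ~ box r0 (sh b h z).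
Proof.
move=> /andP[h0 h1] nz bz; apply: nz; apply/orectE.
move: bz; rewrite /box/sh/coord; have := ler_norm r0; case: b => /= ? [];
  rewrite !ler_norml => /andP[? ?] /andP[? ?]; apply/andP; split; lra.
Qed.

Lemma test_taylor phi : test_function phi -> exists (r0 : R) K, 0 <= K /\
  forall b h z, 0 <= h <= 1 ->
    `|delta b h phi z| <= K * h * \1_(bigbox r0) z /\
    `|delta b h phi z - h * dd b phi z| <= K * h ^+ 2 * \1_(bigbox r0) z.
Proof.
move=> Hphi; have [_ /compact_support[r0 Hr]] := Hphi.
have [_ [K1 [H1 _]]] := test_bounded (test_dd true Hphi).
have [_ [K2 [H2 _]]] := test_bounded (test_dd false Hphi).
have [_ [K3 [H3 _]]] := test_bounded (test_dd true (test_dd true Hphi)).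
have [_ [K4 [H4 _]]] := test_bounded (test_dd false (test_dd false Hphi)).
have P1 : 0 <= K1 by apply: le_trans (H1 0).
have P2 : 0 <= K2 by apply: le_trans (H2 0).
have P3 : 0 <= K3 by apply: le_trans (H3 0).
have P4 : 0 <= K4 by apply: le_trans (H4 0).
exists r0, (K1 + K2 + K3 + K4); split; first by rewrite !addr_ge0.
set K := _ + K4.
have D1 b z : `|dd b phi z| <= K.
  by case: b; [apply: le_trans (H1 z) _|apply: le_trans (H2 z) _]; rewrite /K; lra.
have D2 b z : `|dd b (dd b phi) z| <= K.
  by case: b; [apply: le_trans (H3 z) _|apply: le_trans (H4 z) _]; rewrite /K; lra.
move=> b h z h01; have /andP[h0 h1] := h01.
rewrite indicE; case: (boolP (z \in bigbox r0)) => [_|/negP nz]; last first.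
  have nz' : ~ bigbox r0 z by move=> ?; apply: nz; exact: mem_set.
  have z0 : ~ box r0 z by rewrite -(sh0 b z); apply: sh_out_box => //; rewrite lexx ler01.
  rewrite /delta (Hr _ (sh_out_box (b := b) h01 nz')) (Hr _ z0).
  rewrite (vanish_dd b (Hphi.1 1%N) Hr z0).
  have f0 : (false%:R : R) = 0 by [].
  by rewrite f0 !mulr0 !subr0 normr0.
rewrite !mulr1 /delta.
have [x /andP[x0 xh] ->] := mean_value_slice b z h0 (Hphi.1 1%N).
split; first by rewrite normrM (ger0_norm h0) mulrC ler_wpM2r.
rewrite -mulrBr normrM (ger0_norm h0).
have [y /andP[y0 yx] ->] := mean_value_slice b z x0 (C_dd b (Hphi.1 2%N)).
rewrite expr2 mulrCA ler_wpM2l// normrM (ger0_norm x0) mulrC.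
by apply: ler_pM.
Qed.

Lemma test_regular phi : test_function phi -> regular phi.
Proof.
move=> Hphi; have [_ [M [HM _]]] := test_bounded Hphi.
have [r0 [K [K0 HK]]] := test_taylor Hphi.
have Hp := test_sqintg Hphi.
have HQ : sqintg mu (\1_(bigbox r0)) by exact: sqintg_orect.
split => //.
- exists M; first exact: le_trans (HM 0).
  by apply: aeW => z; exact: HM.
- exists (K * nrm mu (\1_(bigbox r0))) => [|b h h01]; first by rewrite mulr_ge0// nrm_ge0.
  have /andP[h0 h1] := h01.
  apply: (@le_trans _ _ (nrm mu (fun z => (K * h) * \1_(bigbox r0) z))).
    apply: nrm_le_ae; [exact: sqintg_delta|exact: sqintgZ|].
    apply: aeW => z; have [h2 _] := HK b h z h01.
    by apply: le_trans h2 _; exact: ler_norm.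
  by rewrite (nrmZ (K * h) HQ) ger0_norm ?mulr_ge0// mulrAC.
Qed.

(** Makes test functions admissible in [has_d_ibp], which links this calculus back to identities in
    the sense of distributions. *)
Lemma test_has_d b phi : test_function phi -> has_d b phi (dd b phi).
Proof.
move=> Hphi; have Rphi := test_regular Hphi.
have Hp := test_sqintg Hphi; have Hd := test_sqintg (test_dd b Hphi).
have [r0 [K [K0 HK]]] := test_taylor Hphi.
have HQ : sqintg mu (\1_(bigbox r0)) by exact: sqintg_orect.
split => // q Hq; have Sq := regular_sqintg Hq.
exists (K * nrm mu (\1_(bigbox r0)) * nrm mu q) => h h01; have /andP[h0 h1] := h01.
have Sr : sqintg mu (fun z => delta b h phi z - h * dd b phi z).
  by apply: sqintgB; [exact: sqintg_delta|exact: sqintgZ].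
have -> : \int[mu]_z (delta b h phi z * q z) - h * \int[mu]_z (dd b phi z * q z) =
    \int[mu]_z ((delta b h phi z - h * dd b phi z) * q z).
  rewrite -RintZ; last exact: sqintgM.
  rewrite -RintB; [|apply: sqintgM => //; exact: sqintg_delta|apply: intgZ; exact: sqintgM].
  by apply: eq_Rint => z; ring.
apply: le_trans (cauchy_schwarz Sr Sq) _.
rewrite [leRHS]mulrAC ler_wpM2r ?nrm_ge0//.
apply: (@le_trans _ _ (nrm mu (fun z => (K * h ^+ 2) * \1_(bigbox r0) z))).
  apply: nrm_le_ae => //; first exact: sqintgZ.
  apply: aeW => z; have [_ h2] := HK b h z h01.
  by apply: le_trans h2 _; exact: ler_norm.
by rewrite (nrmZ (K * h ^+ 2) HQ) ger0_norm ?mulr_ge0 ?sqr_ge0// mulrAC.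
Qed.

Lemma wdE b u g k : wd b u g -> wd b u k -> ae_eq mu setT g k.
Proof.
move=> [Hu Hg ug] [_ Hk uk].
have : ae_eq mu setT (fun z => g z - k z) (cst 0).
  apply: fundamental_lemma => [q Hq|phi Hphi].
    by apply: sqintgM => //; exact: sqintgB.
  have Hp := test_sqintg Hphi.
  rewrite (_ : \int[mu]_z _ = \int[mu]_z (g z * phi z) - \int[mu]_z (k z * phi z)); last first.
    by rewrite -RintB; [apply: eq_Rint => z; ring|exact: sqintgM..].
  by have := ug _ Hphi; rewrite (uk _ Hphi) => /oppr_inj ->; rewrite subrr.
by apply: ae_mono => z h1 /h1 /eqP; rewrite subr_eq0 => /eqP.
Qed.

Lemma wdB b u v g k : wd b u g -> wd b v k ->
  wd b (fun z => u z - v z) (fun z => g z - k z).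
Proof.
move=> [Hu Hg ug] [Hv Hk vk]; split; [exact: sqintgB..|] => phi Hphi.
have Hp := test_sqintg Hphi; have Hd := test_sqintg (test_dd b Hphi).
have -> : \int[mu]_z ((u z - v z) * dd b phi z) =
    \int[mu]_z (u z * dd b phi z) - \int[mu]_z (v z * dd b phi z).
  by rewrite -RintB; [apply: eq_Rint => z; ring|exact: sqintgM..].
have -> : \int[mu]_z ((g z - k z) * phi z) =
    \int[mu]_z (g z * phi z) - \int[mu]_z (k z * phi z).
  by rewrite -RintB; [apply: eq_Rint => z; ring|exact: sqintgM..].
by rewrite ug// vk//; ring.
Qed.

Lemma ae_wd b u v g : sqintg mu v -> ae_eq mu setT u v -> wd b u g -> wd b v g.
Proof.
move=> Hv uv [Hu Hg ug]; split=> // phi Hphi; rewrite -ug//.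
have Hd := test_sqintg (test_dd b Hphi).
apply: ae_Rint.
- by apply: measurable_funM; [exact: Hv.1|exact: Hd.1].
- by apply: measurable_funM; [exact: Hu.1|exact: Hd.1].
- by move: uv; apply: ae_mono => z e /e ->.
Qed.

End test_functions.

(** * From H^3 to the calculus of regular functions *)

Section sobolev.
Variable R : realType.
Notation mu := (leb2 R).
Implicit Types (f g u v q r phi : R * R -> R) (z : R * R).

Lemma test_iter_d2 n phi : test_function phi -> test_function (iter n (@d2 R) phi).
Proof. by move=> Hphi; elim: n => //= n IH; exact: (test_dd false IH). Qed.

Lemma test_iter_d1 n phi : test_function phi -> test_function (iter n (@d1 R) phi).
Proof. by move=> Hphi; elim: n => //= n IH; exact: (test_dd true IH). Qed.

(** [is_weak_partial] applies the [d2] derivatives innermost, so raising the first index by testing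
    with [d1 phi] requires commuting [d1] past them. *)
Lemma d1_iter_d2 n phi : test_function phi -> d1 (iter n (@d2 R) phi) = iter n (@d2 R) (d1 phi).
Proof.
move=> Hphi; elim: n => //= n <-; apply/funext => z.
exact: (schwarz false true z ((test_iter_d2 n Hphi).1 2%N)).
Qed.

Lemma is_weak_partial00 u : sqintg mu u -> is_weak_partial 0 0 u u.
Proof.
move=> Hu; split; first exact/L2P.
by move=> phi Hphi; rewrite /= expr0 mul1r.
Qed.

Lemma is_weak_partial_wd1 a b u f g : is_weak_partial a b u f ->
  is_weak_partial a.+1 b u g -> wd true f g.
Proof.
move=> [/L2P Hf uf] [/L2P Hg ug]; split => // phi Hphi.
have Hd := test_dd true Hphi.
have := uf _ Hd; rewrite /= -d1_iter_d2// => Ef.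
have := ug _ Hphi; rewrite iterSr => Eg.
have s2 : (-1) ^+ (a + b) * (-1) ^+ (a + b) = 1 :> R by rewrite -exprD addnn -mul2n exprM sqrrN !expr1n.
rewrite -[LHS]mul1r -s2 -mulrA -[X in _ * X = _]Ef Eg addSn exprS mulN1r mulNr mulrN.
by rewrite mulrA s2 mul1r.
Qed.

Lemma is_weak_partial_wd2 a b u f g : is_weak_partial a b u f ->
  is_weak_partial a b.+1 u g -> wd false f g.
Proof.
move=> [/L2P Hf uf] [/L2P Hg ug]; split => // phi Hphi.
have Hd := test_dd false Hphi.
have := uf _ Hd; rewrite /= -iterSr => Ef.
have Eg := ug _ Hphi.
have s2 : (-1) ^+ (a + b) * (-1) ^+ (a + b) = 1 :> R by rewrite -exprD addnn -mul2n exprM sqrrN !expr1n.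
rewrite -[LHS]mul1r -s2 -mulrA -[X in _ * X = _]Ef Eg addnS exprS mulN1r mulNr mulrN.
by rewrite mulrA s2 mul1r.
Qed.

Lemma weak_partialP k a b u : sobolev k u -> (a + b <= k)%N ->
  is_weak_partial a b u (weak_partial a b u).
Proof.
move=> [_ Hu] ab; have [g Hg] := Hu a b ab.
exact: (@xgetPex _ (cst 0) [set g | is_weak_partial a b u g] (ex_intro _ g Hg)).
Qed.

(** The third derivatives enter here: by [wd_regular], a first derivative of [u] is regular thanks
    to its own mixed second derivative, of index (2, 1) or (1, 2) for [u]. *)
Lemma sobolev3_has_d u : sobolev 3 u ->
  [/\ regular (weak_partial 1 0 u), regular (weak_partial 0 1 u) &
  [/\ has_d true u (weak_partial 1 0 u), has_d false u (weak_partial 0 1 u),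
      has_d true (weak_partial 1 0 u) (weak_partial 2 0 u),
      has_d false (weak_partial 1 0 u) (weak_partial 1 1 u) &
      has_d true (weak_partial 0 1 u) (weak_partial 1 1 u) /\
      has_d false (weak_partial 0 1 u) (weak_partial 0 2 u)]].
Proof.
move=> Hu; have [/L2P Su _] := Hu; have H00 := is_weak_partial00 Su.
have W a b (ab : (a + b <= 3)%N) := weak_partialP Hu ab.
have A1 := is_weak_partial_wd1 H00 (W 1 0 isT)%N.
have A2 := is_weak_partial_wd2 H00 (W 0 1 isT)%N.
have B1 := is_weak_partial_wd1 (W 1 0 isT)%N (W 2 0 isT)%N.
have B2 := is_weak_partial_wd2 (W 1 0 isT)%N (W 1 1 isT)%N.
have C1 := is_weak_partial_wd1 (W 0 1 isT)%N (W 1 1 isT)%N.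
have C2 := is_weak_partial_wd2 (W 0 1 isT)%N (W 0 2 isT)%N.
have D1 := is_weak_partial_wd2 (W 2 0 isT)%N (W 2 1 isT)%N.
have D2 := is_weak_partial_wd2 (W 1 1 isT)%N (W 1 2 isT)%N.
have R0 := wd_regular A1 A2 B2; have R1 := wd_regular B1 B2 D1.
have R2 := wd_regular C1 C2 D2.
by split=> //; split; [exact: wd_has_d..|split; exact: wd_has_d].
Qed.

End sobolev.

(** * The convex profile and its Taylor estimates *)

Section profile.
Variable R : realType.
Implicit Types x y a b A B i j : R.

(** For [y >= 1], [prof y = (y - 1)^3 / y]; the cube makes it twice continuously
    differentiable at 1, and the division by y keeps it quadratic at infinity, so
    that it maps L^2 to L^1. *)
Definition cut y := Num.max y 1.
Definition prof y := (cut y - 1) ^+ 3 / cut y.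
Definition prof' y := 2 * cut y - 3 + (cut y)^-1 ^+ 2.
Definition prof'' y := 2 - 2 * (cut y)^-1 ^+ 3.

Lemma cut_ge1 y : 1 <= cut y. Proof. by rewrite le_max lexx orbT. Qed.

Lemma cut_lip x y : `|cut y - cut x| <= `|y - x|.
Proof.
rewrite /cut; case: (leP x 1) => hx; case: (leP y 1) => hy.
- by rewrite subrr normr0.
- by rewrite !ger0_norm; lra.
- by rewrite !ler0_norm; lra.
- by [].
Qed.

Lemma cut_le1 y : y <= 1 -> cut y = 1. Proof. by move=> h; rewrite /cut max_r. Qed.
Lemma cut_gt1 y : 1 <= y -> cut y = y. Proof. by move=> h; rewrite /cut max_l. Qed.

Lemma prof_le1 y : y <= 1 -> prof y = 0.
Proof. by move=> h; rewrite /prof cut_le1// subrr expr0n mul0r. Qed.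

Lemma prof'_le1 y : y <= 1 -> prof' y = 0.
Proof. by move=> h; rewrite /prof' cut_le1// invr1 expr1n; ring. Qed.

Lemma prof''_le1 y : y <= 1 -> prof'' y = 0.
Proof. by move=> h; rewrite /prof'' cut_le1// invr1 expr1n; ring. Qed.

Lemma profE y : prof y = cut y ^+ 2 - 3 * cut y + 3 - (cut y)^-1.
Proof.
have c1 := cut_ge1 y; have c0 : cut y != 0 by rewrite gt_eqF//; lra.
by rewrite /prof; field.
Qed.

(** The corner of [cut] at 1 is harmless because f' vanishes there. The extra error is nonzero only
    for y < 1 < x, where it is at most L (x - 1) (1 - y), and this product is below (y - x)^2. *)
Lemma cut_taylor (f f' : R -> R) C L : 0 <= C -> 0 <= L ->
  (forall A B, 1 <= A -> 1 <= B -> `|f B - f A - f' A * (B - A)| <= C * (B - A) ^+ 2) ->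
  (forall A, 1 <= A -> `|f' A| <= L * (A - 1)) ->
  forall x y, `|f (cut y) - f (cut x) - f' (cut x) * (y - x)| <= (C + L) * (y - x) ^+ 2.
Proof.
move=> C0 L0 H1 H2 x y.
have c1 := cut_ge1 x; have c2 := cut_ge1 y.
have -> : f (cut y) - f (cut x) - f' (cut x) * (y - x) =
   (f (cut y) - f (cut x) - f' (cut x) * (cut y - cut x)) +
   f' (cut x) * ((cut y - y) - (cut x - x)) by ring.
apply: le_trans (ler_normD _ _) _; rewrite mulrDl; apply: lerD.
  apply: le_trans (H1 _ _ c1 c2) _; rewrite ler_wpM2l//.
  rewrite -[leLHS]real_normK ?num_real// -[leRHS]real_normK ?num_real//.
  by rewrite lerXn2r ?nnegrE ?normr_ge0// cut_lip.
rewrite normrM; have := H2 _ c1.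
have [hx|hx] := leP x 1.
  rewrite (cut_le1 hx) subrr mulr0 normr_le0 => /eqP ->.
  by rewrite normr0 mul0r mulr_ge0// sqr_ge0.
rewrite (cut_gt1 (ltW hx)) subrr subr0 => h.
have [hy|hy] := leP 1 y.
  by rewrite (cut_gt1 hy) subrr normr0 mulr0 mulr_ge0// sqr_ge0.
rewrite (cut_le1 (ltW hy)) (gtr0_norm (_ : 0 < 1 - y)); last lra.
apply: (@le_trans _ _ (L * (x - 1) * (1 - y))).
  by rewrite ler_wpM2r//; lra.
rewrite -mulrA ler_wpM2l//; nra.
Qed.

(** The remainder is exactly (B - A)^2 (1 - 1/(A^2 B)). Its lower bound is convexity and its upper
    bound the Taylor estimate. *)
Lemma prof_taylor_ge1 A B : 1 <= A -> 1 <= B ->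
  0 <= (B ^+ 2 - 3 * B + 3 - B^-1) - (A ^+ 2 - 3 * A + 3 - A^-1)
    - (2 * A - 3 + A^-1 ^+ 2) * (B - A) <= (B - A) ^+ 2.
Proof.
move=> hA hB; have A0 : A != 0 by rewrite gt_eqF//; lra.
have B0 : B != 0 by rewrite gt_eqF//; lra.
have -> : (B ^+ 2 - 3 * B + 3 - B^-1) - (A ^+ 2 - 3 * A + 3 - A^-1)
    - (2 * A - 3 + A^-1 ^+ 2) * (B - A) = (B - A) ^+ 2 * (1 - A^-1 ^+ 2 * B^-1).
  by field; rewrite A0 B0.
have i0 : 0 <= A^-1 <= 1 by rewrite invr_ge0 invf_le1; lra.
have j0 : 0 <= B^-1 <= 1 by rewrite invr_ge0 invf_le1; lra.
have /andP[i1 i2] := i0; have /andP[j1 j2] := j0.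
have k1 : 0 <= A^-1 ^+ 2 * B^-1 by rewrite mulr_ge0// sqr_ge0.
have k2 : A^-1 ^+ 2 * B^-1 <= 1 by rewrite mulr_ile1 ?sqr_ge0// exprn_ile1.
have s0 := sqr_ge0 (B - A); rewrite mulr_ge0//=; last lra.
by rewrite ler_piMr//; lra.
Qed.

Lemma prof'_ge1 A : 1 <= A -> 0 <= 2 * A - 3 + A^-1 ^+ 2 <= 2 * (A - 1).
Proof.
move=> hA; have A0 : A != 0 by rewrite gt_eqF//; lra.
have [i1 i2] : 0 <= A^-1 /\ A^-1 <= 1 by rewrite invr_ge0 invf_le1; lra.
have i3 : A^-1 ^+ 2 <= 1 by rewrite exprn_ile1.
apply/andP; split; last lra.
have -> : 2 * A - 3 + A^-1 ^+ 2 = (A - 1) ^+ 2 * (2 * A + 1) * A^-1 ^+ 2 by field.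
by rewrite !mulr_ge0 ?sqr_ge0//; lra.
Qed.

Lemma prof'_taylor_ge1 A B : 1 <= A -> 1 <= B ->
  `|(2 * B - 3 + B^-1 ^+ 2) - (2 * A - 3 + A^-1 ^+ 2) - (2 - 2 * A^-1 ^+ 3) * (B - A)|
  <= 3 * (B - A) ^+ 2.
Proof.
move=> hA hB; have A0 : A != 0 by rewrite gt_eqF//; lra.
have B0 : B != 0 by rewrite gt_eqF//; lra.
have -> : (2 * B - 3 + B^-1 ^+ 2) - (2 * A - 3 + A^-1 ^+ 2) - (2 - 2 * A^-1 ^+ 3) * (B - A) =
   (A^-1 ^+ 2 * B^-1 ^+ 2 + 2 * (A^-1 ^+ 3 * B^-1)) * (B - A) ^+ 2.
  by field; rewrite A0 B0.
have [i1 i2] : 0 <= A^-1 /\ A^-1 <= 1 by rewrite invr_ge0 invf_le1; lra.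
have [j1 j2] : 0 <= B^-1 /\ B^-1 <= 1 by rewrite invr_ge0 invf_le1; lra.
have k1 : 0 <= A^-1 ^+ 2 * B^-1 ^+ 2 <= 1.
  by rewrite mulr_ge0 ?sqr_ge0//= mulr_ile1 ?sqr_ge0// exprn_ile1.
have k2 : 0 <= A^-1 ^+ 3 * B^-1 <= 1.
  by rewrite mulr_ge0 ?exprn_ge0//= mulr_ile1 ?exprn_ge0// exprn_ile1.
rewrite ger0_norm; last by rewrite mulr_ge0 ?sqr_ge0//; lra.
by rewrite ler_wpM2r ?sqr_ge0//; lra.
Qed.

Lemma prof''_ge1 A : 1 <= A -> `|2 - 2 * A^-1 ^+ 3| <= 6 * (A - 1).
Proof.
move=> hA; have A0 : A != 0 by rewrite gt_eqF//; lra.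
have [i1 i2] : 0 <= A^-1 /\ A^-1 <= 1 by rewrite invr_ge0 invf_le1; lra.
have i3 : A^-1 ^+ 3 <= 1 by rewrite exprn_ile1.
have i4 : A^-1 ^+ 2 <= 1 by rewrite exprn_ile1.
rewrite ger0_norm; last lra.
have -> : 2 - 2 * A^-1 ^+ 3 = 2 * (A - 1) * (A^-1 + A^-1 ^+ 2 + A^-1 ^+ 3) by field.
have -> : 6 * (A - 1) = 2 * (A - 1) * 3 by ring.
by rewrite ler_wpM2l; lra.
Qed.

Lemma prof'_lip_ge1 A B : 1 <= A -> 1 <= B ->
  `|(2 * B - 3 + B^-1 ^+ 2) - (2 * A - 3 + A^-1 ^+ 2)| <= 2 * `|B - A|.
Proof.
move=> hA hB; have A0 : A != 0 by rewrite gt_eqF//; lra.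
have B0 : B != 0 by rewrite gt_eqF//; lra.
have -> : (2 * B - 3 + B^-1 ^+ 2) - (2 * A - 3 + A^-1 ^+ 2) =
   (2 - (A^-1 * B^-1 ^+ 2 + A^-1 ^+ 2 * B^-1)) * (B - A).
  by field; rewrite A0 B0.
have [i1 i2] : 0 <= A^-1 /\ A^-1 <= 1 by rewrite invr_ge0 invf_le1; lra.
have [j1 j2] : 0 <= B^-1 /\ B^-1 <= 1 by rewrite invr_ge0 invf_le1; lra.
have k1 : 0 <= A^-1 * B^-1 ^+ 2 <= 1.
  by rewrite mulr_ge0 ?sqr_ge0//= mulr_ile1 ?sqr_ge0// exprn_ile1.
have k2 : 0 <= A^-1 ^+ 2 * B^-1 <= 1.
  by rewrite mulr_ge0 ?sqr_ge0//= mulr_ile1 ?sqr_ge0// exprn_ile1.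
by rewrite normrM ler_wpM2r// ler_norml; lra.
Qed.

Lemma prof''_lip_ge1 A B : 1 <= A -> 1 <= B ->
  `|(2 - 2 * B^-1 ^+ 3) - (2 - 2 * A^-1 ^+ 3)| <= 6 * `|B - A|.
Proof.
move=> hA hB; have A0 : A != 0 by rewrite gt_eqF//; lra.
have B0 : B != 0 by rewrite gt_eqF//; lra.
have -> : (2 - 2 * B^-1 ^+ 3) - (2 - 2 * A^-1 ^+ 3) =
   2 * (A^-1 * B^-1 ^+ 3 + A^-1 ^+ 2 * B^-1 ^+ 2 + A^-1 ^+ 3 * B^-1) * (B - A).
  by field; rewrite A0 B0.
have [i1 i2] : 0 <= A^-1 /\ A^-1 <= 1 by rewrite invr_ge0 invf_le1; lra.
have [j1 j2] : 0 <= B^-1 /\ B^-1 <= 1 by rewrite invr_ge0 invf_le1; lra.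
have k1 : 0 <= A^-1 * B^-1 ^+ 3 <= 1.
  by rewrite mulr_ge0 ?exprn_ge0//= mulr_ile1 ?exprn_ge0// exprn_ile1.
have k2 : 0 <= A^-1 ^+ 2 * B^-1 ^+ 2 <= 1.
  by rewrite mulr_ge0 ?exprn_ge0//= mulr_ile1 ?exprn_ge0// exprn_ile1.
have k3 : 0 <= A^-1 ^+ 3 * B^-1 <= 1.
  by rewrite mulr_ge0 ?exprn_ge0//= mulr_ile1 ?exprn_ge0// exprn_ile1.
by rewrite normrM ler_wpM2r// ler_norml; lra.
Qed.

Lemma prof_taylor x y : `|prof y - prof x - prof' x * (y - x)| <= 3 * (y - x) ^+ 2.
Proof.
(* 1 is the Taylor constant on [1, +oo[ and 2 the slope bound on the first derivative near 1, as
   required by [cut_taylor]; 9 = 3 + 6 below has the same origin. *)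
rewrite !profE (_ : 3 = 1 + 2); last by ring.
apply: (@cut_taylor (fun m => m ^+ 2 - 3 * m + 3 - m^-1) (fun m => 2 * m - 3 + m^-1 ^+ 2)) => //.
  move=> A B hA hB; have /andP[h1 h2] := prof_taylor_ge1 hA hB.
  by rewrite ger0_norm// mul1r.
by move=> A hA; have /andP[h1 h2] := prof'_ge1 hA; rewrite ger0_norm.
Qed.

Lemma prof'_taylor x y : `|prof' y - prof' x - prof'' x * (y - x)| <= 9 * (y - x) ^+ 2.
Proof.
rewrite (_ : 9 = 3 + 6); last by ring.
apply: (@cut_taylor (fun m => 2 * m - 3 + m^-1 ^+ 2) (fun m => 2 - 2 * m^-1 ^+ 3)) => //.
  exact: prof'_taylor_ge1.
exact: prof''_ge1.
Qed.

Lemma prof'_lip x y : `|prof' y - prof' x| <= 2 * `|y - x|.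
Proof.
apply: le_trans (prof'_lip_ge1 (cut_ge1 x) (cut_ge1 y)) _.
by rewrite ler_wpM2l// cut_lip.
Qed.

Lemma prof''_lip x y : `|prof'' y - prof'' x| <= 6 * `|y - x|.
Proof.
apply: le_trans (prof''_lip_ge1 (cut_ge1 x) (cut_ge1 y)) _.
by rewrite ler_wpM2l// cut_lip.
Qed.

Lemma prof_convex x y : prof' x * (y - x) <= prof y - prof x.
Proof.
have /andP[h1 _] := prof_taylor_ge1 (cut_ge1 x) (cut_ge1 y).
have h2 : prof' x * (y - x) <= prof' x * (cut y - cut x).
  have [hx|hx] := leP x 1; first by rewrite prof'_le1// !mul0r.
  rewrite (cut_gt1 (ltW hx)) ler_wpM2l//.
    by have /andP[] := prof'_ge1 (cut_ge1 x).
  by rewrite lerD2r le_max lexx.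
apply: le_trans h2 _; rewrite !profE; move: h1; rewrite /prof'; lra.
Qed.

Lemma prof'_ge0 y : 0 <= prof' y. Proof. by have /andP[] := prof'_ge1 (cut_ge1 y). Qed.

Lemma prof'_le y : prof' y <= 2 * `|y|.
Proof.
have [hy|hy] := leP y 1; first by rewrite prof'_le1// mulr_ge0.
have /andP[_] := prof'_ge1 (cut_ge1 y); rewrite -/(prof' y) (cut_gt1 (ltW hy)).
by have := ler_norm y; lra.
Qed.

Lemma prof_ge0 y : 0 <= prof y.
Proof.
have c1 := cut_ge1 y; rewrite /prof mulr_ge0 ?exprn_ge0 ?invr_ge0; lra.
Qed.

Lemma prof_le y : prof y <= y ^+ 2.
Proof.
have [hy|hy] := leP y 1; first by rewrite prof_le1// sqr_ge0.
rewrite /prof (cut_gt1 (ltW hy)) ler_pdivrMr; last lra.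
have -> : y ^+ 2 * y = y ^+ 3 by ring.
by rewrite lerXn2r ?nnegrE; lra.
Qed.

(** For y > 1 the difference of the two sides is (y - 1)^3 / y^2. *)
Lemma prof_ode y : 2 * prof y <= (y - 1) * prof' y.
Proof.
have [hy|hy] := leP y 1; first by rewrite prof_le1// prof'_le1// !mulr0.
rewrite /prof /prof' (cut_gt1 (ltW hy)).
have y0 : y != 0 by rewrite gt_eqF//; lra.
rewrite -subr_ge0 (_ : _ - _ = (y - 1) ^+ 3 * y^-1 ^+ 2); last by field.
by rewrite mulr_ge0 ?sqr_ge0// exprn_ge0//; lra.
Qed.

Lemma prof_gt0 y : 1 < y -> 0 < prof y.
Proof.
move=> hy; rewrite /prof (cut_gt1 (ltW hy)) mulr_gt0 ?exprn_gt0 ?invr_gt0; lra.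
Qed.

Lemma continuous_of_lip (f : R -> R) K : (forall x y, `|f y - f x| <= K * `|y - x|) ->
  continuous f.
Proof.
move=> fK x; apply/cvgrPdist_lt => e e0; near=> y.
rewrite distrC; apply: le_lt_trans (fK x y) _.
apply: (@le_lt_trans _ _ ((`|K| + 1) * `|y - x|)).
  by rewrite ler_wpM2r//; have := ler_norm K; lra.
have k0 : 0 < `|K| + 1 by have := normr_ge0 K; lra.
rewrite -ltr_pdivlMl// distrC mulrC; near: y.
by apply: cvgr_dist_lt => //; rewrite divr_gt0.
Unshelve. all: by end_near. Qed.

Lemma continuous_prof' : continuous prof'. Proof. exact: continuous_of_lip prof'_lip. Qed.
Lemma continuous_prof'' : continuous prof''. Proof. exact: continuous_of_lip prof''_lip. Qed.

Lemma continuous_prof : continuous prof.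
Proof.
move=> x; apply/cvgrPdist_lt => e e0; near=> y.
rewrite distrC.
have -> : prof y - prof x = (prof y - prof x - prof' x * (y - x)) + prof' x * (y - x) by ring.
apply: le_lt_trans (ler_normD _ _) _.
have h1 : `|y - x| < 1.
  by rewrite distrC; near: y; apply: cvgr_dist_lt.
have k0 : 0 < `|prof' x| + 3 by have := normr_ge0 (prof' x); lra.
have h2 : `|y - x| < e / (`|prof' x| + 3).
  by rewrite distrC; near: y; apply: cvgr_dist_lt => //; rewrite divr_gt0.
have h3 := prof_taylor x y; move: h2; rewrite ltr_pdivlMr// normrM => h2.
have h4 : 3 * (y - x) ^+ 2 <= 3 * `|y - x|.
  rewrite ler_wpM2l// -real_normK ?num_real// expr2 ler_piMl// ltW//.
by apply: le_lt_trans (_ : 3 * `|y - x| + `|prof' x| * `|y - x| < e); [rewrite lerD2r; exact: le_trans h3 h4|lra].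
Unshelve. all: by end_near. Qed.

End profile.

(** * The vorticity inequality for a single time *)

Section vorticity.
Variable R : realType.
Notation mR := (measurableTypeR R).
Notation mu := (leb2 R).
Implicit Types (u g q P Q G : R * R -> R) (f p w : R * R -> R * R) (z : R * R) (s c tau : R).

Lemma prof0 : [/\ prof (0 : R) = 0, prof' (0 : R) = 0 & prof'' (0 : R) = 0].
Proof. by split; [rewrite prof_le1|rewrite prof'_le1|rewrite prof''_le1]. Qed.

Lemma has_d_prof b u g : has_d b u g ->
  has_d b (fun z => prof (u z)) (fun z => prof' (u z) * g z).
Proof.
have [f0 f1 _] := prof0.
apply: has_d_comp f0 f1 _; [exact: continuous_prof|exact: continuous_prof'|].
move=> M M0; exists 3 => // x y _ _; split; first exact: prof_taylor.
by apply: le_trans (prof'_lip x y) _; rewrite ler_wpM2r// ler_nat.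
Qed.

Lemma has_d_prof' b u g : has_d b u g ->
  has_d b (fun z => prof' (u z)) (fun z => prof'' (u z) * g z).
Proof.
have [_ f0 f1] := prof0.
apply: has_d_comp f0 f1 _; [exact: continuous_prof'|exact: continuous_prof''|].
move=> M M0; exists 9 => // x y _ _; split; first exact: prof'_taylor.
by apply: le_trans (prof''_lip x y) _; rewrite ler_wpM2r// ler_nat.
Qed.

Lemma curl_ibp w Q G1 G2 C B : has_d true Q G1 -> has_d false Q G2 ->
  has_d true (comp2 w) C -> has_d false (comp1 w) B ->
  \int[mu]_z (Q z * (C z - B z)) =
    - \int[mu]_z (G1 z * comp2 w z - G2 z * comp1 w z).
Proof.
move=> H1 H2 HC HB.
have SQ := regular_sqintg (has_d_regular H1).
have S1 := has_d_sqintg H1; have S2 := has_d_sqintg H2.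
have SC := has_d_sqintg HC; have SB := has_d_sqintg HB.
have Sw2 := regular_sqintg (has_d_regular HC).
have Sw1 := regular_sqintg (has_d_regular HB).
rewrite RintB; [|exact: sqintgM..].
rewrite (has_d_ibp H1 HC) (has_d_ibp H2 HB).
rewrite (_ : \int[mu]_z (Q z * (C z - B z)) =
  \int[mu]_z (Q z * C z) - \int[mu]_z (Q z * B z)); first by ring.
rewrite -RintB; [|exact: sqintgM..].
by apply: eq_Rint => z; ring.
Qed.

(** G1 and G2 are only in L^2, so both derivatives are moved to the test function, where they
    commute. *)
Lemma perp_gradient_divergence_free Q G1 G2 : has_d true Q G1 -> has_d false Q G2 ->
  divergence_free (fun z => (- G2 z, G1 z)).
Proof.
move=> H1 H2 phi Hphi /=.
have T1 := test_dd true Hphi; have T2 := test_dd false Hphi.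
have S1 := has_d_sqintg H1; have S2 := has_d_sqintg H2.
have E1 := has_d_ibp H1 (test_has_d true T2).
have E2 := has_d_ibp H2 (test_has_d false T1).
have -> : \int[mu]_z (- G2 z * d1 phi z + G1 z * d2 phi z) =
    \int[mu]_z (G1 z * dd false phi z) - \int[mu]_z (G2 z * dd true phi z).
  rewrite -RintB; [|apply: sqintgM => //; exact: test_sqintg..].
  by apply: eq_Rint => z /=; ring.
rewrite (_ : dd true (dd false phi) = dd false (dd true phi)) in E1.
  by rewrite E1 E2 subrr.
by apply/funext => z; exact: (schwarz _ _ z (Hphi.1 2%N)).
Qed.

(** The perpendicular gradient of Q is an admissible field in the orthogonality defining the
    projection: this eliminates the pressure. *)
Lemma leray_perp_gradient f p Q G1 G2 : leray f p -> has_d true Q G1 -> has_d false Q G2 ->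
  \int[mu]_z (G1 z * comp2 p z - G2 z * comp1 p z) =
  \int[mu]_z (G1 z * comp2 f z - G2 z * comp1 f z).
Proof.
move=> [[/L2P Sf1 /L2P Sf2] [/L2P Sp1 /L2P Sp2] _ Horth] H1 H2.
have S1 := has_d_sqintg H1; have S2 := has_d_sqintg H2.
have Hw : L2v (fun z => (- G2 z, G1 z)) by split; apply/L2P => //; exact: sqintgN.
have := Horth _ Hw (perp_gradient_divergence_free H1 H2).
move=> /= H; apply/esym/eqP; rewrite -subr_eq0; apply/eqP; rewrite -[RHS]H.
have M u v (Hu : sqintg mu u) (Hv : sqintg mu v) := sqintgM Hu Hv.
rewrite -RintB; [|apply: intgB; exact: sqintgM..].
by apply: eq_Rint => z; rewrite /comp1 /comp2 /=; ring.
Qed.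

Lemma divergence_free_trace w A D : has_d true (comp1 w) A -> has_d false (comp2 w) D ->
  divergence_free w -> ae_eq mu setT (fun z => A z + D z) (cst 0).
Proof.
move=> HA HD Hw; have SA := has_d_sqintg HA; have SD := has_d_sqintg HD.
have Sw1 := regular_sqintg (has_d_regular HA).
have Sw2 := regular_sqintg (has_d_regular HD).
apply: fundamental_lemma => [q Hq|phi Hphi]; first by apply: sqintgM => //; exact: sqintgD.
have T1 := test_dd true Hphi; have T2 := test_dd false Hphi.
have Sp := test_sqintg Hphi; have S1 := test_sqintg T1; have S2 := test_sqintg T2.
have -> : \int[mu]_z ((A z + D z) * phi z) =
    \int[mu]_z (A z * phi z) + \int[mu]_z (D z * phi z).
  by rewrite -RintD; [apply: eq_Rint => z; ring|exact: sqintgM..].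
rewrite (has_d_ibp HA (test_has_d true Hphi)) (has_d_ibp HD (test_has_d false Hphi)).
rewrite -opprD -RintD; [|exact: sqintgM..].
by rewrite (Hw _ Hphi) oppr0.
Qed.

(** A, B, C, D stand for d1 v1, d2 v1, d1 v2, d2 v2 and c, s for the cosine and sine. The factor of
    tau prof' is the curl of the nonlinearity without its transport of the vorticity, and the factor
    of prof is the divergence of the rotated field. *)
Lemma vorticity_pointwise c s tau A B C D o y : 0 <= s -> 0 <= tau -> A + D = 0 ->
  o = C - B -> y = - tau * o ->
  0 <= tau * (prof' y * (c * (A + D) * o + s * (B ^+ 2 + C ^+ 2 - 2 * (A * D))))
       + prof y * (c * (A + D) + s * o) + s / 2 * (prof' y * o).
Proof.
move=> s0 t0 AD oE yE.
have [hy|hy] := leP y 1; first by rewrite prof_le1// prof'_le1// !mul0r !mulr0 !addr0.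
have h1 := prof_ode y; have h2 := prof'_ge0 y.
have o0 : 0 <= - o.
  rewrite oppr_ge0 leNgt; apply/negP => o0.
  have : y <= 0 by rewrite yE mulNr oppr_le0 mulr_ge0// ltW.
  by move: hy; lra.
have -> : D = - A by lra.
have -> : A + - A = 0 by ring.
(* Splitting B^2 + C^2 as o^2 / 2 + (B + C)^2 / 2 separates a sum of squares; the o^2 part, with tau
   o = - y, joins the remaining terms into the combination controlled by [prof_ode]. *)
have -> : tau * (prof' y * (c * 0 * o + s * (B ^+ 2 + C ^+ 2 - 2 * (A * - A))))
       + prof y * (c * 0 + s * o) + s / 2 * (prof' y * o) =
   s * (tau * prof' y * (2 * A ^+ 2 + (B + C) ^+ 2 / 2)) +
   s * ((- o) / 2 * ((y - 1) * prof' y - 2 * prof y)).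
  by rewrite yE oE; field.
rewrite addr_ge0// mulr_ge0//.
  rewrite mulr_ge0 ?mulr_ge0//; have := sqr_ge0 A; have := sqr_ge0 (B + C); lra.
by rewrite mulr_ge0 ?divr_ge0 ?subr_ge0.
Qed.

Lemma has_d_weak_curl w : sobolevv 3 w ->
  has_d true (weak_curl w)
    (fun z => weak_partial 2 0 (comp2 w) z - weak_partial 1 1 (comp1 w) z) /\
  has_d false (weak_curl w)
    (fun z => weak_partial 1 1 (comp2 w) z - weak_partial 0 2 (comp1 w) z).
Proof.
move=> [H1 H2].
have [_ _ [_ _ a1 a2 [a3 a4]]] := sobolev3_has_d H1.
have [_ _ [_ _ b1 b2 [b3 b4]]] := sobolev3_has_d H2.
by split; apply: has_dB.
Qed.

Lemma ae_Rint_ge0 u : intg mu u -> {ae mu, forall z, 0 <= u z} -> 0 <= \int[mu]_z u z.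
Proof.
move=> Iu u0; have I0 : intg mu (fun=> 0) by exact: integrable0.
by apply: le_trans (ae_le_Rint I0 Iu u0); exact: Rint_ge0.
Qed.

(** J1, ..., J4 have total integral 0; adding them is what makes the integrand nonnegative
    pointwise. *)
Lemma ae_Rint_combination_ge0 (t k : R) (J J1 J2 J3 J4 K : R * R -> R) :
  intg mu J -> intg mu J1 -> intg mu J2 -> intg mu J3 -> intg mu J4 -> intg mu K ->
  \int[mu]_z J3 z = - (\int[mu]_z J1 z) -> \int[mu]_z J4 z = - (\int[mu]_z J2 z) ->
  {ae mu, forall z, 0 <= t * J z + ((J1 z + J2 z) + (J3 z + J4 z)) + k * K z} ->
  0 <= t * \int[mu]_z J z + k * \int[mu]_z K z.
Proof.
move=> IJ I1 I2 I3 I4 IK E1 E2 /ae_Rint_ge0.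
have I12 := intgD I1 I2; have I34 := intgD I3 I4; have I14 := intgD I12 I34.
have IZ := intgZ t IJ; have I0 := intgD IZ I14.
move=> /(_ (intgD I0 (intgZ k IK))).
rewrite RintD//; last exact: intgZ.
rewrite RintD// [X in _ + X + _]RintD// [X in _ + (X + _) + _]RintD//.
rewrite [X in _ + (_ + X) + _]RintD// E1 E2 !RintZ//.
by set a := (X in _ + X + _); have -> : a = 0; [rewrite /a; ring|rewrite addr0].
Qed.

(** Pairing the curl of the projected equation with [Q = f'(- tau om)]: the term in
    [R_(-alpha)(w).grad om] is a multiple of the gradient of [f(- tau om)], and
    integrates by parts against the divergence of [R_(-alpha)(w)]. *)
Lemma vorticity_inequality alpha tau w p : sobolevv 3 w -> divergence_free w ->
  leray (transport (rot_neg alpha \o w) w) p -> 0 <= sin alpha -> 0 <= tau ->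
  exists G1 G2, let Q z := prof' (- tau * weak_curl w z) in
    [/\ has_d true Q G1, has_d false Q G2 &
    0 <= - tau * \int[mu]_z (G1 z * comp2 p z - G2 z * comp1 p z)
       + sin alpha / 2 * \int[mu]_z (Q z * weak_curl w z)].
Proof.
move=> Hw divw Hp s0 t0; set s := sin alpha; set c := cos alpha.
have [w1d w2d] := has_d_weak_curl Hw.
have [H1 H2] := Hw.
have [RA RB [A0 B0 A1 A2 [B1 B2]]] := sobolev3_has_d H1.
have [RC RD [C0 D0 C1 C2 [D1 D2]]] := sobolev3_has_d H2.
have AD := divergence_free_trace A0 D0 divw.
set A := weak_partial 1 0 (comp1 w) in RA A0 A1 A2 AD.
set B := weak_partial 0 1 (comp1 w) in RB B0 B1 B2 AD.
set C := weak_partial 1 0 (comp2 w) in RC C0 C1 C2 AD.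
set D := weak_partial 0 1 (comp2 w) in RD D0 D1 D2 AD.
set o := weak_curl w in w1d w2d *.
set o1 := (fun z => _) in w1d; set o2 := (fun z => _) in w2d.
have y1 := has_dZ (- tau) w1d; have y2 := has_dZ (- tau) w2d.
have P1 := has_d_prof y1; have P2 := has_d_prof y2.
have Q1 := has_d_prof' y1; have Q2 := has_d_prof' y2.
eexists; eexists; split; [exact: Q1|exact: Q2|].
set Q := (fun z => prof' _) in Q1 Q2 *.
set P := (fun z => prof _) in P1 P2.
rewrite (leray_perp_gradient Hp Q1 Q2).
set f := transport _ _.
pose r1 z := c * comp1 w z + s * comp2 w z.
pose r2 z := (- s) * comp1 w z + c * comp2 w z.
have r11 : has_d true r1 (fun z => c * A z + s * C z) by apply: has_dD; exact: has_dZ.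
have r12 : has_d false r1 (fun z => c * B z + s * D z) by apply: has_dD; exact: has_dZ.
have r21 : has_d true r2 (fun z => (- s) * A z + c * C z) by apply: has_dD; exact: has_dZ.
have r22 : has_d false r2 (fun z => (- s) * B z + c * D z) by apply: has_dD; exact: has_dZ.
have f2d : has_d true (comp2 f) _ := has_dD (has_dM r11 C1) (has_dM r21 D1).
have f1d : has_d false (comp1 f) _ := has_dD (has_dM r12 A2) (has_dM r22 B2).
have RQ := has_d_regular Q1; have RP := has_d_regular P1.
have SQ := regular_sqintg RQ; have SP := regular_sqintg RP.
have So := regular_sqintg (has_d_regular w1d).
have So1 := has_d_sqintg w1d; have So2 := has_d_sqintg w2d.
have Sr1 := regular_sqintg (has_d_regular r11).
have Sr2 := regular_sqintg (has_d_regular r21).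
have EK := curl_ibp Q1 Q2 f2d f1d.
have Scurl := sqintgB (has_d_sqintg f2d) (has_d_sqintg f1d).
set g := (fun z => _) in Scurl.
have E1 := has_d_ibp P1 r11; have E2 := has_d_ibp P2 r22.
set dr1 := (fun z => _ : R) in r11 E1; set dr2 := (fun z => _ : R) in r22 E2.
have IP1 := sqintgM SP (has_d_sqintg r11); have IP2 := sqintgM SP (has_d_sqintg r22).
have IQ1 := sqintgM (has_d_sqintg P1) Sr1; have IQ2 := sqintgM (has_d_sqintg P2) Sr2.
have IQ := sqintgM SQ Scurl; have IQo := sqintgM SQ So.
have E3 : forall x y : R, - tau * x + y = tau * (- x) + y by move=> x y; ring.
rewrite E3 -EK; apply: (ae_Rint_combination_ge0 IQ IP1 IP2 IQ1 IQ2 IQo E1 E2).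
move: AD; apply: ae_mono => z /(_ I) AD.
have := vorticity_pointwise c s0 t0 AD (erefl (C z - B z)) (erefl (- tau * (C z - B z))).
(* The second derivatives cancel: tau Q (r . grad om), from the curl, is opposite to r . grad P,
   since P is the profile of - tau om. *)
set L := (X in 0 <= X); set L' := (X in _ -> 0 <= X); have -> // : L = L'.
rewrite /L /L' /g /dr1 /dr2 /Q /P /r1 /r2 /o1 /o2 /s /c.
have -> : o z = C z - B z by [].
move: (prof' _) (prof _) => pp qq; move: (A z) (B z) (C z) (D z) (comp1 w z) (comp2 w z).
move: (weak_partial 2 0 _ z) (weak_partial 1 1 _ z) (weak_partial 1 1 _ z).
move: (weak_partial 0 2 _ z) (sin alpha) (cos alpha).
by clear => *; ring.
Qed.

End vorticity.

(** * Comparison with the extended-real Sobolev norms *)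

Section norms.
Variable R : realType.
Notation mR := (measurableTypeR R).
Notation mu := (leb2 R).
Implicit Types (u g q : R * R -> R) (f p w : R * R -> R * R) (z : R * R).

Lemma normL2E u : sqintg mu u -> normL2 u = (nrm mu u)%:E.
Proof.
move=> [mu_ u2]; rewrite /normL2 unlock /=.
have -> : (\int[mu]_x `|(u x)%:E| `^ 2 = (\int[mu]_x (u x ^+ 2))%:E)%E.
  rewrite /Rintegral fineK; last exact: integrable_fin_num.
  by apply: eq_integral => x _; rewrite abse_EFin poweR_EFin powR_mulrn// real_normK ?num_real.
by rewrite poweR12_sqrt ?lee_fin ?Rint_ge0// => x; exact: sqr_ge0.
Qed.

Lemma le_sqrte (x y : \bar R) : (0 <= x -> x ^+ 2 <= y -> x <= sqrte y)%E.
Proof.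
move=> x0 xy; rewrite -(gee0_abs x0) -sqrte_sqr lee_sqrt//.
by apply: le_trans xy; exact: expe_ge0.
Qed.

Lemma normL2v_ge_nrm w : L2v w -> 
  ((nrm mu (comp1 w))%:E <= normL2v w)%E /\ ((nrm mu (comp2 w))%:E <= normL2v w)%E.
Proof.
move=> [/L2P H1 /L2P H2].
by split; apply: le_sqrte; rewrite ?lee_fin ?nrm_ge0// normL2E// ?normL2E//;
  [apply: leeDl|apply: leeDr]; exact: sqre_ge0.
Qed.

Lemma normH_ge_nrm (k a b : nat) u : (a + b <= k)%N -> sqintg mu (weak_partial a b u) ->
  ((nrm mu (weak_partial a b u))%:E <= normH k u)%E.
Proof.
move=> ab Hu; apply: le_sqrte; rewrite ?lee_fin ?nrm_ge0// -normL2E//.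
have ak : (a < k.+1)%N by rewrite ltnS (leq_trans _ ab)// leq_addr.
have bk : (b < k.+1)%N by rewrite ltnS (leq_trans _ ab)// leq_addl.
rewrite (bigD1 (Ordinal ak))//= (bigD1 (Ordinal bk))//=.
have N0 (i j : nat) : (0 <= normL2 (weak_partial i j u) ^+ 2)%E by exact: sqre_ge0.
have H (x y t : \bar R) : (0 <= y -> 0 <= t -> x <= x + y + t)%E.
  by move=> y0 t0; rewrite -addeA leeDl// adde_ge0.
apply: H; first by apply: sume_ge0 => i _; exact: N0.
by apply: sume_ge0 => i _; apply: sume_ge0 => j _; exact: N0.
Qed.

Lemma normHv_ge k w : (normH k (comp1 w) <= normHv k w)%E /\ (normH k (comp2 w) <= normHv k w)%E.
Proof.
by split; apply: le_sqrte; rewrite ?sqrte_ge0//; [apply: leeDl|apply: leeDr]; exact: sqre_ge0.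
Qed.

Lemma is_weak_partialB a b u g du dg : is_weak_partial a b u du -> is_weak_partial a b g dg ->
  sqintg mu u -> sqintg mu g ->
  is_weak_partial a b (fun z => u z - g z) (fun z => du z - dg z).
Proof.
move=> [/L2P Hdu Eu] [/L2P Hdg Eg] Hu Hg; split; first exact/L2P/sqintgB.
move=> phi Hphi; have Sp := test_sqintg Hphi.
have Sd := test_sqintg (test_iter_d1 a (test_iter_d2 b Hphi)).
have -> : \int[mu]_x ((u x - g x) * iter a (@d1 R) (iter b (@d2 R) phi) x) =
    \int[mu]_x (u x * iter a (@d1 R) (iter b (@d2 R) phi) x) -
    \int[mu]_x (g x * iter a (@d1 R) (iter b (@d2 R) phi) x).
  by rewrite -RintB; [apply: eq_Rint => z; ring|exact: sqintgM..].
have -> : \int[mu]_x ((du x - dg x) * phi x) =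
    \int[mu]_x (du x * phi x) - \int[mu]_x (dg x * phi x).
  by rewrite -RintB; [apply: eq_Rint => z; ring|exact: sqintgM..].
by rewrite Eu// Eg// mulrBr.
Qed.

Lemma sobolevB k u g : sobolev k u -> sobolev k g -> sobolev k (fun z => u z - g z).
Proof.
move=> [Lu Hu] [Lg Hg]; split; first by apply/L2P/sqintgB; exact/L2P.
move=> a b ab; have [du Hdu] := Hu a b ab; have [dg Hdg] := Hg a b ab.
by eexists; apply: (is_weak_partialB Hdu Hdg); exact/L2P.
Qed.

Lemma weak_partial_wd k u : sobolev k u -> (1 <= k)%N ->
  wd true u (weak_partial 1 0 u) /\ wd false u (weak_partial 0 1 u).
Proof.
move=> Hu k1; have [/L2P Su _] := Hu; have H0 := is_weak_partial00 Su.
split; first exact: is_weak_partial_wd1 H0 (weak_partialP Hu _).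
by apply: is_weak_partial_wd2 H0 (weak_partialP Hu _).
Qed.

(** [weak_partial] chooses representatives, so the curl of a difference is the difference of the
    curls only almost everywhere, by uniqueness of weak derivatives. *)
Lemma nrm_weak_curlB k w p : (1 <= k)%N -> sobolevv k w -> sobolevv k p ->
  ((nrm mu (fun z => weak_curl w z - weak_curl p z))%:E <=
     normHv k (w \- p)%R + normHv k (w \- p)%R)%E.
Proof.
move=> k1 [W1 W2] [P1 P2].
have D1 : sobolev k (comp1 (w \- p)) := sobolevB W1 P1.
have D2 : sobolev k (comp2 (w \- p)) := sobolevB W2 P2.
have [_ w1] := weak_partial_wd W1 k1; have [w2 _] := weak_partial_wd W2 k1.
have [_ p1] := weak_partial_wd P1 k1; have [p2 _] := weak_partial_wd P2 k1.
have [_ q1] := weak_partial_wd D1 k1; have [q2 _] := weak_partial_wd D2 k1.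
have [_ S1 _] := q1; have [_ S2 _] := q2.
have E1 := wdE (wdB w1 p1) q1; have E2 := wdE (wdB w2 p2) q2.
have [_ Sw1 _] := w1; have [_ Sw2 _] := w2.
have [_ Sp1 _] := p1; have [_ Sp2 _] := p2.
apply: (@le_trans _ _ (nrm mu (weak_partial 1 0 (comp2 (w \- p))) +
   nrm mu (weak_partial 0 1 (comp1 (w \- p))))%:E).
  rewrite lee_fin; apply: le_trans (nrmB S2 S1).
  rewrite le_eqVlt; apply/orP; left; apply/eqP.
  apply: nrm_ae; [by do 2 apply: sqintgB|exact: sqintgB|].
  apply: ae_mono2 E1 E2 => z /= /[swap] h2 h1 Iz; rewrite /weak_curl.
  have H (a b c d e f : R) : a - b = c -> d - e = f -> a - d - (b - e) = c - f.
    by move=> <- <-; ring.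
  exact: H (h2 Iz) (h1 Iz).
have [N1 N2] := normHv_ge k (w \- p).
rewrite EFinD; apply: leeD.
  by apply: le_trans N2; apply: normH_ge_nrm.
by apply: le_trans N1; apply: normH_ge_nrm.
Qed.

End norms.

(** * A monotonicity criterion for functions of one real variable *)

Section real_functions.
Variable R : realType.
Implicit Types (E : R -> R) (t h x y : R).

Lemma small_factor (a b : R) : 0 <= a -> 0 < b -> exists2 e, 0 < e & a * e <= b.
Proof.
move=> a0 b0; exists (b / (a + 1)); first by rewrite divr_gt0//; lra.
rewrite mulrA ler_pdivrMr; last lra.
by rewrite mulrDr mulr1 mulrC; lra.
Qed.

Lemma le_normB (a b c : R) : 0 <= a -> 0 <= b -> b <= c -> `|a - b| <= a + c.
Proof. by move=> ? ? ?; rewrite ler_norml; lra. Qed.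

(** The first condition bounds the lower right Dini derivative from below by 0, the second is upper
    semicontinuity. For a slope e > 0, consider the supremum of the times t with E(0) - e t <= E(t):
    upper semicontinuity puts it in the set, and the Dini condition allows a further step unless it
    is T. *)
Lemma nonneg_dini_le E T : 0 < T ->
  (forall t, 0 <= t < T -> forall e, 0 < e -> exists2 d, 0 < d &
    forall h, 0 < h < d -> t + h <= T -> E t - e * h <= E (t + h)) ->
  (forall t, 0 < t <= T -> forall e, 0 < e -> exists2 d, 0 < d &
    forall t', 0 <= t' <= T -> `|t' - t| < d -> E t' <= E t + e) ->
  E 0 <= E T.
Proof.
move=> T0 Hr Hl.
suff H e : 0 < e -> E 0 - e * T <= E T.
  rewrite leNgt; apply/negP => lt0.
  have e0 : 0 < (E 0 - E T) / 2 / T by rewrite !divr_gt0// subr_gt0.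
  have := H _ e0; rewrite divfK ?gt_eqF//; lra.
move=> e0; pose S := [set t | 0 <= t <= T /\ E 0 - e * t <= E t].
have S0 : S 0 by rewrite /S /= mulr0 subr0 lexx ltW.
have hS : has_sup S by split; [exists 0|exists T => t [/andP[]]].
have sT : sup S <= T by apply: ge_sup; [exists 0|move=> t [/andP[]]].
have s0 : 0 <= sup S by apply: ub_le_sup => //; exact: hS.2.
have Ss : S (sup S).
  split; first by rewrite s0 sT.
  have [->|sp] := eqVneq (sup S) 0; first by rewrite mulr0 subr0.
  have sp0 : 0 < sup S by rewrite lt_neqAle eq_sym sp.
  apply/ler_addgt0Pr => e' e'0.
  have [|d d0 Hd] := Hl (sup S) _ e' e'0; first by rewrite sp0 sT.
  have [t St td] := sup_adherent d0 hS.
  have ts : t <= sup S by apply: ub_le_sup => //; exact: hS.2.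
  have [t0T Et] := St.
  have := Hd t t0T; rewrite ler0_norm ?subr_le0// => /(_ ltac:(lra)).
  by move=> h; have := ler_wpM2l (ltW e0) ts; lra.
have [sE|] := eqVneq (sup S) T; first by rewrite -sE; exact: Ss.2.
move=> sN; have sltT : sup S < T by rewrite lt_neqAle sN.
have [|d d0 Hd] := Hr (sup S) _ e e0; first by rewrite s0 sltT.
pose h := Num.min (d / 2) (T - sup S).
have h0 : 0 < h by rewrite lt_min subr_gt0 sltT divr_gt0.
have hd : h < d by rewrite gt_min; apply/orP; left; lra.
have hT : sup S + h <= T by have : h <= T - sup S by [rewrite ge_min lexx orbT]; lra.
have Eh := Hd h; rewrite h0 hd in Eh; have {}Eh := Eh isT hT.
have : S (sup S + h).
  by split; [rewrite hT addr_ge0// ltW|have := Ss.2; lra].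
by move=> /(ub_le_sup hS.2); lra.
Qed.

Lemma cvg0_near (G : set_system R) (F : R -> \bar R) (eta : R) : Filter G ->
  F s @[s --> G] --> 0%E -> 0 < eta -> \forall s \near G, (F s < eta%:E)%E.
Proof.
move=> FG cv e0; apply: (cv [set y | (y < eta%:E)%E]).
by apply: open_nbhs_nbhs; split; [exact: open_ereal_lt_ereal|rewrite /= lte_fin].
Qed.

Lemma near_ball (t : R) (P : set R) : (\forall s \near t, P s) ->
  exists2 d, 0 < d & forall s, `|s - t| < d -> P s.
Proof.
move=> /nbhs_ballP[d /= d0 Hd]; exists d => // s sd; apply: Hd.
by rewrite /ball /= distrC.
Qed.

End real_functions.

(** * Time evolution of the energy *)

Section energy.
Variable R : realType.
Notation mR := (measurableTypeR R).
Notation mu := (leb2 R).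
Implicit Types (u g q Q G : R * R -> R) (f p w : R * R -> R * R) (z : R * R) (h s t tau sigma : R).

Definition energy tau u := \int[mu]_z prof (- tau * u z).

Lemma intg_prof u : sqintg mu u -> intg mu (fun z => prof (u z)).
Proof.
move=> [mu_ u2]; apply: (intg_le _ _ u2).
  by apply: measurableT_comp => //; apply: continuous_measurable_fun; exact: continuous_prof.
move=> z; rewrite ger0_norm ?prof_ge0// ger0_norm ?sqr_ge0//; exact: prof_le.
Qed.

Lemma sqintg_prof' u : sqintg mu u -> sqintg mu (fun z => prof' (u z)).
Proof.
move=> Hu; apply: (sqintg_le _ _ (sqintgZ 2 Hu)).
  by apply: measurableT_comp Hu.1 => //; apply: continuous_measurable_fun; exact: continuous_prof'.
by move=> z; rewrite ger0_norm ?prof'_ge0// normrM ger0_norm//; exact: prof'_le.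
Qed.

Lemma prof_convex_Rint u g : sqintg mu u -> sqintg mu g ->
  \int[mu]_z (prof' (u z) * (g z - u z)) <= \int[mu]_z prof (g z) - \int[mu]_z prof (u z).
Proof.
move=> Hu Hg; rewrite -RintB; [|exact: intg_prof..].
apply: le_Rint; first by apply: sqintgM; [exact: sqintg_prof'|exact: sqintgB].
  by apply: intgB; exact: intg_prof.
by move=> z; exact: prof_convex.
Qed.

Lemma weak_curlBE w w' z : weak_curl w' z - weak_curl w z =
  (weak_partial 1 0 (comp2 w') z - weak_partial 1 0 (comp2 w) z) -
  (weak_partial 0 1 (comp1 w') z - weak_partial 0 1 (comp1 w) z).
Proof.
have H (a b k l : R) : a - b - (k - l) = a - k - (b - l) by ring.
exact: H.
Qed.

(** [d] is the error of the difference quotient, small in L^2 because v_t = - p. The first bracket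
    is the quantity shown nonnegative by [vorticity_inequality]; the second collects the errors, one
    from the change of tau during the step and one from [d]. *)
Lemma energy_step tau sigma h w w' p G1 G2 : h != 0 ->
  sobolevv 3 w -> sobolevv 3 w' -> L2v p ->
  let Q z := prof' (- tau * weak_curl w z) in
  let d x := h^-1 *: (w' x - w x) + p x in
  let K := \int[mu]_z (G1 z * comp2 p z - G2 z * comp1 p z) in
  has_d true Q G1 -> has_d false Q G2 ->
  h * (- tau * K + sigma * \int[mu]_z (Q z * weak_curl w z)) +
    h * (sigma * h * K + (tau - sigma * h) *
      \int[mu]_z (G1 z * comp2 d z - G2 z * comp1 d z)) <=
  energy (tau - sigma * h) (weak_curl w') - energy tau (weak_curl w).
Proof.
move=> h0 Hw Hw' [/L2P Sp1 /L2P Sp2] Q d K H1 H2.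
have [wd1 _] := has_d_weak_curl Hw; have [wd1' _] := has_d_weak_curl Hw'.
have So := regular_sqintg (has_d_regular wd1).
have So' := regular_sqintg (has_d_regular wd1').
have [W1 W2] := Hw; have [W1' W2'] := Hw'.
have [_ _ [_ B0 _ _ _]] := sobolev3_has_d W1; have [_ _ [C0 _ _ _ _]] := sobolev3_has_d W2.
have [_ _ [_ B0' _ _ _]] := sobolev3_has_d W1'; have [_ _ [C0' _ _ _ _]] := sobolev3_has_d W2'.
have EC : has_d true (comp2 (w' \- w)) _ := has_dB C0' C0.
have EB : has_d false (comp1 (w' \- w)) _ := has_dB B0' B0.
have EK := curl_ibp H1 H2 EC EB.
have SG1 := has_d_sqintg H1; have SG2 := has_d_sqintg H2.
have SQ := regular_sqintg (has_d_regular H1).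
have Sw1 : sqintg mu (comp1 (w' \- w)) := regular_sqintg (has_d_regular EB).
have Sw2 : sqintg mu (comp2 (w' \- w)) := regular_sqintg (has_d_regular EC).
have Sd1 : sqintg mu (comp1 d) := sqintgD (sqintgZ h^-1 Sw1) Sp1.
have Sd2 : sqintg mu (comp2 d) := sqintgD (sqintgZ h^-1 Sw2) Sp2.
apply: le_trans (prof_convex_Rint (sqintgZ (- tau) So) (sqintgZ (- (tau - sigma * h)) So')).
have IK : intg mu (fun z => G1 z * comp2 p z - G2 z * comp1 p z).
  by apply: intgB; exact: sqintgM.
have Id : intg mu (fun z => G1 z * comp2 d z - G2 z * comp1 d z).
  by apply: intgB; exact: sqintgM.
set err := \int[mu]_z (G1 z * comp2 d z - _).
have Ew : \int[mu]_z (Q z * (weak_curl w' z - weak_curl w z)) = h * K - h * err.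
  rewrite (_ : \int[mu]_z _ = - \int[mu]_z (G1 z * comp2 (w' \- w) z - G2 z * comp1 (w' \- w) z)).
    rewrite /K /err -!RintZ// -RintB; [|exact: intgZ..].
    rewrite -RintN; last by apply: intgB; exact: sqintgM.
    apply: eq_Rint => z.
    have -> : comp1 d z = h^-1 * (comp1 w' z - comp1 w z) + comp1 p z by [].
    have -> : comp2 d z = h^-1 * (comp2 w' z - comp2 w z) + comp2 p z by [].
    have -> : comp1 (w' \- w) z = comp1 w' z - comp1 w z by [].
    have -> : comp2 (w' \- w) z = comp2 w' z - comp2 w z by [].
    by field.
  rewrite -EK; apply: eq_Rint => z.
  exact: (congr1 (fun x => Q z * x) (weak_curlBE w w' z)).
rewrite le_eqVlt; apply/orP; left; apply/eqP.
transitivity (\int[mu]_z (- (tau - sigma * h) *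
    (Q z * (weak_curl w' z - weak_curl w z)) + sigma * h * (Q z * weak_curl w z))); last first.
  apply: eq_Rint => z; rewrite /Q; move: (weak_curl w z) (weak_curl w' z) => a b.
  by move: (prof' _) => k; ring.
rewrite RintD; [|apply: intgZ; apply: sqintgM => //; exact: sqintgB|by apply: intgZ; exact: sqintgM].
rewrite RintZ; last exact: sqintgM.
rewrite RintZ; last by apply: sqintgM => //; exact: sqintgB.
by rewrite Ew; ring.
Qed.

Variables (alpha tau0 : R) (v0 : R * R -> R * R) (v : R -> R * R -> R * R) (T : \bar R).
Hypotheses (Hsol : solution alpha v0 v T) (s0 : 0 < sin alpha).

Let sigma := sin alpha / 2.
Let tau t := tau0 - sigma * t.
Let energy_at t := energy (tau t) (weak_curl (v t)).

Lemma energy_right_lower t e : time_interval T t -> 0 <= tau t -> 0 < e ->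
  exists2 d, 0 < d & forall h, 0 < h < d -> time_interval T (t + h) ->
    energy_at t - e * h <= energy_at (t + h).
Proof.
move=> It t0 e0; have [_ [Sob _] Hder Hdiv _] := Hsol.
have sg0 : 0 < sigma by rewrite divr_gt0.
have sgM x : `|sigma * x| = sigma * `|x| by rewrite (normrM sigma x) (gtr0_norm sg0).
have [p Hp cvp] := Hder t It; have [_ Lp _ _] := Hp.
have [G1 [G2 [H1 H2 Hge]]] := vorticity_inequality (Sob t It) (Hdiv t It) Hp (ltW s0) t0.
set Q := (fun z => _) in H1 H2 Hge; set K := \int[mu]_z (_ - _) in Hge.
have SG1 := has_d_sqintg H1; have SG2 := has_d_sqintg H2.
have n1 := nrm_ge0 mu G1; have n2 := nrm_ge0 mu G2.
have e20 : 0 < e / 2 by rewrite divr_gt0.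
(* As h < 1, the factor tau t - sigma h is at most tau t + sigma in absolute value; [eta] and [d1]
   then make each of the two error terms at most e/2. *)
have a0 : 0 <= (tau t + sigma) * (nrm mu G1 + nrm mu G2).
  by apply: mulr_ge0; [exact: addr_ge0 (ltW _)|exact: addr_ge0].
have [eta eta0 Heta] := small_factor a0 e20.
have a1 : 0 <= sigma * `|K| by rewrite mulr_ge0// ltW.
have [d1 d10 Hd1] := small_factor a1 e20.
have Fw : Filter (within (time_interval T) t^') by exact: within_filter.
have := cvg0_near Fw cvp eta0; rewrite near_withinE near_withinE => /near_ball[d2 d20 Hd2].
exists (Num.min 1 (Num.min d1 d2)); first by rewrite !lt_min ltr01 d10 d20.
move=> h /andP[h0]; rewrite !lt_min => /and3P[h1 hd1 hd2] Ith.
have hN0 : h != 0 by rewrite gt_eqF.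
have hE : t + h - t = h by ring.
have := Hd2 (t + h); rewrite hE gtr0_norm// => /(_ hd2).
rewrite -subr_eq0 hE => /(_ hN0 Ith).
set dd := (fun x => _) => Hdd.
have Sv := Sob t It; have Svh := Sob _ Ith.
have Ldd : L2v dd.
  have [[S1 _] [S2 _]] := Sv; have [[S1' _] [S2' _]] := Svh; have [P1 P2] := Lp.
  split; apply/L2P.
    by apply: (sqintgD (sqintgZ h^-1 (sqintgB _ _))); exact/L2P.
  by apply: (sqintgD (sqintgZ h^-1 (sqintgB _ _))); exact/L2P.
have [N1 N2] := normL2v_ge_nrm Ldd.
have {}N1 : nrm mu (comp1 dd) <= eta.
  by rewrite -lee_fin; apply: le_trans N1 (ltW Hdd).
have {}N2 : nrm mu (comp2 dd) <= eta.
  by rewrite -lee_fin; apply: le_trans N2 (ltW Hdd).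
have [/L2P Sd1 /L2P Sd2] := Ldd.
have step := @energy_step (tau t) sigma h (v t) (v (t + h)) p G1 G2 hN0 Sv Svh Lp H1 H2.
rewrite /= -/Q -/K -/dd in step.
set err := \int[mu]_z (G1 z * comp2 dd z - _) in step.
have Herr : `|err| <= (nrm mu G1 + nrm mu G2) * eta.
  rewrite /err RintB; [|exact: sqintgM..].
  apply: le_trans (ler_normB _ _) _; rewrite mulrDl; apply: lerD.
    by apply: le_trans (cauchy_schwarz SG1 Sd2) _; rewrite ler_wpM2l.
  by apply: le_trans (cauchy_schwarz SG2 Sd1) _; rewrite ler_wpM2l.
have Etau : tau (t + h) = tau t - sigma * h by rewrite /tau; ring.
have A0 : 0 <= h * (- tau t * K + sigma * \int[mu]_z (Q z * weak_curl (v t) z)).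
  by rewrite mulr_ge0// ltW.
have B1 : `|sigma * h * K| <= e / 2.
  apply: le_trans Hd1; rewrite -(mulrA sigma) sgM (normrM h K) (gtr0_norm h0) (mulrC h) mulrA.
  by rewrite ler_wpM2l// ltW.
have B2 : `|(tau t - sigma * h) * err| <= e / 2.
  apply: le_trans Heta; rewrite normrM -mulrA; apply: ler_pM => //.
  apply: le_normB => //; first exact: mulr_ge0 (ltW _) (ltW _).
  by rewrite -[leRHS]mulr1 ler_pM2l// ltW.
have B3 : - e <= sigma * h * K + (tau t - sigma * h) * err.
  rewrite lerNl (le_trans (ler_norm _))// normrN [e]splitr.
  by apply: le_trans (ler_normD _ _) _; exact: lerD.
have := ler_wpM2l (ltW h0) B3; rewrite mulrN => B4.
rewrite /energy_at Etau lerBlDl -lerBlDr -opprB lerNl (mulrC e).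
apply: le_trans B4 _; apply: le_trans step.
by rewrite lerDr.
Qed.

(** Convexity, now with the tangent taken at t', bounds E(t') - E(t) by the norm of prof'(y') times
    that of y' - y. The latter is small by continuity in H^3. *)
Lemma energy_upper_semicontinuous t e : time_interval T t -> 0 < e ->
  exists2 d, 0 < d & forall t', time_interval T t' -> `|t' - t| < d ->
    energy_at t' <= energy_at t + e.
Proof.
move=> It e0; have [_ [Sob cvH] _ _ _] := Hsol.
have sg0 : 0 < sigma by rewrite divr_gt0.
have sgM x : `|sigma * x| = sigma * `|x| by rewrite (normrM sigma x) (gtr0_norm sg0).
have Sv := Sob t It.
have So : sqintg mu (weak_curl (v t)).
  by have [w1 _] := has_d_weak_curl Sv; exact: regular_sqintg (has_d_regular w1).
set n := nrm mu (weak_curl (v t)); have n0 : 0 <= n by exact: nrm_ge0.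
(* Since prof' y <= 2 |y|, this bounds the norm of prof'(y') as soon as y' is within distance 1 of
   y. *)
pose C := 2 * (`|tau t| * n + 1).
have C0 : 0 <= C by rewrite mulr_ge0// addr_ge0// mulr_ge0.
have [r0 r00 Hr0] := small_factor C0 e0.
pose r := Num.min 1 r0.
have r0' : 0 < r by rewrite lt_min ltr01.
have r1 : r <= 1 by rewrite ge_min lexx.
have rC : C * r <= e by apply: le_trans Hr0; rewrite ler_wpM2l// ge_min lexx orbT.
have r20 : 0 < r / 2 by rewrite divr_gt0.
have a0 : 0 <= sigma * n by rewrite mulr_ge0// ltW.
have [d1 d10 Hd1] := small_factor a0 r20.
have a1 : 0 <= 2 * (`|tau t| + sigma) by rewrite mulr_ge0// addr_ge0// ltW.
have [eta eta0 Heta] := small_factor a1 r20.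
have Fw : Filter (within (time_interval T) (nbhs t)) by exact: within_filter.
have := cvg0_near Fw (cvH t It) eta0; rewrite near_withinE => /near_ball[d2 d20 Hd2].
exists (Num.min 1 (Num.min d1 d2)); first by rewrite !lt_min ltr01 d10 d20.
move=> t' It'; rewrite !lt_min => /and3P[td td1 td2].
have := Hd2 t' td2 It' => Hn.
have Sv' := Sob t' It'.
have So' : sqintg mu (weak_curl (v t')).
  by have [w1 _] := has_d_weak_curl Sv'; exact: regular_sqintg (has_d_regular w1).
have Nd : nrm mu (fun z => weak_curl (v t') z - weak_curl (v t) z) <= 2 * eta.
  rewrite -lee_fin; apply: le_trans (nrm_weak_curlB (isT : 1 <= 3)%N Sv' Sv) _.
  by rewrite mulr2n mulrDl mul1r EFinD; apply: leeD; exact: ltW.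
pose y z := - tau t * weak_curl (v t) z; pose y' z := - tau t' * weak_curl (v t') z.
have Sy : sqintg mu y by exact: sqintgZ.
have Sy' : sqintg mu y' by exact: sqintgZ.
have Syy := sqintgB Sy Sy'; have Syy' := sqintgB Sy' Sy.
have tt' : `|tau t' - tau t| <= sigma * `|t' - t|.
  have -> : tau t' - tau t = - (sigma * (t' - t)) by rewrite /tau; ring.
  by rewrite normrN sgM.
have Nyy : nrm mu (fun z => y' z - y z) <= r.
  have Sd := sqintgB So' So.
  rewrite (@eq_nrm _ _ _ mu _ (fun z => (- tau t') * (weak_curl (v t') z - weak_curl (v t) z) +
      (tau t - tau t') * weak_curl (v t) z)); last first.
    by move=> z; rewrite /y /y'; move: (weak_curl _ z) (weak_curl _ z) => a b; ring.
  apply: le_trans (nrmD (sqintgZ _ Sd) (sqintgZ _ So)) _.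
  rewrite nrmZ// nrmZ// (normrN (tau t')) (distrC (tau t)) -/n.
  have h1 : `|tau t'| <= `|tau t| + sigma.
    rewrite (_ : tau t' = tau t + (tau t' - tau t)); last by ring.
    apply: le_trans (ler_normD _ _) _; rewrite lerD2l; apply: le_trans tt' _.
    by rewrite -[leRHS]mulr1 ler_pM2l// ltW.
  have h2 : `|tau t'| * nrm mu (fun z => weak_curl (v t') z - weak_curl (v t) z) <= r / 2.
    apply: le_trans Heta; rewrite (mulrC 2) -mulrA.
    by apply: ler_pM => //; exact: nrm_ge0.
  have h3 : `|tau t' - tau t| * n <= r / 2.
    apply: le_trans Hd1; rewrite mulrAC ler_wpM2r//; apply: le_trans tt' _.
    by rewrite ler_pM2l// ltW.
  by rewrite [r]splitr; exact: lerD.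
have Ny' : nrm mu y' <= `|tau t| * n + 1.
  rewrite (@eq_nrm _ _ _ mu _ (fun z => y z + (y' z - y z))); last by move=> z; ring.
  apply: le_trans (nrmD Sy Syy') _; apply: lerD; last exact: le_trans Nyy r1.
  by rewrite nrmZ// normrN.
have Nq : nrm mu (fun z => prof' (y' z)) <= C.
  apply: (@le_trans _ _ (nrm mu (fun z => 2 * y' z))).
    apply: nrm_le_ae; [exact: sqintg_prof'|exact: sqintgZ|].
    apply: aeW => z; rewrite ger0_norm ?prof'_ge0// normrM ger0_norm//; exact: prof'_le.
  by rewrite nrmZ// ger0_norm// ler_wpM2l.
have step := prof_convex_Rint Sy' Sy.
have := cauchy_schwarz (sqintg_prof' Sy') Syy.
rewrite (_ : nrm mu (fun z => y z - y' z) = nrm mu (fun z => y' z - y z)); last first.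
  by rewrite -(nrmN Syy); apply: eq_nrm => z; rewrite opprB.
move=> cs; have {cs} := le_trans cs (ler_pM (nrm_ge0 _ _) (nrm_ge0 _ _) Nq Nyy).
rewrite ler_norml => /andP[h _].
rewrite /energy_at /energy -/y -/y' -lerBlDl -opprB lerNl; apply: le_trans step.
by apply: le_trans h; rewrite lerN2.
Qed.

End energy.

(** * Initial positivity of the energy and the bound on the blow-up time *)

Section blowup.
Variable R : realType.
Notation mR := (measurableTypeR R).
Notation mu := (leb2 R).
Implicit Types (u g q Q G o : R * R -> R) (f p w : R * R -> R * R) (z : R * R) (h s t tau sigma : R).

Lemma ae_weak_curl w p : sobolevv 3 w -> sobolevv 3 p -> ae_eq mu setT w p ->
  ae_eq mu setT (weak_curl w) (weak_curl p).
Proof.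
move=> [W1 W2] [P1 P2] wp.
have [_ w1] := weak_partial_wd W1 isT; have [w2 _] := weak_partial_wd W2 isT.
have [_ p1] := weak_partial_wd P1 isT; have [p2 _] := weak_partial_wd P2 isT.
have [S1 _ _] := p1; have [S2 _ _] := p2.
have wp1 : ae_eq mu setT (comp1 w) (comp1 p).
  by move: wp; apply: ae_mono => z h Iz; rewrite /comp1 (h Iz).
have wp2 : ae_eq mu setT (comp2 w) (comp2 p).
  by move: wp; apply: ae_mono => z h Iz; rewrite /comp2 (h Iz).
have E1 := wdE (ae_wd S1 wp1 w1) p1; have E2 := wdE (ae_wd S2 wp2 w2) p2.
apply: ae_mono2 E1 E2 => z /= h1 h2 Iz; rewrite /weak_curl.
exact: (congr2 (fun a b : R => a - b) (h2 Iz) (h1 Iz)).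
Qed.

Lemma ae_energy tau u o : measurable_fun setT (u : mR * mR -> R) ->
  measurable_fun setT (o : mR * mR -> R) -> ae_eq mu setT u o -> energy tau u = energy tau o.
Proof.
move=> mu_ mo uo; have mp : measurable_fun setT (@prof R).
  by apply: continuous_measurable_fun; exact: continuous_prof.
apply: ae_Rint.
- by apply: (measurableT_comp mp); exact: measurable_funM.
- by apply: (measurableT_comp mp); exact: measurable_funM.
- by move: uo; apply: ae_mono => z h Iz; rewrite (h Iz).
Qed.

Lemma energy0 u : energy 0 u = 0.
Proof.
have [p0 _ _] := prof0 R; rewrite /energy (@eq_Rint _ _ _ _ _ (fun=> 0)).
  by rewrite /Rintegral integral0.
by move=> z; rewrite oppr0 mul0r.
Qed.

Lemma Rint_orect x1 y1 x2 y2 : x1 < y1 -> x2 < y2 ->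
  \int[mu]_z (\1_(orect x1 y1 x2 y2) z : R) = (y1 - x1) * (y2 - x2).
Proof.
move=> h1 h2; rewrite /Rintegral integral_indic//; last exact: measurable_orect.
rewrite setIT leb2X; [|exact: measurable_itv..].
by rewrite !lebesgue_measure_itv/= !lte_fin h1 h2.
Qed.

(** Continuity turns the value at the single point [x0] into a square of positive measure on which
    the profile exceeds half that value. *)
Lemma energy_gt0 tau o x0 : continuous o -> sqintg mu o -> 1 < - tau * o x0 ->
  0 < energy tau o.
Proof.
move=> co So h1; pose k := prof (- tau * o x0); have k0 : 0 < k by exact: prof_gt0.
have cP : continuous (fun z => prof (- tau * o z)).
  move=> z; apply: (@continuous_comp _ _ _ (fun z => - tau * o z) (@prof R)).
    by apply: continuousM; [exact: cvg_cst|exact: co].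
  exact: continuous_prof.
have k20 : 0 < k / 2 by rewrite divr_gt0.
have : \forall z \near x0, k / 2 < prof (- tau * o z).
  by apply: (cvgr_gt (prof (- tau * o x0)) (cP x0)); rewrite -/k; lra.
move=> /nbhs_ballP[d /= d0 Hd].
pose D := orect (x0.1 - d) (x0.1 + d) (x0.2 - d) (x0.2 + d).
have ID : intg mu (\1_D : R * R -> R).
  have [_] := @sqintg_orect R (x0.1 - d) (x0.1 + d) (x0.2 - d) (x0.2 + d).
  by apply: eq_intg => z; rewrite -/D indicE expr2 -natrM mulnb andbb.
apply: (@lt_le_trans _ _ (\int[mu]_z (k / 2 * \1_D z))).
  rewrite RintZ// mulr_gt0// Rint_orect; [|lra..].
  by rewrite mulr_gt0//; lra.
apply: le_Rint; [exact: intgZ|by apply: intg_prof; exact: sqintgZ|].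
move=> z; rewrite indicE; case: (boolP (z \in D)) => [|_]; last by rewrite mulr0 prof_ge0.
rewrite inE mulr1 => /orectE/= /andP[/andP[a1 a2] /andP[b1 b2]].
apply/ltW/Hd; split; rewrite /ball /=; rewrite ltr_norml; lra.
Qed.

End blowup.

Theorem theorem3p2 (R : realType) (alpha : R) (v0 : R * R -> R * R)
  (omega0 : R * R -> R) (m : R) (v : R -> R * R -> R * R) (Tstar : \bar R) :
  0 < alpha -> alpha < pi / 2 ->
  sobolevv 3 v0 -> divergence_free v0 ->
  continuous omega0 -> ae_eq (leb2 R) setT omega0 (weak_curl v0) ->
  is_min omega0 m -> m < 0 ->
  maximal_solution alpha v0 v Tstar ->
  (Tstar < +oo)%E /\ (Tstar <= (- (2 / (sin alpha * m)))%:E)%E.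
Proof.
move=> alpha0 alpha1 Hv0 _ co oE [[x0 ox0] _] m0 [Hsol _].
have s0 : 0 < sin alpha.
  by apply: sin_gt0_pi; rewrite alpha0/= (lt_trans alpha1)//; have := pi_gt0 R; lra.
have s00 : sin alpha != 0 by rewrite gt_eqF.
have m00 : m != 0 by rewrite lt_eqF.
suff H : (Tstar <= (- (2 / (sin alpha * m)))%:E)%E.
  by split => //; apply: le_lt_trans H (ltry _).
apply/lee_addgt0Pr => e e0; rewrite -EFinD leNgt; apply/negP => ltT.
set T1 := - _ + e in ltT.
(* [tau0] is chosen so that tau vanishes exactly at [T1], a time that the solution is assumed to
   pass. *)
pose sigma := sin alpha / 2; pose tau0 := sigma * T1.
have sg0 : 0 < sigma by rewrite divr_gt0.
have T1E : T1 = - (2 / (sin alpha * m)) + e by [].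
(* The excess sigma e over - 1/m puts - tau0 m strictly above 1, inside the region where the profile
   is positive. *)
have tE : tau0 = - m^-1 + sigma * e.
  by rewrite /tau0 T1E /sigma; field; rewrite s00 m00.
have T10 : 0 < T1.
  by rewrite T1E addr_gt0// oppr_gt0 pmulr_rlt0// invr_lt0 pmulr_rlt0.
have IT t : 0 <= t <= T1 -> time_interval Tstar t.
  by move=> /andP[t0 t1]; split=> //; apply: le_lt_trans ltT; rewrite lee_fin.
pose E t := energy (tau0 - sigma * t) (weak_curl (v t)).
have : E 0 <= E T1.
  apply: (nonneg_dini_le T10) => t.
    move=> /andP[t0 t1] e' e'0.
    have tau_ge0 : 0 <= tau0 - sigma * t by rewrite subr_ge0 ler_pM2l// ltW.
    have It : time_interval Tstar t by apply: IT; rewrite t0 ltW.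
    have [d d0 Hd] := energy_right_lower Hsol s0 It tau_ge0 e'0.
    exists d => // h hd hT; apply: Hd => //; apply: IT; rewrite hT andbT.
    by rewrite addr_ge0// ltW//; case/andP: hd.
  move=> /andP[t0 t1] e' e'0.
  have It : time_interval Tstar t by apply: IT; rewrite t1 ltW.
  have [d d0 Hd] := energy_upper_semicontinuous tau0 Hsol s0 It e'0.
  by exists d => // t' /IT It'; exact: Hd.
rewrite {2}/E /tau0 subrr energy0; apply/negP; rewrite -ltNge.
have [_ [Sob _] _ _ v00] := Hsol.
have S0 : sobolevv 3 (v 0) by apply: Sob; apply: IT; rewrite lexx ltW.
have o00 := ae_weak_curl S0 Hv0 v00.
have So : sqintg (leb2 R) (weak_curl (v 0)).
  by have [w1 _] := has_d_weak_curl S0; exact: regular_sqintg (has_d_regular w1).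
have mo : measurable_fun setT (omega0 : measurableTypeR R * measurableTypeR R -> R).
  exact: continuous_plane_measurable.
have oo : ae_eq (leb2 R) setT (weak_curl (v 0)) omega0.
  by apply: ae_mono2 o00 oE => z h1 h2 Iz; rewrite (h1 Iz) (h2 Iz).
rewrite /E (ae_energy _ So.1 mo oo) mulr0 subr0.
apply: (energy_gt0 co (ae_sqintg mo oo So) (x0 := x0)).
rewrite ox0 tE (_ : - _ * m = 1 + sigma * e * (- m)).
  by rewrite ltrDl mulr_gt0 ?oppr_gt0// mulr_gt0.
by field.
Qed.
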